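(* Let $F_3$ be a truly three-dimensional probability distribution on $\mathbb{Z}^3$ with mean zero and finite variance under which the three coordinates are independent, let $(a_n)_{n\ge 1}$ be a strictly increasing sequence of positive integers, and let $\{S_k\}$ be the $\mathbb{Z}^1$ in $\mathbb{Z}^3$ random walk in varying dimension determined by $F_3$ and $(a_n)$. Put $$\phi_1(n)=\sqrt{\frac{a_{n+1}-a_n}{a_{n+1}}},\qquad n\ge 1 .$$ (i) If $\sum_{n} n^{-1}\phi_1(n)<\infty$, then $\{S_k\}$ is transient. (ii) If $\sum_{n} n^{-1}\phi_1(n)=\infty$ and the sequence $\{\phi_1(n)\}$ is nonincreasing, then $\{S_k\}$ is recurrent.
   Context: A distribution on $\mathbb{Z}^D$ is truly $D$-dimensional if it is not supported on any proper linear subspace of $\mathbb{R}^D$. For $d<D$, the $\mathbb{Z}^d$ in $\mathbb{Z}^D$ random walk in varying dimension determined by a distribution $F_D$ on $\mathbb{Z}^D$ and an increasing sequence $(a_n)_{n\ge1}$ is the process $\{S_k\}_{k\ge 0}$ in $\mathbb{Z}^D$ with $S_0=0$ and independent increments $S_k-S_{k-1}$ ($k\ge1$), where $S_k-S_{k-1}$ has distribution $F_D$ if $k\in\{a_n:n\ge1\}$, and has distribution $F_d$ otherwise; here $F_d$ is the projection of $F_D$ to the first $d$ coordinates (the remaining $D-d$ coordinates of the increment being $0$). The process is recurrent if almost surely $S_k=0$ for infinitely many $k$, and transient if almost surely $S_k=0$ for only finitely many $k$. *)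

(* Defs.v *)
From HB Require Import structures.
From mathcomp Require Import all_boot all_order all_algebra finmap.
From mathcomp Require Import all_classical all_reals all_analysis.

Set Implicit Arguments.
Unset Strict Implicit.
Unset Printing Implicit Defensive.

Import Order.TTheory GRing.Theory Num.Theory.

Local Open Scope classical_set_scope.
Local Open Scope ring_scope.

(* Z^D with the discrete sigma-algebra.  The alias keeps this structure off the
   bare matrix type. *)
Definition lattice (D : nat) : Type := 'rV[int]_D.

HB.instance Definition _ D := GRing.Zmodule.on (lattice D).
HB.instance Definition _ D := isPointed.Build (lattice D) 0.
HB.instance Definition _ D := @isMeasurable.Build default_measure_display
  (lattice D) discrete_measurable discrete_measurable0
  discrete_measurableC discrete_measurableU.

Definition lattice_coord (R : realType) (D : nat) (i : 'I_D) (x : lattice D) : R :=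
  ((x : 'rV[int]_D) 0 i)%:~R.

Definition to_real (R : realType) (D : nat) (x : lattice D) : 'rV[R]_D :=
  \row_i lattice_coord R i x.

(* The projection to the first d coordinates, seen inside Z^D. *)
Definition proj_first (d D : nat) (x : lattice D) : lattice D :=
  \row_(i < D) if (i < d)%N then (x : 'rV[int]_D) 0 i else 0.

Definition truly_dimensional (R : realType) (D : nat)
    (F : probability (lattice D) R) : Prop :=
  forall V : {vspace 'rV[R]_D}, V != fullv ->
    F [set x | to_real R x \in V] != 1%E.

Definition mean_zero (R : realType) (D : nat)
    (F : probability (lattice D) R) : Prop :=
  forall i : 'I_D, F.-integrable [set: lattice D] (EFin \o lattice_coord R i) /\
    ('E_F[lattice_coord R i] = 0)%E.

Definition finite_variance (R : realType) (D : nat)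
    (F : probability (lattice D) R) : Prop :=
  forall i : 'I_D, ('V_F[lattice_coord R i] < +oo)%E.

Definition mutually_independent (R : realType)
    (d d' : measure_display) (T : measurableType d) (T' : measurableType d')
    (P : probability T R) (I : choiceType) (X : I -> T -> T') : Prop :=
  forall (J : {fset I}) (B : I -> set T'), (forall i, measurable (B i)) ->
    P (\bigcap_(i in [set` J]) (X i @^-1` B i)) =
    (\prod_(i <- J) P (X i @^-1` B i))%E.

Definition increment (T : Type) (D : nat) (S : nat -> T -> lattice D)
  (k : nat) (w : T) : lattice D := S k.+1 w - S k w.

(* The sequence a is indexed from 1: the value a 0 is never used.
   The k-th increment below is the step from time k to time k + 1. *)
Definition varying_dimension_walk (R : realType) (d D : nat)
    (F : probability (lattice D) R) (a : nat -> nat)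
    (disp : measure_display) (T : measurableType disp) (P : probability T R)
    (S : nat -> T -> lattice D) : Prop :=
  [/\ forall w, S 0%N w = 0,
      forall k, measurable_fun [set: T] (increment S k),
      mutually_independent P (increment S) &
      forall (k : nat) (A : set (lattice D)),
        pushforward P (increment S k) A =
        if k.+1 \in a @` [set n | (1 <= n)%N] then F A
        else pushforward F (@proj_first d D) A].

Definition recurrent (R : realType) (D : nat) (disp : measure_display)
    (T : measurableType disp) (P : probability T R)
    (S : nat -> T -> lattice D) : Prop :=
  {ae P, forall w, infinite_set [set k | S k w = 0]}.

Definition transient (R : realType) (D : nat) (disp : measure_display)
    (T : measurableType disp) (P : probability T R)
    (S : nat -> T -> lattice D) : Prop :=
  {ae P, forall w, finite_set [set k | S k w = 0]}.

Definition phi1 (R : realType) (a : nat -> nat) (n : nat) : R :=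
  Num.sqrt (((a n.+1)%:R - (a n)%:R) / (a n.+1)%:R).

(* Main.v *)
From HB Require Import structures.
Require Import Defs.
From mathcomp Require Import all_boot all_order all_algebra.
From mathcomp Require Import all_classical all_reals all_analysis.
From mathcomp Require finmap.
From mathcomp Require Import measurable_realfun ring lra zify.

(** While [a n <= k < a n.+1] the last two coordinates have made [n] steps and do
    not move, so in this window the walk is a one-dimensional walk that can reach
    the origin only if the frozen coordinates vanish.  These vanish with
    probability of order [1 / n], and the first coordinate visits zero during the
    window with probability of order [phi1 n].  Hence the origin is visited in
    window [n] with probability of order [phi1 n / n].

    For convergence this gives transience by the Borel-Cantelli lemma.  The upper
    bound comes from counting: the number of zeros of the first coordinate in
    twice the window has mean of order [gap / sqrt (a n.+1)], while after a first
    visit it is at least a Green function, of order [sqrt gap]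
    ([visit_window_le], [green_ge], [visit_prob_le]).

    For divergence the number of visits, those in a window being weighted by the
    inverse root of its length, has mean of order [Phi N], the partial sum of the
    series, up to window [N].  Since [phi1] decreases, the windows grow regularly
    enough for two visits to be nearly independent, and the second moment is of
    order [Phi N ^ 2] ([kernel_sum], [windows_ge], [union_ge_second_moment]).  So
    a return has probability at least some [c > 0], and the estimate holds with the
    same [c] from every position the walk can occupy at any time ([return_from]).
    Therefore the probability of staying away from the origin for ever shrinks by
    the factor [1 - c] each time it is restarted, and it is zero
    ([avoid_contract], [avoid_null]).

    Both parts rest on estimates for a centred integer walk of finite variance:
    the law after [k] steps is at most of order [k ^-1/2] everywhere
    ([return_le]), and at least of that order at the origin, along multiples of a
    fixed [L] and from any reachable starting point ([return_ge]).  With fixed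
    probability a step is a fair choice between two values, so binomial
    coefficients bound the law and its differences ([smooth_sup], [smooth_diff]).
    The Green function up to time [m] is at least
    of order [sqrt m], which with the upper bound yields times [j] of every order
    at which the return probability is of order [j ^-1/2]; the law being smooth,
    it stays so for a while after [j] and at sums of such times, and these sums
    exhaust all large times ([good_time_exists], [good_times_extend],
    [good_times_add], [return_ge_lattice]). *)

Set Implicit Arguments.
Unset Strict Implicit.
Unset Printing Implicit Defensive.

Import Order.TTheory GRing.Theory Num.Theory.

Local Open Scope classical_set_scope.
Local Open Scope ring_scope.

(** * Binomial coefficients *)

Lemma bin_le_succ (M i : nat) : (2 * i + 1 <= M)%N -> ('C(M, i) <= 'C(M, i.+1))%N.
Proof.
move=> h; have e := mul_bin_left M i.
have : (i.+1 * 'C(M, i) <= i.+1 * 'C(M, i.+1))%N.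
  by rewrite e leq_mul2r; apply/orP; right; lia.
by rewrite leq_mul2l.
Qed.

Lemma bin_le_middle (M j i : nat) :
  (j <= i)%N -> (2 * i <= M + 1)%N -> ('C(M, j) <= 'C(M, i))%N.
Proof.
elim: i => [|i IH] ji iM; first by have -> : j = 0%N by lia.
move: ji; rewrite leq_eqVlt => /orP[/eqP->//|ji].
apply: (@leq_trans 'C(M, i)); first by apply: IH; lia.
by apply: bin_le_succ; lia.
Qed.

Lemma sum_bin (M : nat) : (\sum_(0 <= i < M.+1) 'C(M, i) = 2 ^ M)%N.
Proof.
rewrite big_mkord (expnDn 1 1 M); apply: eq_bigr => i _.
by rewrite !exp1n !muln1.
Qed.

(** The coefficients from [j] to the middle of the row are at least
    ['C(M, j)], and together they are at most [2 ^ M]. *)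
Lemma bin_dev_left (M j : nat) :
  (2 * j <= M)%N -> ((M - 2 * j) * 'C(M, j) <= 2 * 2 ^ M)%N.
Proof.
move=> h.
have h1 : ((M./2.+1 - j) * 'C(M, j) <= 2 ^ M)%N.
  rewrite -sum_bin (@big_cat_nat _ _ _ j) //=; last by lia.
  apply: leq_trans (leq_addl _ _).
  rewrite (@big_cat_nat _ _ _ M./2.+1) //=; [|lia|lia].
  apply: leq_trans (leq_addr _ _).
  rewrite -sum_nat_const_nat big_nat_cond [leqRHS]big_nat_cond.
  apply: leq_sum => i /andP[/andP[ji iM] _].
  by apply: bin_le_middle => //; lia.
apply: (@leq_trans (2 * ((M./2.+1 - j) * 'C(M, j)))); last by rewrite leq_mul2l h1.
by rewrite mulnA leq_mul2r; apply/orP; right; lia.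
Qed.

(** Induction on [n]: passing to [n.+1] multiplies the left side by
    [4 * (2 * n + 1) * (2 * n + 3) / n.+1 ^ 2 <= 16]. *)
Lemma central_bin_bound (n : nat) : ('C(2 * n, n) ^ 2 * (2 * n + 1) <= 16 ^ n)%N.
Proof.
elim: n => [//|n IH].
have e1 : (n.+1 * 'C(2 * n.+1, n.+1) = (2 * n + 2) * 'C((2 * n).+1, n))%N.
  have -> : (2 * n.+1 = (2 * n).+2)%N by lia.
  by rewrite -(mul_bin_diag (2 * n).+2 n) /=; congr (_ * _)%N; lia.
have e2 : ((2 * n + 1) * 'C(2 * n, n) = n.+1 * 'C((2 * n).+1, n))%N.
  have e := mul_bin_down (2 * n).+1 n; rewrite /= in e.
  have e' : ((2 * n).+1 - n = n.+1)%N by lia.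
  by rewrite e' in e; rewrite -e addn1.
have e3 : (n.+1 * 'C(2 * n.+1, n.+1) = 2 * (2 * n + 1) * 'C(2 * n, n))%N by nia.
rewrite -(leq_pmul2l (ltn0Sn n)) -(leq_pmul2l (ltn0Sn n)).
have -> : (n.+1 * (n.+1 * ('C(2 * n.+1, n.+1) ^ 2 * (2 * n.+1 + 1))) =
  (n.+1 * 'C(2 * n.+1, n.+1)) ^ 2 * (2 * n.+1 + 1))%N by ring.
rewrite e3 [(16 ^ n.+1)%N]expnS.
have -> : ((2 * (2 * n + 1) * 'C(2 * n, n)) ^ 2 * (2 * n.+1 + 1) =
  ('C(2 * n, n) ^ 2 * (2 * n + 1)) * (4 * ((2 * n + 1) * (2 * n.+1 + 1))))%N by ring.
have -> : (n.+1 * (n.+1 * (16 * 16 ^ n)) = 16 ^ n * (4 * (4 * (n.+1 * n.+1))))%N by ring.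
by apply: leq_mul => //; rewrite leq_mul2l /=; nia.
Qed.

Section BinReal.
Variable R : realType.

Lemma bin_dev (M j : nat) :
  `|M%:R - 2 * j%:R| * 'C(M, j)%:R <= 2 * 2 ^+ M :> R.
Proof.
case: (ltnP M j) => [Mj|jM]; first by rewrite bin_small // mulr0 mulr_ge0 ?exprn_ge0.
case: (leqP (2 * j) M) => h.
  have -> : M%:R - 2 * j%:R = (M - 2 * j)%N%:R :> R by rewrite natrB // natrM.
  rewrite ger0_norm // -natrM -natrX -natrM ler_nat; exact: bin_dev_left.
have h' : (2 * (M - j) <= M)%N by lia.
have -> : M%:R - 2 * j%:R = - (M - 2 * (M - j))%N%:R :> R.
  by rewrite natrB // natrM natrB //; ring.
rewrite normrN ger0_norm // -(bin_sub jM) -natrM -natrX -natrM ler_nat.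
exact: bin_dev_left.
Qed.

(** Up to the factor [M + 1] the difference of two neighbours is the coefficient
    ['C(M.+1, j.+1)] times its distance from the middle of the row, which
    [bin_dev] controls. *)
Lemma bin_step (M j : nat) :
  `|'C(M, j.+1)%:R - 'C(M, j)%:R| / 2 ^+ M <= 4 / (M%:R + 1) :> R.
Proof.
case: (ltnP M j) => [Mj|jM].
  by rewrite !bin_small ?subrr ?normr0 ?mul0r ?divr_ge0 ?addr_ge0//; lia.
have p : (0 : R) < M%:R + 1 by rewrite ltr_wpDl.
have p2 : (0 : R) < 2 ^+ M by rewrite exprn_gt0.
rewrite ler_pdivrMr // mulrAC ler_pdivlMr // -[X in _ * X](gtr0_norm p) -normrM.
have e1 : (M%:R + 1) * 'C(M, j.+1)%:R = (M%:R - j%:R) * 'C(M.+1, j.+1)%:R :> R.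
  have := congr1 (fun n : nat => n%:R : R) (mul_bin_down M.+1 j.+1).
  by rewrite /= subSS !natrM natrB // -natr1.
have e2 : (M%:R + 1) * 'C(M, j)%:R = (j%:R + 1) * 'C(M.+1, j.+1)%:R :> R.
  have := congr1 (fun n : nat => n%:R : R) (mul_bin_diag M.+1 j).
  by rewrite /= !natrM -!natr1.
have -> : ('C(M, j.+1)%:R - 'C(M, j)%:R) * (M%:R + 1) =
  (M.+1%:R - 2 * j.+1%:R) * 'C(M.+1, j.+1)%:R :> R.
  rewrite mulrBl ![_ * (_ + 1)]mulrC e1 e2 -!natr1; ring.
have := bin_dev M.+1 j.+1; rewrite normrM (ger0_norm (ler0n _ _)) exprS.
move=> h; apply: (le_trans h); lra.
Qed.

Lemma bin_sup (M j : nat) : 'C(M, j)%:R / 2 ^+ M <= 2 / Num.sqrt (M%:R + 1) :> R.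
Proof.
have pM : forall M : nat, (0 : R) < M%:R + 1 by move=> ?; rewrite ltr_wpDl.
have p2 : (0 : R) < 2 ^+ M by rewrite exprn_gt0.
(* even rows come from the central coefficient; an odd row is bounded by the
   even row below it *)
have ev n i : 'C(2 * n, i)%:R ^+ 2 * (2 * n%:R + 1) <= (2 ^+ (2 * n)) ^+ 2 :> R.
  have h : ('C(2 * n, i) <= 'C(2 * n, n))%N.
    case: (leqP i n) => ?; first by apply: bin_le_middle => //; lia.
    case: (leqP i (2 * n)) => [i2|i2]; last by rewrite bin_small.
    by rewrite -(bin_sub i2); apply: bin_le_middle; lia.
  rewrite -!natrX -natrM natr1 -natrM ler_nat -expnM.
  have -> : (2 ^ (2 * n * 2) = 16 ^ n)%N by rewrite (_ : (2 * n * 2 = 4 * n)%N) ?expnM //; lia.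
  apply: leq_trans (central_bin_bound n).
  by rewrite addn1 leq_mul2r leq_exp2r // h orbT.
have sq : ('C(M, j)%:R : R) ^+ 2 * (M%:R + 1) <= 4 * (2 ^+ M) ^+ 2.
  have := odd_double_half M; case: (odd M) => /=; last first.
    move=> <-; rewrite add0n -mul2n natrM.
    by apply: (le_trans (ev _ _)); have := sqr_ge0 ((2 : R) ^+ (2 * M./2)); lra.
  move=> <-; rewrite add1n -mul2n; set n := M./2.
  have h : ('C((2 * n).+1, j)%:R : R) <= 2 * 'C(2 * n, n)%:R.
    case: j => [|j].
      by rewrite bin0 -natrM ler_nat; have := bin_gt0 (2 * n) n; lia.
    have l i : ('C(2 * n, i) <= 'C(2 * n, n))%N.
      case: (leqP i n) => ?; first by apply: bin_le_middle => //; lia.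
      case: (leqP i (2 * n)) => [i2|i2]; last by rewrite bin_small.
      by rewrite -(bin_sub i2); apply: bin_le_middle; lia.
    by rewrite binS -natrM ler_nat; have := l j; have := l j.+1; lia.
  have h2 : ('C((2 * n).+1, j)%:R : R) ^+ 2 <= 4 * 'C(2 * n, n)%:R ^+ 2.
    have -> : 4 * 'C(2 * n, n)%:R ^+ 2 = (2 * 'C(2 * n, n)%:R) ^+ 2 :> R by ring.
    by rewrite ler_pXn2r // nnegrE ?mulr_ge0.
  have e := ev n n.
  rewrite [2 ^+ (2 * n).+1]exprS -[X in X + 1]natr1 natrM.
  have n0 : (0 : R) <= n%:R by [].
  have c0 : 0 <= ('C(2 * n, n)%:R : R) ^+ 2 by exact: sqr_ge0.
  have n2 : 0 <= 2 * n%:R + 1 + 1 :> R by lra.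
  have k1 := ler_wpM2r n2 h2.
  have k2 := mulr_ge0 c0 n0.
  apply: (le_trans k1).
  have -> : 4 * (2 * 2 ^+ (2 * n)) ^+ 2 = 16 * (2 ^+ (2 * n)) ^+ 2 :> R by ring.
  move: e k2 c0; set c := _ ^+ 2; set q := _ ^+ 2; set m := n%:R => e k2 c0.
  rewrite (_ : 4 * c * (2 * m + 1 + 1) = 4 * (c * (2 * m + 1)) + 4 * c); last by ring.
  have -> : c = c * (2 * m + 1) - 2 * (c * m) by ring.
  have : 0 <= q by exact: sqr_ge0.
  lra.
rewrite ler_pdivrMr // mulrAC ler_pdivlMr ?sqrtr_gt0 //.
rewrite -(@ler_pXn2r _ 2) ?nnegrE ?mulr_ge0 ?sqrtr_ge0 ?exprn_ge0 //.
by rewrite exprMn sqr_sqrtr ?exprMn; [lra|exact: ltW].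
Qed.

End BinReal.

(** * Walk operators *)

Section WalkOperators.
Variable R : realType.
Implicit Types (f g : int -> R) (T U : (int -> R) -> int -> R) (s t A c : R).

Definition bnd f : Prop := exists A, forall x, `|f x| <= A.

Definition delta (a : int) : int -> R := fun x => (x == a)%:R.

Definition trunc_sqr A : int -> R := fun x => Num.min (x%:~R ^+ 2) A.

(** The operator [T g x = 'E (g (x + xi))] of a centred integer step [xi] of
    variance [s], reduced to what the estimates need.  It is only applied to
    bounded functions; the variance enters through truncated squares, for which
    [walk_trunc] survives iteration.  Iterates of such an operator are again of
    this kind, so that a walk can be replaced by its [L]-step walk. *)
Record is_walk s T : Prop := IsWalk {
  walkD : forall f g, bnd f -> bnd g ->
    T (fun x => f x + g x) = (fun x => T f x + T g x);
  walkZ : forall c f, bnd f -> T (fun x => c * f x) = (fun x => c * T f x);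
  walk_ge0 : forall f, bnd f -> (forall x, 0 <= f x) -> forall x, 0 <= T f x;
  walk1 : T (fun=> 1) = (fun=> 1);
  walkS : forall h f, T (fun x => f (x + h)) = (fun x => T f (x + h));
  walk_trunc : forall A x, 0 <= A ->
    T (trunc_sqr A) x <= trunc_sqr A x + s }.

Lemma bnd_cst c : bnd (fun=> c).
Proof. by exists `|c|. Qed.

Lemma bndD f g : bnd f -> bnd g -> bnd (fun x => f x + g x).
Proof.
move=> [A hA] [B hB]; exists (A + B) => x.
by apply: le_trans (ler_normD _ _) _; exact: lerD.
Qed.

Lemma bndZ c f : bnd f -> bnd (fun x => c * f x).
Proof.
by move=> [A hA]; exists (`|c| * A) => x; rewrite normrM ler_wpM2l.
Qed.

Lemma bndB f g : bnd f -> bnd g -> bnd (fun x => f x - g x).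
Proof.
move=> hf hg; have := bndD hf (bndZ (-1) hg).
by under [X in bnd X]eq_fun do rewrite mulN1r.
Qed.

Lemma bndS h f : bnd f -> bnd (fun x => f (x + h)).
Proof. by move=> [A hA]; exists A. Qed.

Lemma bnd_sum n (c : 'I_n -> R) (f : 'I_n -> int -> R) :
  (forall i, bnd (f i)) -> bnd (fun x => \sum_(i < n) c i * f i x).
Proof.
move=> hf; elim: n c f hf => [|n IH] c f hf.
  by under [X in bnd X]eq_fun do rewrite big_ord0; exact: bnd_cst.
under [X in bnd X]eq_fun do rewrite big_ord_recr /=.
apply: bndD; last exact: bndZ.
by apply: (IH (fun i => c (widen_ord (leqnSn n) i))
              (fun i => f (widen_ord (leqnSn n) i))).
Qed.

Lemma bnd_delta a : bnd (delta a).
Proof. by exists 1 => x; rewrite /delta; case: eqP; rewrite ?normr1 ?normr0. Qed.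

Lemma delta_ge0 a x : 0 <= delta a x. Proof. exact: ler0n. Qed.

Lemma delta_shift a b : delta (a - b) = (fun x => delta a (x + b)).
Proof. by apply/funext => x; rewrite /delta eq_sym subr_eq eq_sym. Qed.

Lemma bnd_trunc A : 0 <= A -> bnd (trunc_sqr A).
Proof.
move=> A0; exists A => x; rewrite /trunc_sqr ger0_norm ?ge_min ?lexx ?orbT //.
by rewrite le_min sqr_ge0.
Qed.

Section OneOperator.
Variables (s : R) (T : (int -> R) -> int -> R).
Hypothesis WT : is_walk s T.

Lemma walk_cst c : T (fun=> c) = (fun=> c).
Proof.
have e : (fun=> c) = (fun x : int => c * (fun=> 1) x).
  by apply/funext => x; rewrite mulr1.
by rewrite {1}e (walkZ WT c (bnd_cst 1)) (walk1 WT).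
Qed.

Lemma walkB f g : bnd f -> bnd g ->
  T (fun x => f x - g x) = (fun x => T f x - T g x).
Proof.
move=> hf hg; rewrite (_ : (fun x => f x - g x) = (fun x => f x + (-1) * g x)).
  by rewrite (walkD WT hf (bndZ _ hg)) (walkZ WT) //; apply/funext => x; rewrite mulN1r.
by apply/funext => x; rewrite mulN1r.
Qed.

Lemma walk_mono f g : bnd f -> bnd g -> (forall x, f x <= g x) ->
  forall x, T f x <= T g x.
Proof.
move=> hf hg fg x; rewrite -subr_ge0.
have -> : T g x - T f x = T (fun x => g x - f x) x by rewrite walkB.
by apply: (walk_ge0 WT); [exact: bndB|move=> y; rewrite subr_ge0].
Qed.

Lemma walk_le c f : bnd f -> (forall x, f x <= c) -> forall x, T f x <= c.
Proof.
move=> hf fc x; have := walk_mono hf (bnd_cst c) fc x.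
by rewrite walk_cst.
Qed.

Lemma walk_ge c f : bnd f -> (forall x, c <= f x) -> forall x, c <= T f x.
Proof.
move=> hf fc x; have := walk_mono (bnd_cst c) hf fc x.
by rewrite walk_cst.
Qed.

Lemma walk_bnd f : bnd f -> bnd (T f).
Proof.
move=> hf; case: (hf) => A hA; exists A => x; rewrite ler_norml.
rewrite walk_ge ?walk_le // => y; first exact: le_trans (ler_norm _) (hA y).
by have := hA y; rewrite ler_norml => /andP[].
Qed.

Lemma walk_sum n (c : 'I_n -> R) (f : 'I_n -> int -> R) : (forall i, bnd (f i)) ->
  T (fun x => \sum_(i < n) c i * f i x) = (fun x => \sum_(i < n) c i * T (f i) x).
Proof.
elim: n c f => [|n IH] c f hf.
  under eq_fun do rewrite big_ord0; rewrite walk_cst.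
  by apply/funext => x; rewrite big_ord0.
under eq_fun do rewrite big_ord_recr /=.
set c' := fun i => c (widen_ord (leqnSn n) i).
set f' := fun i => f (widen_ord (leqnSn n) i).
have e := IH c' f' (fun i => hf _).
rewrite (walkD WT (bnd_sum c' (fun i => hf (widen_ord _ i))) (bndZ _ (hf _))).
rewrite e (walkZ WT) //; apply/funext => x.
by rewrite big_ord_recr.
Qed.

Lemma walk_delta a x : T (delta a) x = T (delta (a - x)) 0.
Proof. by rewrite delta_shift (walkS WT) add0r. Qed.

(** The combination of point masses that agrees with [f] at the points [x + y i]
    lies below [f], and the operator is positive. *)
Lemma walk_atoms n (y : 'I_n -> int) f x : injective y -> bnd f ->
  (forall z, 0 <= f z) ->
  \sum_(i < n) f (x + y i) * T (delta (y i)) 0 <= T f x.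
Proof.
move=> yinj hf f0.
pose g z := \sum_(i < n) f (x + y i) * delta (x + y i) z.
have hg : bnd g by apply: bnd_sum => i; exact: bnd_delta.
have gf z : g z <= f z.
  rewrite /g; have [[i ->]|no] := pselect (exists i, z = x + y i).
    rewrite (bigD1 i) //= big1 => [|j ji].
      by rewrite /delta eqxx mulr1 addr0.
    rewrite /delta; case: eqP => [/addrI/yinj e|]; last by rewrite mulr0.
    by rewrite e eqxx in ji.
  rewrite big1 // => i _; rewrite /delta; case: eqP => [e|]; last by rewrite mulr0.
  by exfalso; apply: no; exists i.
apply: le_trans (walk_mono hg hf gf x).
rewrite /g walk_sum; last by move=> i; exact: bnd_delta.
by apply: ler_sum => i _; rewrite (walk_delta (x + y i) x) (addrC x) addrK.
Qed.

Lemma walk_atom y f x : bnd f -> (forall z, 0 <= f z) ->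
  f (x + y) * T (delta y) 0 <= T f x.
Proof.
move=> hf f0; have := @walk_atoms 1 (fun=> y) f x _ hf f0.
rewrite big_ord_recl big_ord0 addr0; apply => i j _.
by rewrite !ord1.
Qed.

End OneOperator.

Lemma is_walk_id : is_walk 0 id.
Proof. by split => // A x _; rewrite addr0. Qed.

Lemma is_walk_comp s t T U : is_walk s T -> is_walk t U ->
  is_walk (t + s) (fun f => T (U f)).
Proof.
move=> WT WU; split.
- by move=> f g hf hg; rewrite (walkD WU) // (walkD WT) //; exact: (walk_bnd WU).
- by move=> c f hf; rewrite (walkZ WU) // (walkZ WT) //; exact: (walk_bnd WU).
- move=> f hf f0; apply: (walk_ge0 WT); first exact: (walk_bnd WU).
  exact: (walk_ge0 WU).
- by rewrite (walk1 WU) (walk1 WT).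
- by move=> h f; rewrite (walkS WU) (walkS WT).
- move=> A x A0; have bA := bnd_trunc A0.
  apply: le_trans (walk_mono WT (walk_bnd WU bA) (bndD bA (bnd_cst t))
                     (fun y => walk_trunc WU y A0) x) _.
  rewrite (walkD WT bA (bnd_cst t)) (walk_cst WT).
  have := walk_trunc WT x A0; lra.
Qed.

(** Variances of independent steps add. *)
Lemma is_walk_iter s T n : is_walk s T -> is_walk (n%:R * s) (iter n T).
Proof.
move=> WT; elim: n => [|n IH]; first by rewrite mul0r; exact: is_walk_id.
have -> : n.+1%:R * s = n%:R * s + s by rewrite -natr1; ring.
exact: (is_walk_comp WT IH).
Qed.

(** Chebyshev, with the variance entering through [walk_trunc]. *)
Lemma walk_chebyshev s T n (r : nat) : is_walk s T -> (0 < r)%N ->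
  1 - n%:R * s / r%:R ^+ 2 <=
  \sum_(i < (2 * r).+1) iter n T (delta (i%:Z - r%:Z)) 0.
Proof.
move=> WT r0; have W := is_walk_iter n WT.
have r2 : (0 : R) < r%:R ^+ 2 by rewrite exprn_gt0 // ltr0n.
set A := r%:R ^+ 2.
pose g (z : int) := \sum_(i < (2 * r).+1) 1 * delta (i%:Z - r%:Z) z.
have bg : bnd g by apply: bnd_sum => i; exact: bnd_delta.
have bA : bnd (trunc_sqr A) by apply: bnd_trunc; exact: ltW.
have h z : 1 - A^-1 * trunc_sqr A z <= g z.
  have g0 : 0 <= g z by apply: sumr_ge0 => i _; rewrite mul1r delta_ge0.
  case: (leP (`|z|)%N r) => zr.
    have hi : (absz (z + r%:Z)%R < (2 * r).+1)%N by lia.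
    apply: (@le_trans _ _ 1).
      rewrite gerBl mulr_ge0 ?invr_ge0 ?(ltW r2) // /trunc_sqr le_min sqr_ge0.
      exact: ltW.
    rewrite /g (bigD1 (Ordinal hi)) //= {1}/delta.
    have -> : z == (absz (z + r%:Z))%:Z - r%:Z by lia.
    rewrite mul1r ler_wpDr //; apply: sumr_ge0 => i _.
    by rewrite mul1r delta_ge0.
  apply: le_trans g0; rewrite /trunc_sqr min_r.
    by rewrite mulVf ?subrr // gt_eqF.
  rewrite /A -[leRHS]real_normK ?num_real // -intr_norm.
  rewrite ler_pXn2r ?nnegrE ?ler0n ?ler0z //.
  by rewrite -pmulrn ler_nat ltnW.
have -> : \sum_(i < (2 * r).+1) iter n T (delta (i%:Z - r%:Z)) 0 = iter n T g 0.
  rewrite /g (walk_sum W) => [|i]; last exact: bnd_delta.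
  by apply: eq_bigr => i _; rewrite mul1r.
have := walk_mono W (bndB (bnd_cst 1) (bndZ A^-1 bA)) bg h 0.
apply: le_trans.
rewrite (walkB W (bnd_cst 1) (bndZ _ bA)) (walkZ W) // (walk_cst W).
rewrite lerD2l lerN2 mulrC ler_wpM2r ?invr_ge0 ?(ltW r2) //.
apply: le_trans (walk_trunc W 0 (ltW r2)) _.
by rewrite /trunc_sqr mulr0z expr0n /= min_l ?add0r // ltW.
Qed.

End WalkOperators.

(** * Smoothing *)

Definition pair_pt (h : int) (i : 'I_2) : int := if i == ord0 then 0 else h.

Lemma pair_inj (h : int) : h != 0 -> injective (pair_pt h).
Proof.
move=> h0 i j; rewrite /pair_pt.
case: (eqVneq i ord0) => [->|i0]; case: (eqVneq j ord0) => [->|j0] // e.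
- by rewrite -e eqxx in h0.
- by rewrite e eqxx in h0.
apply: val_inj; move: i0 j0; rewrite -!val_eqE /=; move: (ltn_ord i) (ltn_ord j).
by lia.
Qed.

Section Smoothing.
Variable R : realType.
Implicit Types (f g : int -> R) (s A c : R).

Definition avg (h : int) f : int -> R := fun x => 2^-1 * (f x + f (x + h)).

Lemma bnd_avg h f : bnd f -> bnd (avg h f).
Proof. by move=> hf; apply: bndZ; apply: bndD => //; exact: bndS. Qed.

Lemma bnd_avg_iter h M f : bnd f -> bnd (iter M (avg h) f).
Proof. by move=> hf; elim: M => //= M; exact: bnd_avg. Qed.

(** Averaging [M] times gives the binomial law on the progression of step [h]. *)
Lemma avg_iter_delta (h : int) (M : nat) : h != 0 ->
  (forall j : nat, iter M (avg h) (delta R 0) (- (h * j%:Z)) = 'C(M, j)%:R / 2 ^+ M) /\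
  (forall x, (forall j : nat, x <> - (h * j%:Z)) ->
    iter M (avg h) (delta R 0) x = 0).
Proof.
move=> h0; elim: M => [|M [IH1 IH2]]; split => /=.
- move=> j; rewrite /delta oppr_eq0 mulf_eq0 (negPf h0) expr0 divr1.
  by case: j => [|j]; rewrite ?bin0n.
- by move=> x hx; rewrite /delta; case: eqP => // x0; case: (hx 0%N); rewrite mulr0 oppr0.
- case=> [|j]; rewrite /avg IH1 exprS.
    rewrite IH2 => [|j]; last first.
      rewrite mulr0 oppr0 add0r => e.
      have : h * (1 + j%:Z) = 0 by rewrite mulrDr mulr1 {1}e addNr.
      by move/eqP; rewrite mulf_eq0 (negPf h0) /=; lia.
    by rewrite !bin0 addr0 invfM; ring.
  have -> : - (h * j.+1%:Z) + h = - (h * j%:Z) by rewrite -addn1 PoszD; ring.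
  by rewrite IH1 binS natrD invfM; ring.
- move=> x hx; rewrite /avg IH2 // IH2 ?addr0 ?mulr0 // => j e.
  apply: (hx j.+1); rewrite -addn1 PoszD mulrDr mulr1 opprD -e; ring.
Qed.

Lemma avg_iter_delta_le h M x : h != 0 ->
  iter M (avg h) (delta R 0) x <= 2 / Num.sqrt (M%:R + 1).
Proof.
move=> h0; have [f1 f2] := avg_iter_delta M h0.
have [[j ->]|no] := pselect (exists j : nat, x = - (h * j%:Z)).
  by rewrite f1 bin_sup.
by rewrite f2 ?divr_ge0 ?sqrtr_ge0 // => j e; apply: no; exists j.
Qed.

Lemma avg_iter_delta_step h M x : h != 0 ->
  `|iter M (avg h) (delta R 0) x - iter M (avg h) (delta R 0) (x + h)|
    <= 4 / (M%:R + 1).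
Proof.
move=> h0; have [f1 f2] := avg_iter_delta M h0.
have p : (0 : R) < M%:R + 1 by rewrite ltr_wpDl.
have [[j ->]|no] := pselect (exists j : nat, x = - (h * j%:Z)); last first.
  have fx : iter M (avg h) (delta R 0) x = 0.
    by apply: f2 => j e; apply: no; exists j.
  have fxh : iter M (avg h) (delta R 0) (x + h) = 0.
    apply: f2 => j e; apply: no; exists j.+1.
    by rewrite -addn1 PoszD mulrDr mulr1 opprD -e; ring.
  by rewrite fx fxh subrr normr0 divr_ge0 // ltW.
case: j => [|j].
  rewrite f1 f2 => [|j]; last first.
    rewrite mulr0 oppr0 add0r => e.
    have : h * (1 + j%:Z) = 0 by rewrite mulrDr mulr1 {1}e addNr.
    by move/eqP; rewrite mulf_eq0 (negPf h0) /=; lia.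
  have := bin_step R M M; rewrite bin_small // binn bin0 sub0r subr0 normrN normr1.
  by rewrite ger0_norm // divr_ge0 // exprn_ge0.
have -> : - (h * j.+1%:Z) + h = - (h * j%:Z) by rewrite -addn1 PoszD; ring.
rewrite !f1 -mulrBl normrM [`|_^-1|]ger0_norm ?invr_ge0 ?exprn_ge0 //.
exact: bin_step.
Qed.

Variables (s : R) (T : (int -> R) -> int -> R) (h : int) (al : R).
Hypotheses (WT : is_walk s T) (h0 : h != 0) (al0 : 0 < al).
Hypotheses (m0 : al <= T (delta R 0) 0) (mh : al <= T (delta R h) 0).

(** The step law is at least [al] at [0] and at [h]: with probability [2 * al]
    the step is a fair choice between the two. *)
Lemma smooth_step f c x : bnd f -> (forall z, f z <= c) ->
  T f x <= (1 - 2 * al) * c + 2 * al * avg h f x.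
Proof.
move=> hf fc; have yinj := pair_inj h0.
have b := bndB (bnd_cst c) hf.
have fc0 z : 0 <= c - f z by rewrite subr_ge0.
have := walk_atoms WT x yinj b fc0.
rewrite (walkB WT (bnd_cst c) hf) (walk_cst WT).
rewrite !big_ord_recl big_ord0 /= /pair_pt /= !addr0 /avg => e.
have e1 : (c - f x) * al <= (c - f x) * T (delta R 0) 0 by rewrite ler_wpM2l.
have e2 : (c - f (x + h)) * al <= (c - f (x + h)) * T (delta R h) 0.
  by rewrite ler_wpM2l.
lra.
Qed.

Lemma al_half : 2 * al <= 1.
Proof.
have yinj := pair_inj h0.
have := walk_atoms WT 0 yinj (bnd_cst (1 : R)) (fun=> ler01).
rewrite (walk1 WT) !big_ord_recl big_ord0 /= /pair_pt /= !addr0.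
by rewrite !mul1r => e; apply: le_trans e; rewrite mulrDl mul1r; exact: lerD.
Qed.

Lemma walk_avg f : bnd f -> T (avg h f) = avg h (T f).
Proof.
move=> hf; rewrite /avg (walkZ WT); last by apply: bndD => //; exact: bndS.
by rewrite (walkD WT) ?(walkS WT) //; exact: bndS.
Qed.

(** Among [k] steps a binomial number, of mean [2 * al * k], are fair choices.
    A supersolution [psi] of the corresponding one-step recursion turns a bound
    for [M] fair choices into one for [M] fair choices followed by [k] steps. *)
Lemma smooth_iter (psi : R -> R) f : bnd f ->
  (forall y, 1 <= y -> (1 - 2 * al) * psi y + 2 * al * psi (y + 1) <= psi (y + al)) ->
  (forall M x, iter M (avg h) f x <= psi (M%:R + 1)) ->
  forall k M x, iter k T (iter M (avg h) f) x <= psi (M%:R + 1 + al * k%:R).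
Proof.
move=> hf hpsi base; elim=> [|k IH] M x; first by rewrite mulr0 addr0; exact: base.
have bM := bnd_avg_iter h M hf.
have bk N : bnd (iter k T (iter N (avg h) f)).
  elim: k {IH} => [|k IHk] /=; first exact: bnd_avg_iter.
  exact: (walk_bnd WT).
rewrite iterS; apply: le_trans (smooth_step x (bk M) (IH M)) _.
have -> : avg h (iter k T (iter M (avg h) f)) x = iter k T (iter M.+1 (avg h) f) x.
  congr (_ x); rewrite iterS; elim: k {IH bk} => //= k <-.
  rewrite -walk_avg //; elim: k => //= k.
  exact: (walk_bnd WT).
set z := M%:R + 1 + al * k%:R.
have -> : M%:R + 1 + al * k.+1%:R = z + al by rewrite /z -natr1; ring.
apply: le_trans (hpsi z _); last first.
  by rewrite /z -addrA ler_wpDl // ler_wpDr // mulr_ge0 // ltW.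
rewrite lerD2l ler_wpM2l ?mulr_ge0 ?(ltW al0) //.
apply: le_trans (IH _ _) _.
by rewrite /z -natr1 (_ : M%:R + 1 + 1 + al * k%:R = M%:R + 1 + al * k%:R + 1) //; ring.
Qed.

Lemma inv_supersolution A y : 0 <= A -> 1 <= y ->
  (1 - 2 * al) * (A / y) + 2 * al * (A / (y + 1)) <= A / (y + al).
Proof.
move=> A0 y1; have ah := al_half; have a0 := al0.
have y0 : 0 < y by lra.
have y10 : 0 < y + 1 by lra.
have ya0 : 0 < y + al by lra.
suff : (1 - 2 * al) / y + 2 * al / (y + 1) <= (y + al)^-1.
  move=> hh; have := ler_wpM2l A0 hh; rewrite mulrDr; apply: le_trans.
  by rewrite le_eqVlt; apply/orP; left; apply/eqP; ring.
rewrite -(ler_pM2r ya0) mulVf ?gt_eqF // -(ler_pM2r y0) -(ler_pM2r y10).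
have -> : ((1 - 2 * al) / y + 2 * al / (y + 1)) * (y + al) * y * (y + 1) =
  ((1 - 2 * al) * (y + 1) + 2 * al * y) * (y + al) by field; rewrite !gt_eqF.
by nra.
Qed.

(** From [inv_supersolution], by convexity of the square. *)
Lemma sqrt_supersolution A y : 0 <= A -> 1 <= y ->
  (1 - 2 * al) * (A / Num.sqrt y) + 2 * al * (A / Num.sqrt (y + 1))
    <= A / Num.sqrt (y + al).
Proof.
move=> A0 y1; have ah := al_half; have a0 := al0.
have y0 : 0 < y by lra.
have y10 : 0 < y + 1 by lra.
have ya0 : 0 < y + al by lra.
set p := (Num.sqrt y)^-1; set q := (Num.sqrt (y + 1))^-1.
set r := (Num.sqrt (y + al))^-1.
have p0 : 0 <= p by rewrite invr_ge0 sqrtr_ge0.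
have q0 : 0 <= q by rewrite invr_ge0 sqrtr_ge0.
have r0 : 0 <= r by rewrite invr_ge0 sqrtr_ge0.
suff hh : (1 - 2 * al) * p + 2 * al * q <= r.
  have := ler_wpM2l A0 hh; lra.
have := inv_supersolution ler01 y1; rewrite !mul1r.
have -> : y^-1 = p ^+ 2 by rewrite /p exprVn sqr_sqrtr // ltW.
have -> : (y + 1)^-1 = q ^+ 2 by rewrite /q exprVn sqr_sqrtr // ltW.
have -> : (y + al)^-1 = r ^+ 2 by rewrite /r exprVn sqr_sqrtr // ltW.
move=> e; rewrite -(@ler_pXn2r _ 2) ?nnegrE //; last first.
  by apply: addr_ge0; apply: mulr_ge0 => //; lra.
apply: le_trans e.
have : 0 <= (1 - 2 * al) * (2 * al) * (p - q) ^+ 2.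
  by apply: mulr_ge0; [apply: mulr_ge0; lra|exact: sqr_ge0].
nra.
Qed.

Lemma smooth_sup : exists2 C, 0 < C &
  forall k x, iter k T (delta R 0) x <= C / Num.sqrt (k%:R + 1).
Proof.
exists (2 / Num.sqrt al) => [|k x]; first by rewrite divr_gt0 ?sqrtr_gt0.
have ah := al_half; have a0 := al0.
have k0 : 0 <= al * k%:R by rewrite mulr_ge0 // ltW.
have := @smooth_iter (fun y => 2 / Num.sqrt y) _ (bnd_delta R 0) _ _ k 0%N x.
move/(_ (fun y => sqrt_supersolution _)) => H.
apply: le_trans (H _ _) _ => //.
- by move=> M z; exact: avg_iter_delta_le.
rewrite add0r -mulrA ler_wpM2l // -invfM -sqrtrM ?(ltW al0) //.
by rewrite lef_pV2 ?posrE ?sqrtr_gt0 ?ler_sqrt ?mulrDr; lra.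
Qed.

Lemma smooth_diff : exists2 C, 0 < C & forall k x,
  `|iter k T (delta R 0) x - iter k T (delta R 0) (x + h)| <= C / (k%:R + 1).
Proof.
exists (4 / al) => [|k x]; first by rewrite divr_gt0.
have ah := al_half; have a0 := al0.
have k0 : 0 <= al * k%:R by rewrite mulr_ge0 // ltW.
have kk : 4 / (0 + 1 + al * k%:R) <= 4 / al / (k%:R + 1).
  rewrite -mulrA ler_wpM2l // -invfM lef_pV2 ?posrE ?mulrDr; lra.
have W := is_walk_iter k WT.
pose d1 x := delta R 0 x - delta R 0 (x + h).
pose d2 x := delta R 0 (x + h) - delta R 0 x.
have bd := bnd_delta R 0.
have bd1 : bnd d1 by apply: bndB => //; exact: bndS.
have bd2 : bnd d2 by apply: bndB => //; exact: bndS.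
have e1 M : iter M (avg h) d1 = fun x => iter M (avg h) (delta R 0) x -
                                  iter M (avg h) (delta R 0) (x + h).
  by elim: M => //= M ->; apply/funext => z; rewrite /avg; ring.
have e2 M : iter M (avg h) d2 = fun x => iter M (avg h) (delta R 0) (x + h) -
                                  iter M (avg h) (delta R 0) x.
  by elim: M => //= M ->; apply/funext => z; rewrite /avg; ring.
have t1 : iter k T d1 x = iter k T (delta R 0) x - iter k T (delta R 0) (x + h).
  by rewrite /d1 (walkB W) ?(walkS W) //; exact: bndS.
have t2 : iter k T d2 x = iter k T (delta R 0) (x + h) - iter k T (delta R 0) x.
  by rewrite /d2 (walkB W) ?(walkS W) //; exact: bndS.
have hp y : 1 <= y -> (1 - 2 * al) * (4 / y) + 2 * al * (4 / (y + 1)) <= 4 / (y + al).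
  by move=> y1; exact: inv_supersolution.
rewrite ler_norml; apply/andP; split.
  rewrite lerNl opprB -t2; apply: le_trans kk.
  apply: (@smooth_iter (fun y => 4 / y) d2 bd2 hp _ k 0%N x) => M z.
  rewrite e2; apply: le_trans (ler_norm _) _; rewrite distrC.
  exact: avg_iter_delta_step.
rewrite -t1; apply: le_trans kk.
apply: (@smooth_iter (fun y => 4 / y) d1 bd1 hp _ k 0%N x) => M z.
rewrite e1; apply: le_trans (ler_norm _) _.
exact: avg_iter_delta_step.
Qed.

End Smoothing.

(** * Green function *)

Section Green.
Variables (R : realType) (s : R) (T : (int -> R) -> int -> R).
Hypothesis WT : is_walk s T.

Lemma iter_delta_bnd k a : bnd (iter k T (delta R a)).
Proof. exact: (walk_bnd (is_walk_iter k WT) (bnd_delta R a)). Qed.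

Lemma iter_delta_ge0 k a x : 0 <= iter k T (delta R a) x.
Proof.
by apply: (walk_ge0 (is_walk_iter k WT)); [exact: bnd_delta|exact: delta_ge0].
Qed.

Lemma iter_delta_opp k a : iter k T (delta R 0) (- a) = iter k T (delta R a) 0.
Proof. by rewrite (walk_delta (is_walk_iter k WT)) sub0r opprK. Qed.

(** Maximum principle: off the origin the Green function is the average of the
    one with a step less. *)
Lemma green_max m x :
  \sum_(i < m) iter i T (delta R 0) x <= \sum_(i < m) iter i T (delta R 0) 0.
Proof.
elim: m x => [|m IH] x; first by rewrite !big_ord0.
have [->//|x0] := eqVneq x 0.
pose G y := \sum_(i < m) 1 * iter i T (delta R 0) y.
have bG : bnd G by apply: bnd_sum => i; exact: iter_delta_bnd.
have GE y : G y = \sum_(i < m) iter i T (delta R 0) y.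
  by apply: eq_bigr => i _; rewrite mul1r.
apply: (@le_trans _ _ (G 0)); last first.
  by rewrite GE big_ord_recr /= lerDl iter_delta_ge0.
rewrite big_ord_recl /= {1}/delta (negPf x0) add0r.
have -> : \sum_(i < m) T (iter i T (delta R 0)) x = T G x.
  rewrite /G (walk_sum WT) => [|i]; last exact: iter_delta_bnd.
  by apply: eq_bigr => i _; rewrite mul1r.
by apply: (walk_le WT bG) => y; rewrite !GE.
Qed.

Lemma walk_var_ge0 : 0 <= s.
Proof.
have := walk_trunc WT 0 (lexx 0); rewrite {2}/trunc_sqr mulr0z expr0n /= minxx add0r.
apply: le_trans; apply: (walk_ge0 WT); first exact: bnd_trunc.
by move=> z; rewrite /trunc_sqr le_min sqr_ge0 lexx.
Qed.

Lemma nat_sqrt (K k : nat) : (0 < K)%N ->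
  exists r, (K * r ^ 2 <= k < K * r.+1 ^ 2)%N.
Proof.
move=> K0; elim: k => [|k [r /andP[h1 h2]]]; first by exists 0%N; rewrite muln0 muln1.
have [h|h] := ltnP k.+1 (K * r.+1 ^ 2)%N.
  by exists r; rewrite h (leq_trans h1).
exists r.+1; rewrite h /=; apply: (leq_ltn_trans h2).
by rewrite ltn_mul2l K0 ltn_sqr ltnSn.
Qed.

Lemma nat_above (x : R) : exists2 K : nat, (0 < K)%N & x <= K%:R.
Proof.
exists (Num.truncn `|x|).+1 => //; apply: le_trans (ler_norm x) _.
by apply: ltW; exact: truncnS_gt.
Qed.

(** By [green_max] the time spent in a window of width of order [sqrt m] is at
    most that width times the Green function at the origin, and by Chebyshev it
    is of order [m]. *)
Lemma green_ge : exists2 c, 0 < c &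
  forall m, c * Num.sqrt m%:R <= \sum_(i < m) iter i T (delta R 0) 0.
Proof.
have s0 := walk_var_ge0.
have [K K0 hK] := nat_above (2 * s + 1).
have K1 : (0 : R) < K%:R by rewrite ltr0n.
exists (12 * K%:R)^-1 => [|m]; first by rewrite invr_gt0 mulr_gt0.
have [n] := @nat_sqrt 1 m isT; rewrite !mul1n => /andP[nm mn].
case: n nm mn => [|n'] nm mn.
  have -> : m = 0%N by move: mn; rewrite exp1n; lia.
  by rewrite sqrtr0 mulr0 big_ord0.
set n := n'.+1 in nm mn; set G := \sum_(i < m) _.
pose r := (K * n.+1)%N.
have r0 : (0 < r)%N by rewrite muln_gt0 K0.
have rR : r%:R = K%:R * (n%:R + 1) :> R by rewrite natrM natr1.
have n1 : (1 : R) <= n%:R by rewrite ler1n.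
have nmR : n%:R ^+ 2 <= m%:R :> R by rewrite -natrX ler_nat.
have mnR : m%:R <= (n%:R + 1) ^+ 2 :> R by rewrite natr1 -natrX ler_nat ltnW.
have m0 : (0 : R) <= m%:R by [].
have r2 : 2 * s * m%:R <= r%:R ^+ 2.
  rewrite rR exprMn; apply: ler_pM; rewrite ?mulr_ge0 //.
  by rewrite expr2; apply: (@le_trans _ _ (K%:R * 1)); [lra|rewrite ler_wpM2l; lra].
have h1 : m%:R / 2 <= (2 * r).+1%:R * G.
  have -> : m%:R / 2 = \sum_(j < m) (2^-1 : R).
    by rewrite sumr_const card_ord mulr_natl.
  have -> : (2 * r).+1%:R * G = \sum_(i < (2 * r).+1) G.
    by rewrite sumr_const card_ord mulr_natl.
  apply: (@le_trans _ _ (\sum_(i < (2 * r).+1) \sum_(j < m)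
      iter j T (delta R (i%:Z - r%:Z)) 0)); last first.
    apply: ler_sum => i _; under eq_bigr do rewrite -iter_delta_opp.
    exact: green_max.
  rewrite exchange_big /=; apply: ler_sum => j _.
  apply: le_trans (walk_chebyshev j WT r0).
  have rr : (0 : R) < r%:R ^+ 2 by rewrite exprn_gt0 // ltr0n.
  suff : j%:R * s / r%:R ^+ 2 <= 2^-1 by lra.
  rewrite ler_pdivrMr //.
  have jm : j%:R <= m%:R :> R by rewrite ler_nat ltnW.
  have := ler_wpM2r s0 jm; lra.
have G0 : 0 <= G by apply: sumr_ge0 => i _; exact: iter_delta_ge0.
have nq : n%:R <= Num.sqrt m%:R :> R.
  by rewrite -(@ler_pXn2r _ 2) ?nnegrE ?sqrtr_ge0 // sqr_sqrtr.
have q2 : Num.sqrt m%:R ^+ 2 = m%:R :> R by rewrite sqr_sqrtr.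
set q := Num.sqrt _ in nq q2 *.
have q1 : 1 <= q by lra.
have h2 : (2 * r).+1%:R <= 6 * K%:R * q.
  rewrite -natr1 natrM rR.
  have k1 : (1 : R) <= K%:R by rewrite ler1n.
  have e : K%:R * (n%:R + 1) <= K%:R * (2 * q) by rewrite ler_wpM2l //; lra.
  have e2 : 1 <= 1 * q by lra.
  have e3 : K%:R * 1 <= K%:R * q by rewrite ler_wpM2l.
  by have : 1 * q <= K%:R * q by [rewrite ler_wpM2r //; lra]; nra.
have h3 := le_trans h1 (ler_wpM2r G0 h2).
rewrite mulrC ler_pdivrMr; last by rewrite mulr_gt0.
have q0 : 0 < q by lra.
rewrite -(ler_pM2l q0) -expr2 q2; lra.
Qed.

End Green.

(** * The lattice carrying the walk *)

Section Lattice.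
Variables (R : realType) (s : R) (T : (int -> R) -> int -> R) (h : int).
Hypotheses (WT : is_walk s T) (h0 : h != 0).
Hypotheses (m0 : 0 < T (delta R 0) 0) (mh : 0 < T (delta R h) 0).

Local Notation q k := (iter k T (delta R 0)).

(** [x] is a possible position after [m] steps. *)
Definition reach (m : nat) (x : int) : Prop := 0 < iter m T (delta R x) 0.

Lemma iter_delta_mul m n x y :
  iter m T (delta R x) 0 * iter n T (delta R y) 0 <=
  iter (m + n) T (delta R (x + y)) 0.
Proof.
rewrite iterD.
have := walk_atom (is_walk_iter m WT) x 0 (iter_delta_bnd WT n (x + y))
  (iter_delta_ge0 WT n (x + y)).
rewrite add0r (walk_delta (is_walk_iter n WT)) (addrC x y) addrK.
by rewrite mulrC.
Qed.

Lemma reachD m n x y : reach m x -> reach n y -> reach (m + n) (x + y).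
Proof.
by move=> hx hy; apply: lt_le_trans (iter_delta_mul m n x y); exact: mulr_gt0.
Qed.

Lemma reach0 m : reach m 0.
Proof.
elim: m => [|m IH]; first by rewrite /reach /= /delta eqxx.
have := @reachD 1 m 0 0 m0 IH; by rewrite addr0.
Qed.

(** Directions in which the law at time [k] varies by [O(1 / k)], a factor
    [sqrt k] less than its size; they form a group. *)
Definition lip (x : int) : Prop := exists2 C, 0 <= C &
  forall k y, `|q k y - q k (y + x)| <= C / (k%:R + 1).

Lemma lipD x y : lip x -> lip y -> lip (x + y).
Proof.
move=> [A A0 hA] [B B0 hB]; exists (A + B); first exact: addr_ge0.
move=> k z; rewrite mulrDl addrA.
by apply: le_trans (ler_distD (q k (z + x)) _ _) _; apply: lerD.
Qed.

Lemma lipN x : lip x -> lip (- x).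
Proof.
move=> [A A0 hA]; exists A => // k z; rewrite distrC.
by have := hA k (z - x); rewrite subrK.
Qed.

Lemma lip_mul (n : int) x : lip x -> lip (n * x).
Proof.
move=> hx; have hn (j : nat) : lip (j%:Z * x).
  elim: j => [|j IH]; first by rewrite mul0r; exists 0 => // k y; rewrite addr0 subrr normr0 mul0r.
  by rewrite -addn1 PoszD mulrDl mul1r; exact: lipD.
case: n => j; first exact: hn.
by rewrite NegzE mulNr; apply: lipN; exact: hn.
Qed.

(** The [m]-step walk has atoms at [0] and at [x], hence is smooth in the
    direction [x]; the remaining steps only average. *)
Lemma reach_lip m x : reach m x -> lip x.
Proof.
have [->|x0] := eqVneq x 0; first by move=> _; exists 0 => // k y; rewrite addr0 subrr normr0 mul0r.
case: m => [|m] hx.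
  by move: hx; rewrite /reach /= /delta eq_sym (negPf x0) ltxx.
have Wm := is_walk_iter m.+1 WT.
pose al := Num.min (iter m.+1 T (delta R 0) 0) (iter m.+1 T (delta R x) 0).
have al0 : 0 < al by rewrite lt_min hx andbT; exact: (reach0 m.+1).
have al1 : al <= iter m.+1 T (delta R 0) 0 by rewrite ge_min lexx.
have al2 : al <= iter m.+1 T (delta R x) 0 by rewrite ge_min lexx orbT.
have [C C0 hC] := smooth_diff Wm x0 al0 al1 al2.
exists (C * m.+1%:R) => [|k y]; first by rewrite mulr_ge0 // ltW.
rewrite {1 2}(divn_eq k m.+1); set i := (k %/ m.+1)%N; set j := (k %% m.+1)%N.
have iE : iter (i * m.+1) T (delta R 0) = iter i (iter m.+1 T) (delta R 0).
  by elim: i => // i IH; rewrite mulSn iterD IH.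
rewrite addnC !iterD iE.
have Wj := is_walk_iter j WT.
set f := iter i _ _ in hC *.
have bf : bnd f by apply: (walk_bnd (is_walk_iter i Wm)); exact: bnd_delta.
have hf z : `|f z - f (z + x)| <= C / (i%:R + 1) by exact: hC.
have -> : iter j T f y - iter j T f (y + x) = iter j T (fun z => f z - f (z + x)) y.
  by rewrite (walkB Wj) ?(walkS Wj) //; exact: bndS.
have bd : bnd (fun z => f z - f (z + x)) by apply: bndB => //; exact: bndS.
apply: (@le_trans _ _ (C / (i%:R + 1))).
  rewrite ler_norml (walk_ge Wj) ?(walk_le Wj) // => z.
    by have := hf z; rewrite ler_norml => /andP[].
  by have := hf z; rewrite ler_norml => /andP[].
rewrite -mulrA ler_wpM2l ?(ltW C0) // ler_pdivlMr ?ltr_wpDl //.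
rewrite mulrC ler_pdivrMr ?ltr_wpDl // !natr1 -natrM ler_nat.
by have := ltn_ceil k (ltn0Sn m); rewrite -/i mulnC.
Qed.

(** [d] generates the group of directions [lip]. *)
Lemma lattice_gen : exists C d, [/\ 0 < C, (0 < d)%N,
  forall k (n : int) y, `|q k y - q k (y + n * d%:Z)| <= C * `|n|%:~R / (k%:R + 1) &
  forall m x, reach m x -> (d %| x)%Z].
Proof.
have hlip : lip h by exact: (@reach_lip 1).
have ex : exists d, (0 < d)%N && `[< lip d%:Z >].
  exists `|h|%N; rewrite absz_gt0 h0 /=; apply/asboolP.
  case: h hlip => // j; rewrite NegzE abszN => /lipN; rewrite opprK.
  by apply.
case: (ex_minnP ex) => d /andP[d0 /asboolP ld] dmin.
have [C C0 hC] := ld.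
exists (C + 1), d; split => //; first by rewrite ltr_wpDl.
  have hn k (j : nat) y : `|q k y - q k (y + j%:Z * d%:Z)| <= (C + 1) * j%:R / (k%:R + 1).
    have kp : (0 : R) < k%:R + 1 by rewrite ltr_wpDl.
    elim: j => [|j IH]; first by rewrite mul0r addr0 subrr normr0 mulr0 mul0r.
    apply: le_trans (ler_distD (q k (y + j%:Z * d%:Z)) _ _) _.
    rewrite -natr1 mulrDr mulr1 mulrDl; apply: lerD => //.
    rewrite -addn1 PoszD mulrDl mul1r addrA.
    apply: le_trans (hC k _) _; rewrite ler_pM2r ?invr_gt0 //; lra.
  move=> k n y; case: n => j; first exact: hn.
  have -> : `|Negz j|%:~R = j.+1%:R :> R by [].
  rewrite NegzE mulNr distrC.
  by have := hn k j.+1 (y - j.+1%:Z * d%:Z); rewrite subrK.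
move=> m x /reach_lip lx.
have lr : lip (x %% d%:Z)%Z.
  have -> : (x %% d%:Z)%Z = x + - ((x %/ d%:Z)%Z * d%:Z) by rewrite {2}(divz_eq x d%:Z); ring.
  by apply: lipD => //; apply: lipN; exact: lip_mul.
apply/dvdz_mod0P.
have r0 : 0 <= (x %% d%:Z)%Z by apply: modz_ge0; lia.
have rd : (x %% d%:Z)%Z < d%:Z by apply: ltz_pmod; lia.
apply/eqP; apply/negP => /negP rn.
have := dmin `|(x %% d%:Z)%Z|%N; rewrite gez0_abs // absz_gt0 rn.
have -> : `[< lip (x %% d%:Z)%Z >] by apply/asboolP.
by move=> /(_ isT); lia.
Qed.

End Lattice.

(** * Pointwise lower bound for the return probability *)

Section SumInvSqrt.
Variable R : realType.

Lemma inv_sqrt_telescope (k : nat) :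
  (Num.sqrt (k%:R + 1))^-1 <= 2 * (Num.sqrt k.+1%:R - Num.sqrt k%:R) :> R.
Proof.
have k0 : (0 : R) <= k%:R by [].
have e1 : Num.sqrt (k%:R + 1) ^+ 2 = k%:R + 1 :> R by rewrite sqr_sqrtr; lra.
have e2 : Num.sqrt k%:R ^+ 2 = k%:R :> R by rewrite sqr_sqrtr.
rewrite -[k.+1%:R]natr1; set p := Num.sqrt (_ + 1) in e1 *; set q := Num.sqrt _ in e2 *.
have p0 : 0 < p by rewrite sqrtr_gt0; lra.
have q0 : 0 <= q by exact: sqrtr_ge0.
rewrite -(ler_pM2l p0) divff ?gt_eqF //.
have : 0 <= (p - q) ^+ 2 by exact: sqr_ge0.
by move=> sq; nra.
Qed.

Lemma sum_inv_sqrt (a b : nat) : (a <= b)%N ->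
  \sum_(a <= k < b) (Num.sqrt (k%:R + 1))^-1
    <= 2 * (Num.sqrt b%:R - Num.sqrt a%:R) :> R.
Proof.
move=> ab; rewrite -(telescope_sumr (fun k => Num.sqrt k%:R : R) ab) mulr_sumr.
by apply: ler_sum => k _; exact: inv_sqrt_telescope.
Qed.

End SumInvSqrt.

Lemma succ_sqr_le (t : nat) : (0 < t)%N -> (t.+1 ^ 2 <= 4 * t ^ 2)%N.
Proof. by move=> t0; nia. Qed.

Lemma abs_window (t rho : nat) :
  (t < (2 * rho).+1)%N -> `|t%:Z - rho%:Z| <= rho%:Z.
Proof. by move=> h; lia. Qed.

Section Pointwise.
Variables (R : realType) (s : R) (T : (int -> R) -> int -> R) (h : int).
Hypotheses (WT : is_walk s T) (h0 : h != 0).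
Hypotheses (m0 : 0 < T (delta R 0) 0) (mh : 0 < T (delta R h) 0).

Local Notation q k := (iter k T (delta R 0)).

Section WithLattice.
Variables (C : R) (d : nat).
Hypotheses (C0 : 0 < C) (d0 : (0 < d)%N).
Hypothesis qlip : forall k (n : int) y,
  `|q k y - q k (y + n * d%:Z)| <= C * `|n|%:~R / (k%:R + 1).
Hypothesis qlat : forall m x, reach T m x -> (d %| x)%Z.

(** Moving by [n] lattice steps changes the mass by at most [C * n / r ^ 2],
    half of [a / r] when [n] is a small multiple of [r]. *)
Lemma near_origin a (r i : nat) (n : int) : (0 < r)%N -> (r ^ 2 <= i)%N ->
  a / r%:R <= q i 0 -> C * `|n|%:~R <= a * r%:R / 2 ->
  a / r%:R / 2 <= q i (n * d%:Z).
Proof.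
move=> r0 ri hq hn; have := qlip i n 0; rewrite add0r ler_norml => /andP[_].
have rp : (0 : R) < r%:R by rewrite ltr0n.
have ip : (0 : R) < i%:R + 1 by rewrite ltr_wpDl.
suff : C * `|n|%:~R / (i%:R + 1) <= a / r%:R / 2 by lra.
have ri' : r%:R ^+ 2 <= i%:R + 1 :> R.
  by apply: (@le_trans _ _ i%:R); [rewrite -natrX ler_nat|rewrite lerDl].
have n0 : 0 <= C * `|n|%:~R by rewrite mulr_ge0 ?(ltW C0) // ler0z.
have a0 : 0 <= a.
  by have := le_trans n0 hn; rewrite -mulrA pmulr_lge0 // divr_gt0.
rewrite ler_pdivrMr //; apply: le_trans hn _.
have e : a * r%:R / 2 = (a / r%:R / 2) * r%:R ^+ 2 by field; rewrite gt_eqF.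
by rewrite e ler_wpM2l // !divr_ge0 // ltW.
Qed.

(** Near the origin both laws have mass of order [r^-1] at each of the order [r]
    lattice points, and these products add up to order [r^-1] in the
    convolution. *)
Lemma good_times_add a b : 0 < a -> 0 < b -> exists2 c, 0 < c &
  forall r i j : nat, (0 < r)%N -> (r ^ 2 <= i)%N -> (r ^ 2 <= j)%N ->
    a / r%:R <= q i 0 -> b / r%:R <= q j 0 -> c / r%:R <= q (i + j) 0.
Proof.
move=> a0 b0; pose e := Num.min a b.
have e0 : 0 < e by rewrite lt_min a0.
have ea : e <= a by rewrite ge_min lexx.
have eb : e <= b by rewrite ge_min lexx orbT.
exists (a * b * e / (8 * C)) => [|r i j r0 ri rj hi hj].
  by rewrite divr_gt0 ?mulr_gt0.
have rp : (0 : R) < r%:R by rewrite ltr0n.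
pose x := e * r%:R / (2 * C); pose rho := Num.truncn x.
have x0 : 0 <= x by rewrite divr_ge0 ?mulr_ge0 // ltW.
have rx : rho%:R <= x by rewrite truncn_le.
have xr : x <= rho.+1%:R by apply/ltW/truncnS_gt.
have Cx : C * x = e * r%:R / 2 by rewrite /x; field; rewrite gt_eqF.
pose y (t : 'I_rho.+1) := t%:Z * d%:Z.
have yinj : injective y.
  have dz : d%:Z != 0 by rewrite eqz_nat -lt0n.
  by move=> t u /(mulIf dz)[] /val_inj.
have Wi := is_walk_iter i WT.
have := walk_atoms Wi 0 yinj (iter_delta_bnd WT j 0) (iter_delta_ge0 WT j 0).
rewrite -iterD; apply: le_trans.
apply: (@le_trans _ _ (\sum_(t < rho.+1) (b / r%:R / 2) * (a / r%:R / 2))).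
  rewrite sumr_const card_ord -[leRHS]mulr_natl.
  have -> : a * b * e / (8 * C) / r%:R = x * ((b / r%:R / 2) * (a / r%:R / 2)).
    by rewrite /x; field; rewrite !gt_eqF.
  by rewrite ler_wpM2r // mulr_ge0 // !divr_ge0 // ltW.
apply: ler_sum => t _; rewrite add0r.
have tx : C * t%:R <= C * x.
  by rewrite ler_wpM2l ?(ltW C0) //; apply: le_trans rx; rewrite ler_nat -ltnS.
apply: ler_pM; rewrite ?divr_ge0 ?(ltW a0) ?(ltW b0) ?(ltW rp) //.
  apply: near_origin => //; apply: (le_trans tx); rewrite Cx.
  by rewrite -!mulrA ler_wpM2r // divr_ge0 // ltW.
rewrite -(iter_delta_opp WT) /y -mulNr; apply: near_origin => //.
rewrite normrN; apply: (le_trans tx); rewrite Cx.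
by rewrite -!mulrA ler_wpM2r // divr_ge0 // ltW.
Qed.

(** In a further [i] steps, with [i] a small multiple of [r ^ 2], the walk
    stays near the origin with probability one half by Chebyshev. *)
Lemma good_times_extend a : 0 < a -> exists Q r0 : nat, (0 < Q)%N /\
  forall r i j : nat, (0 < r)%N -> (r0 <= r)%N -> (r ^ 2 <= j)%N ->
    (i * Q <= r ^ 2)%N -> a / r%:R <= q j 0 -> (a / 4) / r%:R <= q (i + j) 0.
Proof.
move=> a0; have s0 := walk_var_ge0 WT.
(* [Q] makes [i * s] at most half of [rho ^+ 2], and [r0] makes [rho] positive *)
have [Q Q0 hQ] := nat_above (32 * s * C ^+ 2 / a ^+ 2).
have [r0 r00 hr0] := nat_above (2 * C / a).
exists Q, r0; split => // r i j r1 rr rj iQ hj.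
have rp : (0 : R) < r%:R by rewrite ltr0n.
pose x := a * r%:R / (2 * C); pose rho := Num.truncn x.
have x1 : 1 <= x.
  have h1 : 2 * C / a <= r%:R by apply: le_trans hr0 _; rewrite ler_nat.
  by move: h1; rewrite ler_pdivrMr // /x ler_pdivlMr ?mulr_gt0 // mul1r (mulrC a).
have rho0 : (0 < rho)%N by rewrite truncn_gt0.
have rx : rho%:R <= x by rewrite truncn_le; lra.
have xr : x <= 2 * rho%:R.
  have := ltW (truncnS_gt x); rewrite -/rho -natr1.
  have : (1 : R) <= rho%:R by rewrite ler1n.
  by move=> ? ?; lra.
have Cx : C * x = a * r%:R / 2 by rewrite /x; field; rewrite gt_eqF.
have rhop : (0 : R) < rho%:R by rewrite ltr0n.
pose y (t : 'I_(2 * rho).+1) := t%:Z - rho%:Z.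
have yinj : injective y by move=> t u /addIr[] /val_inj.
have Wi := is_walk_iter i WT.
have := walk_atoms Wi 0 yinj (iter_delta_bnd WT j 0) (iter_delta_ge0 WT j 0).
rewrite -iterD; apply: le_trans.
apply: (@le_trans _ _ (\sum_(t < (2 * rho).+1)
    (a / r%:R / 2) * iter i T (delta R (y t)) 0)); last first.
  apply: ler_sum => t _; rewrite add0r.
  have := iter_delta_ge0 WT i (y t) 0; rewrite le_eqVlt => /orP[/eqP <-|pos].
    by rewrite !mulr0.
  rewrite ler_wpM2r ?(ltW pos) //.
  have /dvdzP[n yn] := qlat pos.
  rewrite yn; apply: near_origin => //; rewrite -Cx ler_wpM2l ?(ltW C0) //.
  apply: le_trans rx; rewrite -[rho%:R]/(rho%:Z%:~R) ler_int.
  have ty := abs_window (ltn_ord t); rewrite -/(y t) yn normrM in ty.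
  by apply: le_trans ty; rewrite ler_peMr // normr_nat ler1n.
rewrite -mulr_sumr.
apply: (@le_trans _ _ ((a / r%:R / 2) * (1 / 2))).
  by rewrite le_eqVlt; apply/orP; left; apply/eqP; field; rewrite gt_eqF.
rewrite ler_wpM2l ?divr_ge0 ?(ltW a0) ?(ltW rp) //.
apply: le_trans (walk_chebyshev i WT rho0).
suff : i%:R * s / rho%:R ^+ 2 <= 1 / 2 by move=> ?; lra.
rewrite ler_pdivrMr ?exprn_gt0 //.
have Qp : (0 : R) < Q%:R by rewrite ltr0n.
have k1 : i%:R * Q%:R <= r%:R ^+ 2 :> R by rewrite -natrM -natrX ler_nat.
have k2 : 32 * s * C ^+ 2 <= Q%:R * a ^+ 2 by move: hQ; rewrite ler_pdivrMr // exprn_gt0.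
have k3 : a * r%:R <= 4 * C * rho%:R.
  have := ler_wpM2l (ltW C0) xr; rewrite Cx => k; lra.
have k4 : (a * r%:R) ^+ 2 <= (4 * C * rho%:R) ^+ 2.
  by rewrite ler_pXn2r ?nnegrE ?mulr_ge0 ?(ltW C0) // ltW.
(* after multiplication by [C ^+ 2 * Q] the bounds [k2], [k1] and [k4] chain *)
have C2 : 0 < C ^+ 2 by rewrite exprn_gt0.
rewrite -(ler_pM2l C2) -(ler_pM2l Qp).
have i0 : (0 : R) <= i%:R by [].
have k5 := ler_wpM2l (mulr_ge0 i0 (ltW Qp)) k2.
have k6 := ler_wpM2l (mulr_ge0 (ltW Qp) (sqr_ge0 a)) k1.
have k7 := ler_wpM2l (ltW Qp) k4.
set ii := i%:R in i0 k5 k6 *; set qq := Q%:R in Qp k5 k6 k7 *.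
set rr2 := r%:R in rp k6 k7 *; set rh := rho%:R in rhop k7 *.
have e6 : qq * a ^+ 2 * rr2 ^+ 2 = qq * (a * rr2) ^+ 2 by ring.
have e5 : ii * qq * (qq * a ^+ 2) = qq * a ^+ 2 * (ii * qq) by rewrite mulrC.
rewrite e5 in k5; rewrite e6 in k6; have j7 := le_trans (le_trans k5 k6) k7.
have -> : qq * (C ^+ 2 * (ii * s)) = ii * qq * (32 * s * C ^+ 2) / 32 by field.
have -> : qq * (C ^+ 2 * (1 / 2 * rh ^+ 2)) = qq * (4 * C * rh) ^+ 2 / 32 by field.
by rewrite ler_pM2r.
Qed.

(** The Green function up to time [B * r ^ 2] is of order [sqrt B * r], and at
    most of order [r] of it is produced before time [r ^ 2]. *)
Lemma good_time_exists : exists2 a, 0 < a & exists2 B : nat, (0 < B)%N &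
  forall r : nat, (0 < r)%N ->
    exists2 j, (r ^ 2 <= j < B * r ^ 2)%N & a / r%:R <= q j 0.
Proof.
have [c c0 hc] := green_ge WT.
pose al := Num.min (T (delta R 0) 0) (T (delta R h) 0).
have al0 : 0 < al by rewrite lt_min m0.
have al1 : al <= T (delta R 0) 0 by rewrite ge_min lexx.
have al2 : al <= T (delta R h) 0 by rewrite ge_min lexx orbT.
have [S S0 hS] := smooth_sup WT h0 al0 al1 al2.
have [b b0 hb] := nat_above (3 * S / c).
have bp : (0 : R) < b%:R by rewrite ltr0n.
have b2p : (0 : R) < (b ^ 2)%:R by rewrite natrX exprn_gt0.
exists (S / (2 * (b ^ 2)%:R)); first by rewrite divr_gt0 ?mulr_gt0.
exists (b ^ 2)%N => [|r r0]; first by rewrite expn_gt0 b0.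
have rp : (0 : R) < r%:R by rewrite ltr0n.
set a := S / _; apply: contrapT => no.
have small j : (r ^ 2 <= j < b ^ 2 * r ^ 2)%N -> q j 0 <= a / r%:R.
  by move=> hj; rewrite leNgt; apply/negP => /ltW hq; apply: no; exists j.
have r2 : (r ^ 2 <= b ^ 2 * r ^ 2)%N by rewrite leq_pmull // expn_gt0 b0.
have := hc (b ^ 2 * r ^ 2)%N.
rewrite -(big_mkord xpredT (fun i => q i 0)) (@big_cat_nat _ _ _ (r ^ 2)) //=.
have h1 : \sum_(0 <= i < r ^ 2) q i 0 <= 2 * S * r%:R.
  apply: (@le_trans _ _ (\sum_(0 <= i < r ^ 2) S * (Num.sqrt (i%:R + 1))^-1)).
    by apply: ler_sum => i _; exact: hS.
  have := @sum_inv_sqrt R 0 (r ^ 2) (leq0n _).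
  rewrite natrX sqrtr_sqr ger0_norm // sqrtr0 subr0 => e.
  rewrite -mulr_sumr [2 * S]mulrC -mulrA ler_wpM2l //; exact: ltW.
have h2 : \sum_(r ^ 2 <= i < b ^ 2 * r ^ 2) q i 0 <= S * r%:R / 2.
  apply: (@le_trans _ _ (\sum_(r ^ 2 <= i < b ^ 2 * r ^ 2) a / r%:R)).
    by rewrite big_nat_cond [leRHS]big_nat_cond; apply: ler_sum => i /andP[hi _]; exact: small.
  rewrite sumr_const_nat -[leLHS]mulr_natl.
  apply: (@le_trans _ _ ((b ^ 2 * r ^ 2)%:R * (a / r%:R))).
    by rewrite ler_wpM2r ?ler_nat ?leq_subr // !divr_ge0 ?mulr_ge0 // ltW.
  rewrite natrM [in leLHS]natrX [(r ^ 2)%:R]natrX /a natrX le_eqVlt; apply/orP; left.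
  by apply/eqP; field; rewrite !gt_eqF.
rewrite natrM !natrX -exprMn sqrtr_sqr ger0_norm ?mulr_ge0 // mulrA => h3.
have h4 : 3 * S * r%:R <= c * b%:R * r%:R.
  rewrite ler_wpM2r //; move: hb; rewrite ler_pdivrMr // => hb.
  by rewrite [c * _]mulrC.
have Sr : 0 < S * r%:R by rewrite mulr_gt0.
move: (le_trans h4 (le_trans h3 (lerD h1 h2))).
by rewrite leNgt => /negP; apply; lra.
Qed.

(** Sums of [n] good times [j + i], [i <= D], fill [n * j, n * j + n * D]. *)
Lemma good_times_mul a : 0 < a -> exists Q r0 : nat, (0 < Q)%N /\
  forall n, exists2 c, 0 < c &
  forall r D j e : nat, (0 < r)%N -> (r0 <= r)%N -> (r ^ 2 <= j)%N ->
    (D * Q = r ^ 2)%N -> (e <= n.+1 * D)%N ->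
    a / r%:R <= q j 0 -> c / r%:R <= q (n.+1 * j + e) 0.
Proof.
move=> a0; have [Q [r0 [Q0 hQ]]] := good_times_extend a0.
exists Q, r0; split => //.
have a40 : 0 < a / 4 by rewrite divr_gt0.
have one r D j e : (0 < r)%N -> (r0 <= r)%N -> (r ^ 2 <= j)%N ->
    (D * Q = r ^ 2)%N -> (e <= D)%N ->
    a / r%:R <= q j 0 -> a / 4 / r%:R <= q (j + e) 0.
  move=> r1 rr rj DQ eD hj; rewrite addnC; apply: hQ => //.
  by rewrite -DQ leq_mul2r eD orbT.
elim=> [|n [c c0 IH]].
  by exists (a / 4) => // r D j e; rewrite !mul1n; exact: one.
have [c' c'0 hadd] := good_times_add c0 a40.
exists c' => // r D j e r1 rr rj DQ eD hj.
pose e1 := minn e D.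
have -> : (n.+2 * j + e = (n.+1 * j + (e - e1)) + (j + e1))%N by rewrite /e1; lia.
apply: hadd => //.
- by apply: (leq_trans rj); rewrite mulSn -addnA leq_addr.
- by apply: (leq_trans rj); rewrite leq_addr.
- by apply: (IH _ D) => //; rewrite /e1; lia.
- by apply: (one _ D) => //; exact: geq_minr.
Qed.

(** A time [k] lies within [n * D] of the multiple [n * j] of a good time [j],
    with [n] the quotient of [k] by [j].  Choosing [r] of order [sqrt k] with a
    large constant makes [n] large enough for [j <= n * D], yet bounded. *)
Lemma return_ge_lattice : exists2 c, 0 < c & exists K0 : nat, forall k, (K0 <= k)%N ->
  c / Num.sqrt (k%:R + 1) <= q k 0.
Proof.
have [a a0 [B B0 hB]] := good_time_exists.
have [Q [r0 [Q0 hQ]]] := good_times_mul a0.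
pose K := (B * Q * B * Q ^ 2)%N.
have K1 : (0 < K)%N by rewrite !muln_gt0 B0 Q0.
have [c c0 hc] : exists2 c, 0 < c & forall n, (n < 4 * K)%N ->
  forall r D j e : nat, (0 < r)%N -> (r0 <= r)%N -> (r ^ 2 <= j)%N ->
    (D * Q = r ^ 2)%N -> (e <= n.+1 * D)%N ->
    a / r%:R <= q j 0 -> c / r%:R <= q (n.+1 * j + e) 0.
  elim: (4 * K)%N => [|N [c1 c10 IH]]; first by exists 1.
  have [c2 c20 h2] := hQ N.
  exists (Num.min c1 c2) => [|n]; first by rewrite lt_min c10.
  rewrite ltnS leq_eqVlt => /orP[/eqP->|nN] r D j e r1 rr rj DQ eD hj.
    apply: le_trans (h2 _ _ _ _ r1 rr rj DQ eD hj).
    by rewrite ler_wpM2r ?invr_ge0 // ge_min lexx orbT.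
  apply: le_trans (IH _ nN _ _ _ _ r1 rr rj DQ eD hj).
  by rewrite ler_wpM2r ?invr_ge0 // ge_min lexx.
exists (c / Q%:R); first by rewrite divr_gt0 // ltr0n.
exists (K * r0.+1 ^ 2)%N => k hk.
have [t /andP[t1 t2]] := nat_sqrt k K1.
have rt : (r0.+1 <= t)%N.
  by have := leq_ltn_trans hk t2; rewrite ltn_mul2l K1 ltn_sqr /= => ?; lia.
have t0 : (0 < t)%N by lia.
have r1 : (0 < Q * t)%N by rewrite muln_gt0 Q0.
have [j /andP[j1 j2] hj] := hB _ r1.
have j0 : (0 < j)%N by apply: leq_trans j1; rewrite expn_gt0 r1.
have DQ : (Q * t ^ 2 * Q = (Q * t) ^ 2)%N by ring.
have ek := divn_eq k j.
have nlow : (B * Q <= k %/ j)%N.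
  rewrite leq_divRL //; apply: leq_trans t1.
  have -> : (K * t ^ 2 = B * Q * (B * (Q * t) ^ 2))%N by rewrite /K; ring.
  by rewrite leq_mul2l (ltnW j2) orbT.
have nup : (k %/ j <= 4 * K)%N.
  rewrite -ltnS ltn_divLR //; apply: (leq_trans t2).
  apply: (@leq_trans (4 * K * t ^ 2)).
    by rewrite [(4 * K)%N]mulnC -mulnA leq_mul2l succ_sqr_le ?orbT.
  apply: leq_mul; first by rewrite leqnSn.
  by apply: leq_trans j1; rewrite leq_sqr leq_pmull.
have [n nE] : exists n, (k %/ j = n.+1)%N.
  by exists (k %/ j).-1; rewrite prednK //; apply: leq_trans nlow; rewrite muln_gt0 B0.
rewrite nE in nlow nup ek.
have eD : (k %% j <= n.+1 * (Q * t ^ 2))%N.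
  apply: (@leq_trans (B * (Q * t) ^ 2)); first by apply: ltnW; apply: ltn_trans j2; rewrite ltn_mod.
  by rewrite (_ : B * (Q * t) ^ 2 = B * Q * (Q * t ^ 2))%N ?leq_mul2r ?nlow ?orbT //; ring.
have rr : (r0 <= Q * t)%N by apply: (@leq_trans t); [lia|rewrite leq_pmull].
have := hc n nup _ _ _ _ r1 rr j1 DQ eD hj.
rewrite -ek; apply: le_trans.
rewrite natrM invfM mulrA ler_wpM2l ?divr_ge0 ?(ltW c0) //.
have tp : (0 : R) < t%:R by rewrite ltr0n.
rewrite lef_pV2 ?posrE ?sqrtr_gt0 ?ltr_wpDl //.
rewrite -(@ler_pXn2r _ 2) ?nnegrE ?sqrtr_ge0 // sqr_sqrtr ?addr_ge0 //.
rewrite natr1 -natrX ler_nat; apply: leqW; apply: leq_trans t1.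
by rewrite leq_pmull.
Qed.

End WithLattice.
End Pointwise.

(** * Return probabilities of a centred walk *)

Section Returns.
Variables (R : realType) (s : R) (T : (int -> R) -> int -> R) (u v : int).
Hypotheses (WT : is_walk s T) (u0 : 0 < u) (v0 : v < 0).
Hypotheses (mu : 0 < T (delta R u) 0) (mv : 0 < T (delta R v) 0).

(* [`|v|] steps [u] and [`|u|] steps [v] lead back: the [L]-step walk can stay put *)
Let L := (`|u| + `|v|)%N.
Let WL : is_walk (L%:R * s) (iter L T) := is_walk_iter L WT.

Lemma reach_mul (m n : nat) x : reach T m x -> reach T (n * m) (n%:Z * x).
Proof.
move=> hx; elim: n => [|n IH]; first by rewrite mul0r mul0n /reach /= /delta eqxx.
rewrite mulSn -add1n PoszD mulrDl mul1r; exact: (reachD WT hx IH).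
Qed.

Lemma iter_iter m n (f : int -> R) : iter m (iter n T) f = iter (m * n) T f.
Proof. by elim: m => // m IH; rewrite mulSn iterD -IH. Qed.

Lemma steps_gt0 : (0 < L)%N. Proof. by rewrite /L; lia. Qed.

Lemma steps_return : 0 < iter L T (delta R 0) 0.
Proof.
have := reachD WT (@reach_mul 1 `|v| u mu) (@reach_mul 1 `|u| v mv).
have eu : `|u|%N%:Z = u by move: u0; clear; lia.
have ev : `|v|%N%:Z = - v by move: v0; clear; lia.
have -> : `|v|%N%:Z * u + `|u|%N%:Z * v = 0 by rewrite eu ev; ring.
by rewrite !muln1 addnC.
Qed.

Lemma steps_move : 0 < iter L T (delta R (L%:Z * u)) 0.
Proof. by have := @reach_mul 1 L u mu; rewrite muln1. Qed.

Lemma steps_move_neq0 : L%:Z * u != 0.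
Proof. by rewrite mulf_neq0 ?gt_eqF // ltz_nat steps_gt0. Qed.

Lemma return_le : exists2 C, 0 < C &
  forall k x, iter k T (delta R 0) x <= C / Num.sqrt (k%:R + 1).
Proof.
pose al := Num.min (iter L T (delta R 0) 0) (iter L T (delta R (L%:Z * u)) 0).
have al0 : 0 < al by rewrite lt_min steps_return steps_move.
have al1 : al <= iter L T (delta R 0) 0 by rewrite ge_min lexx.
have al2 : al <= iter L T (delta R (L%:Z * u)) 0 by rewrite ge_min lexx orbT.
have [C C0 hC] := smooth_sup WL steps_move_neq0 al0 al1 al2.
have L0 := steps_gt0; have Lp : (0 : R) < L%:R by rewrite ltr0n.
exists (C * Num.sqrt L%:R) => [|k x]; first by rewrite mulr_gt0 ?sqrtr_gt0.
have ek := divn_eq k L; set i := (k %/ L)%N in ek; set r := (k %% L)%N in ek.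
rewrite {1}ek addnC iterD -iter_iter.
apply: (@le_trans _ _ (C / Num.sqrt (i%:R + 1))).
  apply: (walk_le (is_walk_iter r WT)); last by move=> z; exact: hC.
  exact: iter_delta_bnd WL _ _.
have ip : (0 : R) < i%:R + 1 by rewrite ltr_wpDl.
have kp : (0 : R) < k%:R + 1 by rewrite ltr_wpDl.
rewrite -mulrA ler_wpM2l ?(ltW C0) // ler_pdivlMr ?sqrtr_gt0 //.
rewrite mulrC ler_pdivrMr ?sqrtr_gt0 // -sqrtrM ?ler0n // ler_sqrt; last by rewrite mulr_ge0 // ltW.
rewrite !natr1 -natrM ler_nat mulnC.
by have := ltn_ceil k L0.
Qed.

(** The time is restricted to multiples of [L] counted from time [0], not from
    [k0]: along these every point reachable at its own time [k0] leads back to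
    the origin, whatever the period of the walk. *)
Lemma return_ge : exists2 c, 0 < c & exists2 L : nat, (0 < L)%N &
  forall k0 x0, reach T k0 x0 -> exists K : nat, forall k, (K <= k)%N -> (L %| k)%N ->
    (k0 <= k)%N /\ c / Num.sqrt (k%:R + 1) <= iter (k - k0) T (delta R 0) x0.
Proof.
have [C [d [C0 d0 qlip qlat]]] :=
  lattice_gen WL steps_move_neq0 steps_return steps_move.
have [c c0 [K0 hc]] :=
  return_ge_lattice WL steps_move_neq0 steps_return steps_move C0 d0 qlip qlat.
have L0 := steps_gt0; have s0 := walk_var_ge0 WT.
exists (c / 4); first by rewrite divr_gt0.
exists L => // k0 x0 hx.
pose r := ((L - 1) * k0)%N.
have [W W0 hW] := nat_above (2 * r%:R * s).
pose A := (`|x0| + W)%N.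
have [K1 K10 hK1] := nat_above ((2 * C * A%:R / c) ^+ 2).
exists (L * (k0 + K0 + K1))%N => k hk /dvdnP[k' ek].
have hk' : (k0 + K0 + K1 <= k')%N by move: hk; rewrite ek mulnC leq_mul2r; case/orP => //; lia.
have k0k' : (k0 <= k')%N by lia.
have Lk0 : (k0 + r = k0 * L)%N by rewrite /r; nia.
split; first by rewrite ek; nia.
have [j ej] : exists j, (k' = k0 + j)%N by exists (k' - k0)%N; lia.
have -> : (k - k0 = r + j * L)%N by rewrite ek ej mulnDl -Lk0; lia.
rewrite iterD -iter_iter.
have jk : (j <= k)%N.
  by rewrite ek; apply: leq_trans (leq_pmulr k' L0); rewrite ej leq_addl.
have jK0 : (K0 <= j)%N by lia.
have jK1 : (K1 <= j)%N by lia.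
have jp : (0 : R) < j%:R + 1 by rewrite ltr_wpDl.
have jq : (0 : R) < Num.sqrt (j%:R + 1) by rewrite sqrtr_gt0.
have kp : (0 : R) < k%:R + 1 by rewrite ltr_wpDl.
have q0 := hc j jK0.
have Ap : (0 : R) <= A%:R by [].
have loss : C * A%:R / (j%:R + 1) <= c / 2 / Num.sqrt (j%:R + 1).
  have h1 : 2 * C * A%:R / c <= Num.sqrt (j%:R + 1).
    rewrite -(@ler_pXn2r _ 2) ?nnegrE ?sqrtr_ge0 ?divr_ge0 ?mulr_ge0 ?(ltW C0) ?(ltW c0) //.
    rewrite sqr_sqrtr ?(ltW jp) //; apply: (le_trans hK1).
    by apply: (@le_trans _ _ j%:R); rewrite ?ler_nat // lerDl.
  rewrite ler_pdivrMr // in h1.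
  rewrite ler_pdivrMr // -{2}(sqr_sqrtr (ltW jp)) expr2 mulrA divfK ?gt_eqF //.
  by move: h1; set w := Num.sqrt _ => h1; lra.
apply: (@le_trans _ _ (c / 2 / Num.sqrt (j%:R + 1) * (1 / 2))).
  have -> : c / 2 / Num.sqrt (j%:R + 1) * (1 / 2) = c / 4 / Num.sqrt (j%:R + 1).
    by field; rewrite gt_eqF.
  rewrite ler_wpM2l ?divr_ge0 ?(ltW c0) // lef_pV2 ?posrE ?sqrtr_gt0 // ler_sqrt //.
  by rewrite lerD2r ler_nat.
have Wr := is_walk_iter r WT.
pose y (t : 'I_(2 * W).+1) := t%:Z - W%:Z.
have yinj : injective y by move=> t z /addIr[] /val_inj.
have := walk_atoms Wr x0 yinj (iter_delta_bnd WL j 0) (iter_delta_ge0 WL j 0).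
apply: le_trans.
apply: (@le_trans _ _ (\sum_(t < (2 * W).+1)
    (c / 2 / Num.sqrt (j%:R + 1)) * iter r T (delta R (y t)) 0)); last first.
  apply: ler_sum => t _.
  have := iter_delta_ge0 WT r (y t) 0; rewrite le_eqVlt => /orP[/eqP <-|pos].
    by rewrite !mulr0.
  rewrite ler_wpM2r ?(ltW pos) //.
  have rx : reach (iter L T) k0 (x0 + y t).
    by rewrite /reach iter_iter -Lk0; exact: (reachD WT hx pos).
  have /dvdzP[n yn] := qlat _ _ rx.
  have := qlip j n 0; rewrite add0r -yn ler_norml => /andP[_].
  have nA : C * `|n|%:~R / (j%:R + 1) <= C * A%:R / (j%:R + 1).
    rewrite ler_pM2r ?invr_gt0 // ler_wpM2l ?(ltW C0) //.
    rewrite -[A%:R]/(A%:Z%:~R) ler_int.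
    have ty := abs_window (ltn_ord t); rewrite -/(y t) in ty.
    have e : `|n * d%:Z| <= A%:Z.
      rewrite -yn; apply: (le_trans (ler_normD _ _)).
      by rewrite /A PoszD lerD.
    by apply: le_trans e; rewrite normrM ler_peMr // normr_nat ler1n.
  have half : c / 2 / Num.sqrt (j%:R + 1) = c / Num.sqrt (j%:R + 1) / 2 by rewrite mulrAC.
  by move=> e; have := le_trans nA loss; rewrite half => e'; lra.
rewrite -mulr_sumr ler_wpM2l ?divr_ge0 ?(ltW c0) ?(ltW jq) //.
apply: le_trans (walk_chebyshev r WT W0).
suff : r%:R * s / W%:R ^+ 2 <= 1 / 2 by move=> ?; lra.
have Wp : (1 : R) <= W%:R by rewrite ler1n.
rewrite ler_pdivrMr; last by rewrite exprn_gt0 //; lra.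
have : W%:R * 1 <= W%:R * W%:R :> R by rewrite ler_wpM2l //; lra.
by move=> e; rewrite expr2; lra.
Qed.

End Returns.

(** * Sums over the windows *)

Section Sums.
Variable R : realType.

Lemma sum_pow32 (N : nat) :
  \sum_(1 <= l < N) (l%:R * Num.sqrt l%:R)^-1 <= 3 :> R.
Proof.
suff h M : \sum_(1 <= l < M.+2) (l%:R * Num.sqrt l%:R)^-1 <= 3 - 2 / Num.sqrt M.+1%:R :> R.
  case: N => [|N]; first by rewrite big_geq.
  case: N => [|M]; first by rewrite big_geq.
  apply: (le_trans (h M)).
  by rewrite gerBl divr_ge0 ?sqrtr_ge0.
elim: M => [|M IH]; first by rewrite big_nat1 sqrtr1 mulr1 invr1; lra.
rewrite big_nat_recr //=; apply: le_trans (lerD IH (lexx _)) _.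
have e1 : Num.sqrt M.+1%:R ^+ 2 = M%:R + 1 :> R by rewrite sqr_sqrtr // -natr1.
have e2 : Num.sqrt M.+2%:R ^+ 2 = M%:R + 1 + 1 :> R by rewrite sqr_sqrtr // -!natr1.
have p0 : (0 : R) < Num.sqrt M.+1%:R by rewrite sqrtr_gt0 ltr0n.
have q0 : (0 : R) < Num.sqrt M.+2%:R by rewrite sqrtr_gt0 ltr0n.
have e3 : M.+2%:R = Num.sqrt M.+2%:R ^+ 2 :> R by rewrite e2 -!natr1.
rewrite {1}e3; set p := Num.sqrt M.+1%:R in e1 p0 *.
set q := Num.sqrt M.+2%:R in e2 e3 q0 *.
have pq : q ^+ 2 - p ^+ 2 = 1 by rewrite e1 e2; lra.
have plq : p <= q.
  by rewrite -(@ler_pXn2r _ 2) ?nnegrE ?(ltW p0) ?(ltW q0) //; lra.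
suff : (q ^+ 2 * q)^-1 <= 2 / p - 2 / q by move=> ?; lra.
have -> : 2 / p - 2 / q = 2 / (p * q * (p + q)).
  transitivity (2 * (q ^+ 2 - p ^+ 2) / (p * q * (p + q))); last by rewrite pq mulr1.
  by field; rewrite !gt_eqF // addr_gt0.
rewrite -[leLHS]mul1r ler_pdivlMr; last by rewrite !mulr_gt0 // ltr_wpDl // ltW.
rewrite mul1r mulrC ler_pdivrMr; last by rewrite !mulr_gt0 // exprn_gt0.
have h1 : p * q * (p + q) <= q * q * (q + q).
  apply: ler_pM; rewrite ?mulr_ge0 ?addr_ge0 ?(ltW p0) ?(ltW q0) //.
    by rewrite ler_wpM2r // ltW.
  by rewrite lerD2r.
by apply: (le_trans h1); rewrite le_eqVlt; apply/orP; left; apply/eqP; ring.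
Qed.

Lemma sum_inv_sqrt_shift (j a b : nat) : (j <= a)%N -> (a < b)%N ->
  \sum_(a <= k < b) (Num.sqrt ((k - j)%:R + 1))^-1
    <= 2 * (b - a)%:R / Num.sqrt (b - j)%:R :> R.
Proof.
move=> ja ab; rewrite -{1}(subnK ja) -{1}(subnK (leq_trans ja (ltnW ab))).
rewrite big_addn addnK; under eq_bigr do rewrite addnK.
apply: le_trans (sum_inv_sqrt R _) _; first by rewrite leq_sub2r // ltnW.
have bj : (0 : R) < (b - j)%:R by rewrite ltr0n subn_gt0 (leq_ltn_trans ja).
have e1 := sqr_sqrtr (ltW bj); have e2 := sqr_sqrtr (ler0n R (a - j)).
have bp : 0 < Num.sqrt (b - j)%:R :> R by rewrite sqrtr_gt0.
have ap : 0 <= Num.sqrt (a - j)%:R :> R by rewrite sqrtr_ge0.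
have ba : (b - a)%:R = (b - j)%:R - (a - j)%:R :> R.
  by rewrite -natrB ?leq_sub2r ?(ltnW ab) //; congr _%:R; lia.
have pq : Num.sqrt (a - j)%:R <= Num.sqrt (b - j)%:R :> R.
  by rewrite ler_sqrt ?(ltW bj) // ler_nat leq_sub2r // ltnW.
rewrite ba ler_pdivlMr // -!mulrA ler_wpM2l //.
move: e1 e2 bp ap pq; set p := Num.sqrt (b - j)%:R; set q := Num.sqrt (a - j)%:R.
move=> e1 e2 bp ap pq; rewrite -e1 -e2.
have : 0 <= q * (p - q) by rewrite mulr_ge0 // subr_ge0.
by move=> h; nra.
Qed.

End Sums.

Section Windows.
Variables (R : realType) (a : nat -> nat).
Hypothesis a_incr : forall m n : nat, (1 <= m)%N -> (m < n)%N -> (a m < a n)%N.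

Definition gap (n : nat) : nat := a n.+1 - a n.
Definition Phi (N : nat) : R := \sum_(1 <= n < N) n%:R^-1 * phi1 R a n.

Lemma a_mono m n : (1 <= m)%N -> (m <= n)%N -> (a m <= a n)%N.
Proof.
by move=> m1; rewrite leq_eqVlt => /orP[/eqP->//|mn]; exact/ltnW/a_incr.
Qed.

Lemma a_ge n : (1 <= n)%N -> (n <= (a n).+1)%N.
Proof.
elim: n => // -[|n] IH _ //; apply: (leq_ltn_trans (IH isT)).
by rewrite ltnS; exact: a_incr.
Qed.

Lemma gap_gt0 n : (1 <= n)%N -> (0 < gap n)%N.
Proof. by move=> n1; rewrite subn_gt0; exact: a_incr. Qed.

Lemma aS_gt0 n : (1 <= n)%N -> (0 < a n.+1)%N.
Proof. by move=> n1; apply: leq_ltn_trans (a_incr n1 (ltnSn n)). Qed.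

Lemma phi_ge0 n : 0 <= phi1 R a n. Proof. exact: sqrtr_ge0. Qed.

Lemma gapE n : (1 <= n)%N -> (gap n)%:R = (a n.+1)%:R - (a n)%:R :> R.
Proof. by move=> n1; rewrite natrB // ltnW // a_incr. Qed.

Lemma phi_sqr n : (1 <= n)%N -> phi1 R a n ^+ 2 * (a n.+1)%:R = (gap n)%:R.
Proof.
move=> n1; have ap : (0 : R) < (a n.+1)%:R by rewrite ltr0n aS_gt0.
rewrite /phi1 -gapE // sqr_sqrtr ?divr_ge0 ?ler0n //.
by rewrite divfK // gt_eqF.
Qed.

Lemma phi_sqrt n : (1 <= n)%N ->
  phi1 R a n = Num.sqrt (gap n)%:R / Num.sqrt (a n.+1)%:R.
Proof. by move=> n1; rewrite /phi1 -gapE // sqrtrM ?ler0n // sqrtrV ?ler0n. Qed.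

Lemma big_windows (F : nat -> R) M N : (1 <= M)%N -> (M <= N)%N ->
  \sum_(a M <= k < a N) F k = \sum_(M <= n < N) \sum_(a n <= k < a n.+1) F k.
Proof.
move=> M1; elim: N => [|N IH]; first by rewrite leqn0 => /eqP->; rewrite !big_geq.
rewrite leq_eqVlt => /orP[/eqP->|]; first by rewrite !big_geq.
rewrite ltnS => MN; rewrite big_nat_recr //= -IH // -big_cat_nat //=.
  exact: a_mono.
by apply: a_mono => //; exact: leq_trans MN.
Qed.

Lemma Phi_ge0 N : 0 <= Phi N.
Proof. by apply: sumr_ge0 => n _; rewrite mulr_ge0 ?invr_ge0 ?phi_ge0. Qed.

Section Upper.
Hypothesis phi_mono : forall m n : nat,
  (1 <= m)%N -> (m <= n)%N -> phi1 R a n <= phi1 R a m.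

(** Every window from [m.+1] to [n] has relative length at least
    [phi1 R a n ^+ 2]. *)
Lemma gap_growth m n t : (1 <= m)%N -> (m.+1 + t <= n.+1)%N ->
  phi1 R a n ^+ 2 * t%:R * (a m.+1)%:R <= (a (m.+1 + t))%:R - (a m.+1)%:R.
Proof.
move=> m1; elim: t => [|t IH] h; first by rewrite addn0 mulr0 mul0r subrr.
have m1t : (1 <= m.+1 + t)%N by [].
rewrite addnS in h; have tn : (m.+1 + t <= n)%N by [].
have g := phi_sqr m1t; rewrite gapE // in g.
rewrite addnS -natr1.
have le2 : phi1 R a n ^+ 2 <= phi1 R a (m.+1 + t) ^+ 2.
  by rewrite ler_pXn2r ?nnegrE ?phi_ge0 //; exact: phi_mono.
have la : (a m.+1)%:R <= (a (m.+1 + t).+1)%:R :> R.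
  by rewrite ler_nat; apply: a_mono => //; rewrite -addnS leq_addr.
have e : phi1 R a n ^+ 2 * (a m.+1)%:R <= (a (m.+1 + t).+1)%:R - (a (m.+1 + t))%:R.
  by rewrite -g; apply: ler_pM => //; rewrite sqr_ge0.
have IH' := IH (ltnW h).
have := lerD IH' e; set x := phi1 R a n ^+ 2 => e'; lra.
Qed.

(** Monotonicity of [phi1] makes the distance from window [m] to the end of
    window [n] at least of order [min (1, (n - m) * phi1 n ^+ 2)] times
    [a n.+1]; this is what makes the walk forget window [m]. *)
Lemma kernel_window m n j : (1 <= m)%N -> (m < n)%N -> (j < a m.+1)%N ->
  (Num.sqrt (gap n)%:R)^-1 *
    (\sum_(a n <= k < a n.+1) (Num.sqrt ((k - j)%:R + 1))^-1) <=
  2 * ((Num.sqrt (n - m)%:R)^-1 + phi1 R a n).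
Proof.
move=> m1 mn jm; have n1 : (1 <= n)%N by apply: leq_trans mn.
have jn : (j <= a n)%N by apply: ltnW; apply: leq_trans jm _; exact: a_mono.
have an : (a n < a n.+1)%N by exact: a_incr.
have gp : (0 : R) < (gap n)%:R by rewrite ltr0n gap_gt0.
have sg : 0 < Num.sqrt (gap n)%:R :> R by rewrite sqrtr_gt0.
apply: le_trans (ler_wpM2l (ltW _) (sum_inv_sqrt_shift R jn an)) _.
  by rewrite invr_gt0.
set B := (a n.+1 - j)%N; set l := (n - m)%N.
have Bp : (0 : R) < B%:R by rewrite ltr0n subn_gt0 (leq_ltn_trans jn).
have lp : (0 : R) < l%:R by rewrite ltr0n subn_gt0.
have -> : (Num.sqrt (gap n)%:R)^-1 * (2 * (a n.+1 - a n)%:R / Num.sqrt B%:R) =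
    2 * Num.sqrt ((gap n)%:R / B%:R) :> R.
  rewrite -/(gap n) sqrtrM ?ler0n // sqrtrV ?ler0n //.
  by rewrite -{2}(sqr_sqrtr (ltW gp)); field; rewrite !gt_eqF // sqrtr_gt0.
rewrite ler_wpM2l //.
have f0 := phi_ge0 n; have l0 : 0 <= (Num.sqrt l%:R)^-1 :> R by rewrite invr_ge0 sqrtr_ge0.
rewrite -(@ler_pXn2r _ 2) ?nnegrE ?addr_ge0 ?sqrtr_ge0 //.
rewrite sqr_sqrtr ?divr_ge0 ?ler0n //.
have hl : (Num.sqrt l%:R)^-1 ^+ 2 = l%:R^-1 :> R by rewrite exprVn sqr_sqrtr ?ltW.
apply: (@le_trans _ _ (l%:R^-1 + phi1 R a n ^+ 2)); last first.
  rewrite sqrrD hl -addrA lerD2l lerDr -mulr_natl.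
  by rewrite !mulr_ge0.
have := @gap_growth m n l m1; rewrite addSn subnKC ?(ltnW mn) // => /(_ (leqnn _)).
rewrite -(phi_sqr n1); set f2 := phi1 R a n ^+ 2 => hD.
have f20 : 0 <= f2 by exact: sqr_ge0.
have BD : (a n.+1)%:R - (a m.+1)%:R <= B%:R :> R.
  by rewrite -natrB ?ler_nat; [rewrite leq_sub2l // ltnW|apply: a_mono => //; exact: leqW].
have am : (0 : R) <= (a m.+1)%:R by [].
rewrite ler_pdivrMr // -(ler_pM2l lp).
have -> : l%:R * ((l%:R^-1 + f2) * B%:R) = (1 + f2 * l%:R) * B%:R by field; rewrite gt_eqF.
have fl : 0 <= 1 + f2 * l%:R by rewrite addr_ge0 ?mulr_ge0.
apply: le_trans (ler_wpM2l fl BD); move: hD.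
set y := f2 * l%:R => hD.
have -> : l%:R * (f2 * (a n.+1)%:R) = y * (a n.+1)%:R by rewrite mulrA [l%:R * _]mulrC.
by lra.
Qed.

Lemma kernel_same m j : (1 <= m)%N -> (a m <= j < a m.+1)%N ->
  (Num.sqrt (gap m)%:R)^-1 *
    (\sum_(j <= k < a m.+1) (Num.sqrt ((k - j)%:R + 1))^-1) <= 2 :> R.
Proof.
move=> m1 /andP[j1 j2].
have gp : (0 : R) < (gap m)%:R by rewrite ltr0n gap_gt0.
have sg : 0 < Num.sqrt (gap m)%:R :> R by rewrite sqrtr_gt0.
apply: le_trans (ler_wpM2l (ltW _) (sum_inv_sqrt_shift R (leqnn j) j2)) _.
  by rewrite invr_gt0.
have Bp : (0 : R) < (a m.+1 - j)%:R by rewrite ltr0n subn_gt0.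
rewrite -{1}(sqr_sqrtr (ltW Bp)) expr2 -!mulrA divff ?mulr1; last first.
  by rewrite gt_eqF // sqrtr_gt0.
rewrite mulrCA ler_piMr // mulrC ler_pdivrMr // mul1r ler_sqrt ?(ltW gp) //.
by rewrite ler_nat leq_sub2l.
Qed.

Variable nk : nat -> nat.
Hypothesis nkE : forall n k, (1 <= n)%N -> (a n <= k < a n.+1)%N -> nk k = n.

(** Up to a constant the summand bounds the probability of a visit at [k] given
    one at [j], weighted by the inverse root of the length of its window.  The
    window at distance [l] contributes [l^-1 * (l ^-1/2 + phi1 l)]. *)
Lemma kernel_sum m N j : (1 <= m)%N -> (m < N)%N -> (a m <= j < a m.+1)%N ->
  \sum_(j <= k < a N) (Num.sqrt (gap (nk k))%:R)^-1 *
     ((Num.sqrt ((k - j)%:R + 1))^-1 / ((nk k - nk j)%:R + 1)) <= 8 + 2 * Phi N.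
Proof.
move=> m1 mN hj; have /andP[j1 j2] := hj.
rewrite (@big_cat_nat _ _ _ (a m.+1)) //=; [|exact: ltnW|exact: a_mono].
have nj : nk j = m by exact: nkE.
have first : \sum_(j <= k < a m.+1) (Num.sqrt (gap (nk k))%:R)^-1 *
     ((Num.sqrt ((k - j)%:R + 1))^-1 / ((nk k - nk j)%:R + 1)) <= 2 :> R.
  apply: le_trans (kernel_same m1 hj); rewrite mulr_sumr.
  rewrite big_nat_cond [leRHS]big_nat_cond; apply: ler_sum => k /andP[/andP[jk km] _].
  have -> : nk k = m by apply: nkE => //; rewrite km (leq_trans j1).
  by rewrite nj subnn add0r invr1 mulr1.
apply: le_trans (lerD first (lexx _)) _.
suff : \sum_(a m.+1 <= k < a N) (Num.sqrt (gap (nk k))%:R)^-1 *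
     ((Num.sqrt ((k - j)%:R + 1))^-1 / ((nk k - nk j)%:R + 1)) <= 6 + 2 * Phi N.
  by move=> ?; lra.
rewrite big_windows //.
apply: (@le_trans _ _ (\sum_(m.+1 <= n < N) (2 * ((n - m)%:R * Num.sqrt (n - m)%:R)^-1 +
   2 * ((n - m)%:R^-1 * phi1 R a (n - m))))).
  rewrite big_nat_cond [leRHS]big_nat_cond; apply: ler_sum => n /andP[/andP[mn nN] _].
  have n1 : (1 <= n)%N by apply: leq_trans mn.
  have lp : (0 : R) < (n - m)%:R by rewrite ltr0n subn_gt0.
  apply: (@le_trans _ _ ((n - m)%:R^-1 * ((Num.sqrt (gap n)%:R)^-1 *
    (\sum_(a n <= k < a n.+1) (Num.sqrt ((k - j)%:R + 1))^-1)))).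
    rewrite !mulr_sumr big_nat_cond [leRHS]big_nat_cond.
    apply: ler_sum => k /andP[hk _].
    rewrite (nkE n1 hk) nj mulrA [leRHS]mulrC.
    rewrite ler_wpM2l ?mulr_ge0 ?invr_ge0 ?sqrtr_ge0 //.
    by rewrite lef_pV2 ?posrE ?ltr_wpDl // lerDl.
  apply: le_trans (ler_wpM2l (ltW _) (kernel_window m1 mn j2)) _.
    by rewrite invr_gt0.
  rewrite mulrCA -mulrDr ler_wpM2l // mulrDr invfM lerD2l.
  rewrite ler_wpM2l ?invr_ge0 //; apply: phi_mono; last exact: leq_subr.
  by rewrite subn_gt0.
rewrite -{1}(add1n m) -{1}(subnK (ltnW mN)) big_addn addnK.
under eq_bigr do rewrite addnK.
rewrite big_split /= -!mulr_sumr; apply: lerD.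
  by have := sum_pow32 R (N - m) => ?; lra.
rewrite ler_wpM2l // /Phi [leRHS](@big_cat_nat _ _ _ (N - m)) ?leq_subr ?subn_gt0 //=.
by rewrite lerDl; apply: sumr_ge0 => n _; rewrite mulr_ge0 ?invr_ge0 ?phi_ge0.
Qed.

End Upper.
End Windows.

Lemma count_multiples_aux (L b : nat) : (0 < L)%N ->
  (b <= L * (\sum_(0 <= k < b) (L %| k)) < b + L)%N.
Proof.
move=> L0; elim: b => [|b /andP[IH1 IH2]]; first by rewrite big_geq // muln0 add0n.
rewrite big_nat_recr //=; set f := (\sum_(0 <= _ < b) _)%N in IH1 IH2 *.
rewrite mulnDr; have [/dvdnP[c bc]|nd] := boolP (L %| b)%N.
  have : (L * f = b)%N.
    have fc : (f < c.+1)%N by rewrite -(ltn_pmul2l L0) mulnS addnC mulnC (mulnC L c) -bc mulnC.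
    have cf : (c <= f)%N by rewrite -(leq_pmul2l L0) (mulnC L c) -bc.
    by rewrite bc mulnC; congr (_ * _)%N; lia.
  by move=> ->; rewrite muln1; apply/andP; split; lia.
rewrite muln0 addn0; apply/andP; split; last by lia.
rewrite ltn_neqAle IH1 andbT; apply/negP => /eqP e.
by case/negP: nd; rewrite e dvdn_mulr.
Qed.

Lemma count_multiples (L a b : nat) : (0 < L)%N -> (a <= b)%N ->
  (b - a <= L * (\sum_(a <= k < b) (L %| k)) + L)%N.
Proof.
move=> L0 ab; have /andP[_ h1] := count_multiples_aux a L0.
have /andP[h2 _] := count_multiples_aux b L0; move: h2.
by rewrite (@big_cat_nat _ _ _ a) //= mulnDr; lia.
Qed.

Section LowerWindows.
Variables (R : realType) (a : nat -> nat).
Hypothesis a_incr : forall m n : nat, (1 <= m)%N -> (m < n)%N -> (a m < a n)%N.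
Hypothesis phi_mono : forall m n : nat,
  (1 <= m)%N -> (m <= n)%N -> phi1 R a n <= phi1 R a m.
Variable nk : nat -> nat.
Hypothesis nkE : forall n k, (1 <= n)%N -> (a n <= k < a n.+1)%N -> nk k = n.

Let x (n : nat) : R := n%:R^-1 * phi1 R a n.

Let x_ge0 n : 0 <= x n. Proof. by rewrite mulr_ge0 ?invr_ge0 // phi_ge0. Qed.

Lemma Phi_mono M N : (M <= N)%N -> Phi R a M <= Phi R a N.
Proof.
case: M => [|M] MN.
  by rewrite {1}/Phi big_geq // Phi_ge0.
rewrite /Phi [leRHS](@big_cat_nat _ _ _ M.+1) //= lerDl.
by apply: sumr_ge0 => n _; exact: x_ge0.
Qed.

(** The terms decrease, so the multiple of [L] opening each block of length [L]
    carries the largest of them. *)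
Lemma sum_multiples L M t : (0 < L)%N -> (0 < M)%N ->
  \sum_(L * M <= n < L * (M + t)) x n <=
  L%:R * \sum_(L * M <= n < L * (M + t)) (L %| n)%:R * x n.
Proof.
move=> L0 M0; elim: t => [|t IH]; first by rewrite addn0 !big_geq // mulr0.
have h1 : (L * M <= L * (M + t))%N by rewrite leq_mul2l leq_addr orbT.
have h2 : (L * (M + t) <= L * (M + t.+1))%N by rewrite leq_mul2l leq_add2l leqnSn orbT.
rewrite !(@big_cat_nat _ _ _ (L * (M + t)) (L * M) (L * (M + t.+1))) //=.
rewrite mulrDr; apply: lerD => //; set b := (L * (M + t))%N.
have b0 : (0 < b)%N by rewrite muln_gt0 L0 addn_gt0 M0.
have bE : (L * (M + t.+1) = b + L)%N by rewrite /b addnS mulnS addnC.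
rewrite bE; apply: (@le_trans _ _ (L%:R * x b)).
  have -> : L%:R * x b = \sum_(b <= n < b + L) x b.
    by rewrite sumr_const_nat addKn mulr_natl.
  rewrite big_nat_cond [leRHS]big_nat_cond; apply: ler_sum => n /andP[/andP[bn _] _].
  apply: ler_pM; rewrite ?invr_ge0 ?phi_ge0 //; last exact: phi_mono.
  by rewrite lef_pV2 ?posrE ?ltr0n ?ler_nat // (leq_trans b0).
rewrite ler_wpM2l // big_ltn; last by rewrite -[ltnLHS]addn0 ltn_add2l.
rewrite dvdn_mulr // mul1r lerDl; apply: sumr_ge0 => n _.
by rewrite mulr_ge0 // x_ge0.
Qed.

(** At least [gap a n / L - 1] multiples of [L] lie in the window; the loss of
    one is paid by the summable last term. *)
Lemma window_ge L n : (0 < L)%N -> (1 <= n)%N ->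
  x n / (2 * L%:R) - (n%:R * Num.sqrt n%:R)^-1 <=
  \sum_(a n <= k < a n.+1) (L %| k)%:R *
    ((Num.sqrt (gap a n)%:R)^-1 * ((Num.sqrt (k%:R + 1))^-1 / (n%:R + 1))) :> R.
Proof.
move=> L0 n1; have an := a_incr n1 (ltnSn n).
have Lp : (0 : R) < L%:R by rewrite ltr0n.
have np : (0 : R) < n%:R by rewrite ltr0n.
have np1 : (0 : R) < n%:R + 1 by rewrite addr_gt0.
have g0 := gap_gt0 a_incr n1.
have gp : (0 : R) < (gap a n)%:R by rewrite ltr0n.
have Ap : (0 : R) < (a n.+1)%:R by rewrite ltr0n (aS_gt0 a_incr n1).
set w := (Num.sqrt (gap a n)%:R)^-1; pose A : R := (Num.sqrt (a n.+1)%:R)^-1.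
have w0 : 0 < w by rewrite invr_gt0 sqrtr_gt0.
have A0 : 0 < A by rewrite invr_gt0 sqrtr_gt0.
pose cnt := (\sum_(a n <= k < a n.+1) (L %| k))%N.
apply: (@le_trans _ _ (cnt%:R * (w * (A / (n%:R + 1))))); last first.
  rewrite /cnt natr_sum mulr_suml big_nat_cond [leRHS]big_nat_cond.
  apply: ler_sum => k /andP[/andP[k1 k2] _]; rewrite ler_wpM2l // ler_pM2l //.
  rewrite ler_pM2r ?invr_gt0 // /A lef_pV2 ?posrE ?sqrtr_gt0 ?ltr_wpDl //.
  by rewrite ler_sqrt // natr1 ler_nat.
have := count_multiples L0 (ltnW an); rewrite -/cnt -/(gap a n).
rewrite -(ler_nat R) natrD natrM => hc.
have cnt_ge : (gap a n)%:R / L%:R - 1 <= cnt%:R :> R.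
  rewrite lerBlDr ler_pdivrMr //; apply: (le_trans hc).
  by rewrite le_eqVlt; apply/orP; left; apply/eqP; ring.
have u0 : 0 < w * (A / (n%:R + 1)) by apply: mulr_gt0 => //; exact: divr_gt0.
apply: le_trans (ler_wpM2r (ltW u0) cnt_ge).
have fE : phi1 R a n = (gap a n)%:R * (w * A).
  rewrite (phi_sqrt R a_incr n1) -{2}(sqr_sqrtr (ltW gp)) /w /A.
  by field; rewrite !gt_eqF // sqrtr_gt0.
have -> : ((gap a n)%:R / L%:R - 1) * (w * (A / (n%:R + 1))) =
    phi1 R a n / (n%:R + 1) / L%:R - w * A / (n%:R + 1).
  by rewrite fE; field; rewrite !gt_eqF.
apply: lerB.
  rewrite /x invfM !mulrA ler_pM2r ?invr_gt0 // mulrAC [_ * phi1 _ _ _]mulrC.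
  rewrite ler_wpM2l ?phi_ge0 // -invfM lef_pV2 ?posrE ?mulr_gt0 //.
  by have : (1 : R) <= n%:R by [rewrite ler1n]; move=> ?; lra.
have w1 : w <= 1.
  rewrite invf_le1 ?sqrtr_gt0 // -sqrtr1 ler_sqrt ?ler0n // sqrtr1 ler1n //.
have An : A <= (Num.sqrt n%:R)^-1.
  rewrite /A lef_pV2 ?posrE ?sqrtr_gt0 // ler_sqrt ?ler0n // ler_nat.
  by have := a_ge a_incr (isT : (1 <= n.+1)%N).
rewrite invfM mulrC; apply: ler_pM.
- by rewrite invr_ge0 ltW.
- by rewrite mulr_ge0 // ltW.
- by rewrite lef_pV2 ?posrE // lerDl.
- by rewrite -[leRHS]mul1r; apply: ler_pM => //; exact: ltW.
Qed.

Hypothesis Phi_unbounded : forall A, exists N, A <= Phi R a N.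

(** The restriction to multiples of [L] is where the period of the walk enters;
    it costs a constant factor and a bounded amount, absorbed by the divergence
    of [Phi]. *)
Lemma windows_ge L : (0 < L)%N -> exists2 c, 0 < c &
  forall M, (0 < M)%N -> exists2 N, (M < N)%N &
  c * (1 + Phi R a N) <= \sum_(a M <= k < a N) ((L %| k)%N && (L %| nk k)%N)%:R *
    ((Num.sqrt (gap a (nk k))%:R)^-1 *
      ((Num.sqrt (k%:R + 1))^-1 / ((nk k)%:R + 1))) :> R.
Proof.
move=> L0; have Lp : (0 : R) < L%:R by rewrite ltr0n.
have L1 : (1 : R) <= L%:R by rewrite ler1n.
have Lp2 : 0 < 8 * L%:R ^+ 2 :> R by rewrite mulr_gt0 // exprn_gt0.
exists (8 * L%:R ^+ 2)^-1; first by rewrite invr_gt0.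
move=> M M0; pose M1 := (L * M)%N.
have [t ht] := Phi_unbounded (2 * Phi R a M1 + 8 * L%:R ^+ 2 + 1).
pose N := (L * (M + t.+1))%N.
have tN : (t <= N)%N.
  by apply: (@leq_trans (M + t.+1)); [lia|rewrite leq_pmull].
have MM1 : (M <= M1)%N by rewrite leq_pmull.
have M1N : (M1 < N)%N by rewrite ltn_pmul2l // addnS ltnS leq_addr.
have M10 : (0 < M1)%N by rewrite muln_gt0 L0.
exists N; first exact: leq_ltn_trans M1N.
have hN := le_trans ht (Phi_mono tN).
pose F k : R := ((L %| k)%N && (L %| nk k)%N)%:R *
    ((Num.sqrt (gap a (nk k))%:R)^-1 *
      ((Num.sqrt (k%:R + 1))^-1 / ((nk k)%:R + 1))).
have F0 k : 0 <= F k.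
  by rewrite /F !mulr_ge0 ?invr_ge0 ?sqrtr_ge0 ?addr_ge0.
apply: (@le_trans _ _ (\sum_(a M1 <= k < a N) F k)); last first.
  rewrite [leRHS](@big_cat_nat _ _ _ (a M1)) /=; [|exact: a_mono|by apply: a_mono => //; exact: ltnW].
  by rewrite lerDr sumr_ge0.
rewrite (big_windows a_incr) ?(ltnW M1N) //.
apply: (@le_trans _ _ (\sum_(M1 <= n < N)
   ((L %| n)%:R * x n / (2 * L%:R) - (n%:R * Num.sqrt n%:R)^-1))); last first.
  rewrite big_nat_cond [leRHS]big_nat_cond; apply: ler_sum => n /andP[/andP[n1 _] _].
  have n0 : (1 <= n)%N by exact: leq_trans n1.
  case: (boolP (L %| n)%N) => Ln; last first.
    rewrite !mul0r sub0r; apply: (@le_trans _ _ 0); last by apply: sumr_ge0 => k _; exact: F0.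
    by rewrite oppr_le0 invr_ge0 mulr_ge0 ?sqrtr_ge0.
  rewrite mul1r; apply: le_trans (window_ge L0 n0) _.
  rewrite big_nat_cond [leRHS]big_nat_cond; apply: ler_sum => k /andP[hk _].
  by rewrite /F (nkE n0 hk) Ln andbT.
rewrite sumrB -mulr_suml.
have z : \sum_(M1 <= n < N) (n%:R * Num.sqrt n%:R)^-1 <= 3 :> R.
  apply: le_trans (sum_pow32 R N); rewrite [leRHS](@big_cat_nat _ _ _ M1) ?(ltnW M1N) //=.
  by rewrite lerDr sumr_ge0 // => n _; rewrite invr_ge0 mulr_ge0 ?sqrtr_ge0.
have y := sum_multiples t.+1 L0 M0; rewrite -/M1 -/N in y.
have y1 : \sum_(M1 <= n < N) x n = Phi R a N - Phi R a M1.
  by rewrite /Phi (@big_cat_nat _ _ _ M1 1 N) ?(ltnW M1N) //= addrAC subrr add0r.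
rewrite y1 in y; set S := \sum_(M1 <= n < N) _ * _ in y *.
have P0 := Phi_ge0 R a M1.
have h1 : Phi R a N - Phi R a M1 <= L%:R * S by [].
rewrite mulrC ler_pdivrMr //.
have e : S / (2 * L%:R) * (8 * L%:R ^+ 2) = 4 * (L%:R * S) by field; rewrite gt_eqF.
have e3 := ler_wpM2r (ltW Lp2) z.
rewrite mulrBl e; move: e3 h1 hN P0.
set z' := \sum_(_ <= _ < _) _; set q := 8 * _ ^+ 2.
have q8 : 8 <= q.
  have : (1 : R) <= L%:R ^+ 2 by rewrite exprn_ege1.
  by rewrite /q => ?; lra.
move=> e3 h1 hN P0; lra.
Qed.

End LowerWindows.

(** * Coordinates of a step *)

Definition zcoord (D : nat) (i : 'I_D) (w : lattice D) : int := (w : 'rV[int]_D) 0 i.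

Section StepOperator.
Variables (R : realType) (D : nat) (F : probability (lattice D) R) (i : 'I_D).

Definition step_op (g : int -> R) (x : int) : R := \int[F]_w g (x + zcoord i w).

Lemma lattice_measurable (A : set (lattice D)) : measurable A. Proof. by []. Qed.

Lemma lattice_measurable_fun d (U : measurableType d) (f : lattice D -> U) (B : set (lattice D)) :
  measurable_fun B f.
Proof. by move=> _ Y mY; exact: lattice_measurable. Qed.

Lemma bnd_integrable (f : lattice D -> R) : (exists A, forall w, `|f w| <= A) ->
  F.-integrable setT (EFin \o f).
Proof.
move=> [A hA]; apply: measurable_bounded_integrable => //.
- by apply: (le_lt_trans (probability_le1 F _)) => //; exact: ltry.
- exists A; split; first exact: num_real.
  by move=> M AM w _; apply: le_trans (hA w) (ltW AM).
Qed.

Lemma step_integrable (g : int -> R) x : bnd g ->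
  F.-integrable setT (EFin \o (fun w => g (x + zcoord i w))).
Proof. by move=> [A hA]; apply: bnd_integrable; exists A. Qed.

Hypothesis F_mean : mean_zero F.
Hypothesis F_var : finite_variance F.

Definition second_moment : R := \int[F]_w ((zcoord i w)%:~R ^+ 2).

Lemma coord_integrable : F.-integrable setT (EFin \o (fun w => (zcoord i w)%:~R)).
Proof. by have [] := F_mean i. Qed.

Lemma coord_mean : \int[F]_w ((zcoord i w)%:~R : R) = 0.
Proof.
have [_] := F_mean i; rewrite unlock /Rintegral => e.
by rewrite (_ : (\int[F]_x _)%E = 0%E).
Qed.

Lemma sqr_integrable : F.-integrable setT (EFin \o (fun w => (zcoord i w)%:~R ^+ 2)).
Proof.
have := F_var i; have [_ E0] := F_mean i.
rewrite /variance unlock E0 /= => h.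
apply/integrableP; split; first by [].
move: h; rewrite unlock; apply: le_lt_trans.
rewrite le_eqVlt; apply/orP; left; apply/eqP; apply: eq_integral => w _.
rewrite /= ger0_norm ?sqr_ge0 //.
by rewrite /lattice_coord /zcoord /= !fctE /= subr0 expr2.
Qed.

(** For [walk_trunc]: the mean of a minimum is at most the minimum of the means,
    and a centred step adds exactly its variance to the mean square. *)
Lemma is_walk_step : is_walk second_moment step_op.
Proof.
have F1 : fine (F setT) = 1 by rewrite probability_setT.
split.
- move=> f g bf bg; apply/funext => x; rewrite /step_op.
  by rewrite RintegralD //; exact: step_integrable.
- move=> c f bf; apply/funext => x; rewrite /step_op.
  by rewrite RintegralZl //; exact: step_integrable.
- by move=> f bf f0 x; apply: Rintegral_ge0.
- by apply/funext => x; rewrite /step_op Rintegral_cst // F1 mulr1.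
- by move=> h f; apply/funext => x; rewrite /step_op; under eq_Rintegral do rewrite addrAC.
- move=> A x A0; rewrite /step_op.
  have bA := bnd_trunc A0 (R := R).
  have s0 : 0 <= second_moment by apply: Rintegral_ge0 => w _; exact: sqr_ge0.
  case: (leP A (x%:~R ^+ 2)) => xA.
    rewrite {2}/trunc_sqr min_r //.
    apply: (@le_trans _ _ (\int[F]_w A)).
      apply: le_Rintegral => //; first exact: step_integrable.
        by apply: bnd_integrable; exists `|A|.
      by move=> w _; rewrite /trunc_sqr ge_min lexx orbT.
    by rewrite Rintegral_cst // F1 mulr1 lerDl.
  rewrite {2}/trunc_sqr min_l ?(ltW xA) //.
  have i1 : F.-integrable setT (EFin \o (fun w => 2 * x%:~R * (zcoord i w)%:~R : R)).
    exact: (integrableZl measurableT (2 * x%:~R) coord_integrable).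
  have i0 : F.-integrable setT (EFin \o (fun _ : lattice D => x%:~R ^+ 2 : R)).
    by apply: bnd_integrable; exists `|x%:~R ^+ 2|.
  have i2 := sqr_integrable.
  have i01 : F.-integrable setT (EFin \o (fun w : lattice D =>
      (x%:~R ^+ 2 + 2 * x%:~R * (zcoord i w)%:~R) : R)).
    exact: (integrableD measurableT i0 i1).
  have i012 : F.-integrable setT (EFin \o (fun w : lattice D =>
      (x%:~R ^+ 2 + 2 * x%:~R * (zcoord i w)%:~R + (zcoord i w)%:~R ^+ 2) : R)).
    exact: (integrableD measurableT i01 i2).
  apply: (@le_trans _ _ (\int[F]_w (x%:~R ^+ 2 + 2 * x%:~R * (zcoord i w)%:~R +
    (zcoord i w)%:~R ^+ 2))).
    apply: le_Rintegral => //; first exact: step_integrable.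
    move=> w _; rewrite /trunc_sqr ge_min; apply/orP; left.
    by rewrite le_eqVlt; apply/orP; left; apply/eqP; rewrite intrD; ring.
  rewrite (RintegralD measurableT i01 i2) (RintegralD measurableT i0 i1).
  rewrite (RintegralZl _ measurableT coord_integrable).
  by rewrite coord_mean Rintegral_cst // F1 mulr1 mulr0 addr0.
Qed.

Lemma step_delta y : step_op (delta R y) 0 = fine (F [set w | zcoord i w = y]).
Proof.
rewrite /step_op; set E := [set w | _].
have -> : (fun w => delta R y (0 + zcoord i w)) = \1_E.
  apply/funext => w; rewrite /delta add0r indicE.
  suff -> : (w \in E) = (zcoord i w == y) by [].
  by apply/idP/eqP; rewrite inE.
by rewrite /Rintegral integral_indic // setIT.
Qed.

End StepOperator.

Section Atoms.
Variables (R : realType) (D : nat) (F : probability (lattice D) R).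

(** Otherwise the mean would be at most the contribution of the atom [y], which
    is negative. *)
Lemma atom_opposite (xi : lattice D -> int) (y : int) :
  F.-integrable setT (EFin \o (fun w => (xi w)%:~R)) ->
  \int[F]_w ((xi w)%:~R : R) = 0 -> y < 0 ->
  (0 < F [set w | xi w = y])%E -> exists2 u, 0 < u & (0 < F [set w | xi w = u])%E.
Proof.
move=> ixi mean y0 hy; apply: contrapT => no.
have null u : 0 < u -> F [set w | xi w = u] = 0%E.
  move=> u0; apply/eqP; rewrite eq_le measure_ge0 andbT leNgt.
  by apply/negP => h; apply: no; exists u.
pose g w : R := if 0 < xi w then 0 else (xi w)%:~R.
pose N := [set w | 0 < xi w].
have N0 : F.-negligible N.
  apply: (@negligibleS _ _ _ _ (\bigcup_n [set w | xi w = n.+1%:Z])).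
    move=> w /=; rewrite /N /=; case e: (xi w) => [[|n]|n] //= _.
    by exists n.
  by apply: negligible_bigcup => n; apply/negligibleP; [exact: lattice_measurable|exact: null].
have Neq : ae_eq F setT (EFin \o (fun w => (xi w)%:~R : R)) (EFin \o g).
  case: N0 => M [mM M0 NM]; exists M; split => // w /= hw; apply: NM.
  rewrite /N /=; apply: contrapT => hn; apply: hw => _.
  by rewrite /g /=; case: ifP.
have ig : F.-integrable setT (EFin \o g).
  apply: le_integrable ixi; [exact: measurableT|by []|].
  move=> w _ /=; rewrite lee_fin /g; case: ifP => // _.
  by rewrite normr0.
have gI : \int[F]_w g w = 0.
  rewrite -mean /Rintegral; congr fine.
  by apply: esym; apply: (ae_eq_integral (EFin \o g) _ measurableT _ _ Neq).
have : \int[F]_w g w <= \int[F]_w (y%:~R * \1_[set w | xi w = y] w).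
  apply: le_Rintegral => //.
    apply: bnd_integrable; exists `|y%:~R| => w; rewrite normrM indicE.
    by rewrite ler_piMr // normr_nat lern1 leq_b1.
  move=> w _; rewrite /g indicE; case: ifP => h; case: (boolP (w \in _)) => hw.
  - by move: hw; rewrite inE /= => e; move: h; rewrite e; move: y0; clear; lia.
  - by rewrite mulr0.
  - by move: hw; rewrite inE /= => ->; rewrite mulr1.
  - by rewrite mulr0 lerz0; move: h; clear; lia.
rewrite gI RintegralZl //; last first.
  apply: bnd_integrable; exists 1 => w; rewrite indicE.
  by rewrite normr_nat lern1 leq_b1.
rewrite /Rintegral integral_indic // setIT leNgt => /negP; apply.
rewrite nmulr_rlt0 ?ltrz0 //.
by apply: fine_gt0; rewrite hy /= (le_lt_trans (probability_le1 F _)) // ltry.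
Qed.

(** Not being supported on a coordinate hyperplane gives a nonzero atom. *)
Lemma step_atoms (i : 'I_D) : truly_dimensional F -> mean_zero F ->
  (exists2 u, 0 < u & 0 < step_op F i (delta R u) 0) /\
  (exists2 v, v < 0 & 0 < step_op F i (delta R v) 0).
Proof.
move=> Ftruly Fmean.
have pos y : (0 < F [set w | zcoord i w = y])%E -> 0 < step_op F i (delta R y) 0.
  move=> h; rewrite step_delta; apply: fine_gt0; rewrite h /=.
  by rewrite (le_lt_trans (probability_le1 F _)) // ltry.
have ic := coord_integrable i Fmean; have mc := coord_mean i Fmean.
have opp y : [set w | zcoord i w = y] = [set w | - zcoord i w = - y].
  by apply/seteqP; split => w /= => [->//|/oppr_inj].
have icN : F.-integrable setT (EFin \o (fun w => (- zcoord i w)%:~R)).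
  have := integrableN ic; congr integrable.
  by apply/funext => w /=; rewrite intrN.
have mcN : \int[F]_w ((- zcoord i w)%:~R : R) = 0.
  transitivity (\int[F]_w (-1 * (zcoord i w)%:~R : R)).
    by apply: eq_Rintegral => w _; rewrite intrN mulN1r.
  by rewrite RintegralZl // mc mulr0.
have [y y0 hy] : exists2 y, y != 0 & (0 < F [set w | zcoord i w = y])%E.
  apply: contrapT => no.
  have null y : y != 0 -> F [set w | zcoord i w = y] = 0%E.
    move=> u0; apply/eqP; rewrite eq_le measure_ge0 andbT leNgt.
    by apply/negP => h; apply: no; exists y.
  pose f : 'rV[R]_D -> R^o := fun x => x 0 i.
  have flin : linear f by move=> c x z; rewrite /f !mxE.
  pose fl : {linear 'rV[R]_D -> R^o} := HB.pack f (GRing.isLinear.Build _ _ _ _ f flin).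
  pose V := lker (linfun fl).
  have VE x : (x \in V) = (x 0 i == 0) by rewrite memv_ker lfunE.
  have Vn : V != fullv.
    apply/eqP => e; have : delta_mx 0 i \in V by rewrite e memvf.
    by rewrite VE mxE !eqxx oner_eq0.
  have := Ftruly V Vn; apply/negP; rewrite negbK.
  have -> : [set x | to_real R x \in V] = ~` [set w | zcoord i w <> 0].
    apply/seteqP; split => w /=; rewrite VE !mxE /lattice_coord intr_eq0.
      by move=> /eqP e; apply.
    by move/contrapT => /eqP.
  rewrite probability_setC; last exact: lattice_measurable.
  have -> : F [set w | zcoord i w <> 0] = 0%E; last by rewrite sube0.
  apply/negligibleP; first exact: lattice_measurable.
  apply: (@negligibleS _ _ _ _ (\bigcup_n [set w | zcoord i w <> 0 /\ pickle (zcoord i w) = n])).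
    by move=> w /= hw; exists (pickle (zcoord i w)).
  apply: negligible_bigcup => n; apply/negligibleP; first exact: lattice_measurable.
  have [[w [w0 wn]]|em] := pselect (exists w, zcoord i w <> 0 /\ pickle (zcoord i w) = n).
    have -> : [set w | zcoord i w <> 0 /\ pickle (zcoord i w) = n] = [set w' | zcoord i w' = zcoord i w].
      apply/seteqP; split => w' /=.
        by move=> [_ h]; apply: (pcan_inj pickleK); rewrite h.
      by move=> ->.
    by apply: null; apply/eqP.
  rewrite (_ : [set w | _] = set0) ?measure0 //.
  by apply/seteqP; split => // w hw; apply: em; exists w.
have neg_pos z : z < 0 -> (0 < F [set w | zcoord i w = z])%E ->
    exists2 u, 0 < u & (0 < F [set w | zcoord i w = u])%E.
  exact: atom_opposite ic mc.
have pos_neg z : 0 < z -> (0 < F [set w | zcoord i w = z])%E ->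
    exists2 u, u < 0 & (0 < F [set w | zcoord i w = u])%E.
  move=> z0; rewrite opp => hz.
  have nz : - z < 0 by rewrite oppr_lt0.
  have [u u0 hu] := atom_opposite icN mcN nz hz.
  by exists (- u); rewrite ?oppr_lt0 // opp opprK.
case: (ltgtP y 0) y0 => // yy _.
- have [u u0 hu] := neg_pos _ yy hy.
  by split; [exists u|exists y] => //; exact: pos.
- have [u u0 hu] := pos_neg _ yy hy.
  by split; [exists y|exists u] => //; exact: pos.
Qed.

End Atoms.

(** * Independence and the Markov property *)

Section Fibers.
Variables (R : realType) (d : measure_display) (T : measurableType d).
Variables (mu : {measure set T -> \bar R}) (I : countType) (xi : T -> I).
Hypothesis xi_fib : forall i, measurable (xi @^-1` [set i]).

Local Notation fib n := [set w | pickle (xi w) = n].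

Lemma fib_cases n : fib n = set0 \/ exists i, fib n = xi @^-1` [set i].
Proof.
have [[w wn]|no] := pselect (exists w, pickle (xi w) = n).
  right; exists (xi w); apply/seteqP; split => w' /=.
    by rewrite -wn => /(pcan_inj pickleK).
  by move=> ->.
by left; apply/seteqP; split => // w hw; apply: no; exists w.
Qed.

Lemma fib_measurable n : measurable (fib n).
Proof. by case: (fib_cases n) => [->|[i ->]]. Qed.

Lemma fib_cover : \bigcup_n fib n = setT.
Proof. by apply/seteqP; split => // w _; exists (pickle (xi w)). Qed.

Lemma fib_triv : trivIset setT (fun n => fib n).
Proof. by apply/trivIsetP => m n _ _ mn; apply/seteqP; split => // w [/= em en]; move: mn; rewrite -em -en eqxx. Qed.

Lemma fibers_measurable (A : set I) : measurable (xi @^-1` A).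
Proof.
have -> : xi @^-1` A = \bigcup_n (fib n `&` xi @^-1` A).
  by rewrite -setI_bigcupl fib_cover setTI.
apply: bigcup_measurable => n _.
case: (fib_cases n) => [->|[i ->]]; first by rewrite set0I.
have [Ai|nAi] := pselect (A i).
  by rewrite (_ : _ `&` _ = xi @^-1` [set i]) //; apply/seteqP; split => w /= [] // ->.
rewrite (_ : _ `&` _ = set0) //.
by apply/seteqP; split => // w /= [->].
Qed.

Lemma fibers_measurable_fun d' (U : measurableType d') (g : I -> U) :
  measurable_fun setT (g \o xi).
Proof. by move=> _ Y mY; rewrite setTI; exact: (fibers_measurable (g @^-1` Y)). Qed.

Local Open Scope ereal_scope.

Lemma integral_fibers (f : T -> \bar R) : measurable_fun setT f ->
  (forall w, 0 <= f w) ->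
  \int[mu]_w f w = \sum_(0 <= n <oo) \int[mu]_(w in fib n) f w.
Proof.
move=> mf f0; rewrite -ge0_integral_bigcup ?fib_cover //.
- exact: fib_measurable.
- exact: fib_triv.
Qed.

(** The integral splits over the countably many fibres of [xi], and the second
    factor is constant on each.  This takes the place of product measures. *)
Lemma integral_indep (f : T -> \bar R) (g : I -> \bar R) (c : R) :
  measurable_fun setT f -> (forall w, 0 <= f w) -> (forall i, 0 <= g i) -> (0 <= c)%R ->
  (forall i, \int[mu]_(w in xi @^-1` [set i]) f w = c%:E * mu (xi @^-1` [set i])) ->
  \int[mu]_w (f w * g (xi w)) = c%:E * \int[mu]_w g (xi w).
Proof.
move=> mf f0 g0 c0 ind.
have mg : measurable_fun setT (g \o xi) by exact: fibers_measurable_fun.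
rewrite (integral_fibers (f := fun w => f w * g (xi w))); last 2 first.
- exact: emeasurable_funM.
- by move=> w; exact: mule_ge0.
rewrite (integral_fibers (f := fun w => g (xi w))) //.
rewrite -nneseriesZl; last by move=> n _; exact: integral_ge0.
apply: eq_eseriesr => n _.
case: (fib_cases n) => [->|[i ->]]; first by rewrite !integral_set0 mule0.
transitivity (\int[mu]_(w in xi @^-1` [set i]) (g i * f w)).
  by apply: eq_integral => w; rewrite inE /= => ->; rewrite muleC.
rewrite ge0_integralZl //; last exact: measurable_funS mf.
rewrite ind muleCA; congr (_ * _).
rewrite -integral_cst //; apply: eq_integral => w.
by rewrite inE /= => ->.
Qed.

End Fibers.

Definition cX : 'I_3 := @Ordinal 3 0 isT.
Definition cY : 'I_3 := @Ordinal 3 1 isT.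
Definition cZ : 'I_3 := @Ordinal 3 2 isT.

Lemma coord_cases (i : 'I_3) : i = cX \/ i = cY \/ i = cZ.
Proof.
case: i => -[|[|[|//]]] hi; [left|right; left|right; right]; exact: val_inj.
Qed.

Lemma integral_indicr (R : realType) d (T : measurableType d) (mu : {measure set T -> \bar R})
    (A : set T) (f : T -> \bar R) :
  (\int[mu]_(w in A) f w = \int[mu]_w (f w * (\1_A w)%:E))%E.
Proof.
rewrite integral_mkcond; apply: eq_integral => w _.
by rewrite patchE indicE; case: ifP; rewrite ?mule1 ?mule0.
Qed.

Section ProductSteps.
Import finmap.
Variables (R : realType) (F : probability (lattice 3) R).
Hypothesis F_indep : mutually_independent F (@lattice_coord R 3).

Let at_ (o : option int) : set int := if o is Some x then [set x] else setT.

Lemma coord_indep (x y z : option int) :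
  F [set w | [/\ at_ x (zcoord cX w), at_ y (zcoord cY w) & at_ z (zcoord cZ w)]] =
  (F [set w | at_ x (zcoord cX w)] * F [set w | at_ y (zcoord cY w)] *
   F [set w | at_ z (zcoord cZ w)])%E.
Proof.
pose B (i : 'I_3) : set R := [set r | forall t : int,
   (if i == cX then x else if i == cY then y else z) = Some t -> r = t%:~R].
have mB i : measurable (B i).
  rewrite /B; case: (if _ then _ else _) => [t|].
    by rewrite (_ : [set _ | _] = [set t%:~R]) //; apply/seteqP; split => r /=; [apply|move=> -> t1 [<-]].
  by rewrite (_ : [set _ | _] = setT) //; apply/seteqP; split.
have BE i w : B i (lattice_coord R i w) <->
    at_ (if i == cX then x else if i == cY then y else z) (zcoord i w).
  rewrite /B /= /lattice_coord; case: (if _ then _ else _) => [t|] /=; last by split.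
  by split; [move=> /(_ _ erefl) /intr_inj|move=> <- t1 [<-]].
pose J := fsetU (fset1 cX) (fsetU (fset1 cY) (fset1 cZ)).
have := F_indep J mB.
rewrite big_fsetU1 ?big_fsetU1 ?big_seq_fset1 /=; last 2 first.
- by rewrite in_fset1.
- by rewrite in_fsetU !in_fset1.
have -> : \bigcap_(i in [set` J]) (lattice_coord R i @^-1` B i) =
    [set w | [/\ at_ x (zcoord cX w), at_ y (zcoord cY w) & at_ z (zcoord cZ w)]].
  apply/seteqP; split => w /=.
    move=> h; have hJ i : i \in J ->
      at_ (if i == cX then x else if i == cY then y else z) (zcoord i w).
    by move=> iJ; apply/BE; exact: h.
  by split; [apply: (hJ cX)|apply: (hJ cY)|apply: (hJ cZ)];
    rewrite /J !in_fsetU !in_fset1.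
  move=> [h0 h1 h2] i /=; rewrite /J !in_fsetU !in_fset1.
  by move=> /or3P[] /eqP ->; apply/BE.
move=> ->; rewrite muleA; congr (_ * _ * _)%E; congr (F _); apply/seteqP;
  by split => w /= /BE.
Qed.


Lemma coord_fibers i (y : int) : measurable (@zcoord 3 i @^-1` [set y]).
Proof. exact: lattice_measurable. Qed.

Lemma fin_F A : F A \is a fin_num.
Proof. exact: fin_num_measure. Qed.

Lemma step_opE i (g : int -> R) x : bnd g ->
  (step_op F i g x)%:E = (\int[F]_w (g (x + zcoord i w))%:E)%E.
Proof.
move=> bg; rewrite /step_op /Rintegral fineK //.
by apply: integrable_fin_num => //; exact: step_integrable.
Qed.

(** The coordinates are integrated out one at a time by [integral_indep]. *)
Lemma coord_product (g0 g1 g2 : int -> R) x0 x1 x2 : bnd g0 -> bnd g1 -> bnd g2 ->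
  (forall z, 0 <= g0 z) -> (forall z, 0 <= g1 z) -> (forall z, 0 <= g2 z) ->
  (\int[F]_w (g0 (x0 + zcoord cX w) * g1 (x1 + zcoord cY w) * g2 (x2 + zcoord cZ w))%:E =
   (step_op F cX g0 x0 * step_op F cY g1 x1 * step_op F cZ g2 x2)%:E)%E.
Proof.
move=> b0 b1 b2 p0 p1 p2.
have s_ge0 i (g : int -> R) x : (forall z, 0 <= g z) -> 0 <= step_op F i g x.
  by move=> g0'; apply: Rintegral_ge0.
pose f0 z := (g0 (x0 + z))%:E; pose f1 z := (g1 (x1 + z))%:E.
pose f2 z := (g2 (x2 + z))%:E.
have q0 z : (0 <= f0 z)%E by rewrite lee_fin.
have q1 z : (0 <= f1 z)%E by rewrite lee_fin.
have q2 z : (0 <= f2 z)%E by rewrite lee_fin.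
have mF (f : lattice 3 -> \bar R) : measurable_fun setT f.
  exact: lattice_measurable_fun.
have F0 A : 0 <= fine (F A) by apply: fine_ge0.
have h2 x y : (\int[F]_w ((\1_[set w | x = zcoord cX w /\ y = zcoord cY w] w)%:E * f2 (zcoord cZ w)) =
    (fine (F [set w | zcoord cX w = x]) * fine (F [set w | zcoord cY w = y]) *
      step_op F cZ g2 x2)%:E)%E.
  rewrite (integral_indep (c := fine (F [set w | zcoord cX w = x]) *
     fine (F [set w | zcoord cY w = y])) (coord_fibers cZ)) //.
  - by rewrite -step_opE // -EFinM.
  - exact: mulr_ge0.
  - move=> z; rewrite integral_indic //.
    have := coord_indep (Some x) (Some y) (Some z); rewrite /= => e.
    rewrite EFinM !fineK ?fin_F // -e; congr (F _).
    by apply/seteqP; split => w /= [] => [[-> ->] ->|-> -> ->].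
have h1 x : (\int[F]_w (((\1_[set w | zcoord cX w = x] w)%:E * f2 (zcoord cZ w)) * f1 (zcoord cY w)) =
    (fine (F [set w | zcoord cX w = x]) * step_op F cZ g2 x2 * step_op F cY g1 x1)%:E)%E.
  rewrite (integral_indep (c := fine (F [set w | zcoord cX w = x]) * step_op F cZ g2 x2)
     (coord_fibers cY)) //.
  - by rewrite -step_opE // -EFinM.
  - by move=> w; rewrite mule_ge0 // lee_fin.
  - by rewrite mulr_ge0 // s_ge0.
  - move=> y; rewrite integral_indicr.
    transitivity ((fine (F [set w | zcoord cX w = x]) * step_op F cZ g2 x2 *
        fine (F [set w | zcoord cY w = y]))%:E); last by rewrite EFinM fineK ?fin_F.
    rewrite mulrAC -h2; apply: eq_integral => w _.
    rewrite muleAC; congr (_ * _)%E; rewrite -EFinM; congr (_%:E).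
    rewrite !indicE -natrM mulnb; congr ((nat_of_bool _)%:R).
    apply/andP/idP => [[]|]; first by rewrite !in_setE /= => -> ->.
    by rewrite in_setE /= => -[-> ->]; rewrite !in_setE.
transitivity (\int[F]_w ((f2 (zcoord cZ w) * f1 (zcoord cY w)) * f0 (zcoord cX w)))%E.
  by apply: eq_integral => w _; rewrite -!EFinM; congr EFin; ring.
rewrite (integral_indep (c := step_op F cZ g2 x2 * step_op F cY g1 x1) (coord_fibers cX)) //.
- by rewrite -step_opE // -EFinM; congr EFin; ring.
- by move=> w; rewrite mule_ge0.
- by rewrite mulr_ge0 // s_ge0.
- move=> x; rewrite integral_indicr.
  transitivity ((step_op F cZ g2 x2 * step_op F cY g1 x1 *
      fine (F [set w | zcoord cX w = x]))%:E); last by rewrite EFinM fineK ?fin_F.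
  rewrite mulrC mulrA -h1.
  by apply: eq_integral => w _; rewrite muleC muleA.
Qed.

End ProductSteps.

Lemma integral_same_law (R : realType) d d' (T : measurableType d) (T' : measurableType d')
    (mu : {measure set T -> \bar R}) (nu : {measure set T' -> \bar R})
    (I : countType) (xi : T -> I) (eta : T' -> I) (g : I -> \bar R) :
  (forall i, measurable (xi @^-1` [set i])) ->
  (forall i, measurable (eta @^-1` [set i])) ->
  (forall i, mu (xi @^-1` [set i]) = nu (eta @^-1` [set i])) ->
  (forall i, 0 <= g i)%E ->
  (\int[mu]_w g (xi w) = \int[nu]_w g (eta w))%E.
Proof.
move=> mxi meta law g0.
rewrite (integral_fibers mu mxi) //; last exact: (fibers_measurable_fun mxi).
rewrite (integral_fibers nu meta) //; last exact: (fibers_measurable_fun meta).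
have cst d1 (T1 : measurableType d1) (m : {measure set T1 -> \bar R}) (z : T1 -> I)
    (A : set I) i : (forall i, measurable (z @^-1` [set i])) -> A = [set i] ->
    (\int[m]_(w in z @^-1` A) g (z w) = g i * m (z @^-1` [set i]))%E.
  move=> mz ->; rewrite -integral_cst //; apply: eq_integral => w.
  by rewrite inE /= => ->.
apply: eq_eseriesr => n _.
have [[i ni]|no] := pselect (exists i : I, pickle i = n).
  have Ai : [set j | pickle j = n] = [set i].
    apply/seteqP; split => j /=; last by move=> ->.
    by rewrite -ni => /(pcan_inj pickleK).
  rewrite (cst _ _ mu xi [set j | pickle j = n] i mxi Ai).
  by rewrite (cst _ _ nu eta [set j | pickle j = n] i meta Ai) law.
have e U (z : U -> I) : [set w | pickle (z w) = n] = set0.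
  by apply/seteqP; split => // w hw; apply: no; exists (z w).
by rewrite !e !integral_set0.
Qed.

Section PrefixIndep.
Import finmap.

Lemma prefix_indep (R : realType) d d' (T : measurableType d) (T' : measurableType d')
    (P : probability T R) (X : nat -> T -> T') (B : nat -> set T') k :
  mutually_independent P X -> (forall i, measurable (B i)) ->
  P ((\bigcap_(i in [set i | (i < k)%N]) X i @^-1` B i) `&` X k @^-1` B k) =
  (P (\bigcap_(i in [set i | (i < k)%N]) X i @^-1` B i) * P (X k @^-1` B k))%E.
Proof.
move=> ind mB.
have [J HJ] : exists J : {fset nat}, forall i, (i \in J) = (i < k)%N.
  elim: k => [|n [J HJ]]; first by exists fset0 => i; rewrite in_fset0.
  exists (n |` J)%fset => i.
  by rewrite in_fsetU in_fset1 HJ [RHS]ltnS [RHS]leq_eqVlt.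
have JE : [set` J] = [set i | (i < k)%N].
  by apply/seteqP; split => i /=; rewrite HJ.
have e1 := ind J B mB; have e2 := ind (k |` J)%fset B mB.
rewrite big_fsetU1 /= in e2; last by rewrite HJ ltnn.
rewrite -e1 muleC JE in e2; rewrite -e2; congr (P _).
apply/seteqP; split => w /=.
  move=> [hw1 hw2] i /=; rewrite in_fsetU in_fset1 => /orP[/eqP ->//|].
  by rewrite HJ; exact: hw1.
move=> hw; split => [i ik|].
  by apply: hw => /=; rewrite in_fsetU HJ ik orbT.
by apply: hw => /=; rewrite in_fsetU in_fset1 eqxx.
Qed.

End PrefixIndep.

Section Walk.
Variables (R : realType) (F : probability (lattice 3) R) (a : nat -> nat).
Variables (disp : measure_display) (T : measurableType disp) (P : probability T R).
Variable S : nat -> T -> lattice 3.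
Hypothesis S_walk : varying_dimension_walk 1 F a P S.

Local Notation xi := (increment S).

Definition hist (k : nat) (w : T) : seq 'rV[int]_3 := [seq xi i w | i <- iota 0 k].

Arguments hist : simpl never.

(** Events determined by the first [k] increments.  The increments take countably
    many values, so such events are measurable ([past_measurable]). *)
Definition past (k : nat) (B : set T) : Prop := forall w w',
  (forall i, (i < k)%N -> xi i w = xi i w') -> B w -> B w'.

Lemma hist_succ k w : hist k.+1 w = rcons (hist k w) (xi k w).
Proof. by rewrite /hist -(addn1 k) iotaD map_cat /= add0n cats1. Qed.

Lemma xi_fibers k (y : 'rV[int]_3) : measurable (xi k @^-1` [set y]).
Proof.
case: S_walk => _ mS _ _; have := mS k measurableT [set y].
by rewrite setTI; apply.
Qed.

Lemma hist_fibers k h : measurable (hist k @^-1` [set h]).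
Proof.
elim: k h => [|k IH] h.
  have [->|hn] := eqVneq h [::].
    by rewrite (_ : _ @^-1` _ = setT) //; apply/seteqP; split.
  by rewrite (_ : _ @^-1` _ = set0) //; apply/seteqP; split => // w /= e; rewrite -e in hn.
case/lastP: h => [|h y].
  by rewrite (_ : _ @^-1` _ = set0) //; apply/seteqP; split.
rewrite (_ : _ @^-1` _ = hist k @^-1` [set h] `&` xi k @^-1` [set y]).
  by apply: measurableI => //; exact: xi_fibers.
apply/seteqP; split => w /=; rewrite hist_succ; first by move/rcons_inj => [-> ->].
by move=> [-> ->].
Qed.

Lemma hist_eq k w w' : hist k w = hist k w' ->
  forall i, (i < k)%N -> xi i w = xi i w'.
Proof.
elim: k => // k IH; rewrite !hist_succ => /rcons_inj[e e'] i.
by rewrite ltnS leq_eqVlt => /orP[/eqP ->//|]; exact: IH.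
Qed.

Lemma past_measurable k B : past k B -> measurable B.
Proof.
move=> pB; rewrite (_ : B = hist k @^-1` (hist k @` B)).
  exact: (fibers_measurable (hist_fibers k)).
apply/seteqP; split => w; first by move=> Bw; exists w.
by move=> [w' Bw' e]; apply: (pB w') => // i; exact: hist_eq.
Qed.

Lemma past_measurable_fun k d' (U : measurableType d') (f : T -> U) :
  (forall w w', (forall i, (i < k)%N -> xi i w = xi i w') -> f w = f w') ->
  measurable_fun setT f.
Proof.
move=> hf _ Y mY; rewrite setTI; apply: (@past_measurable k) => w w' /hf e /=.
by rewrite e.
Qed.

Lemma past_mono j k B : (j <= k)%N -> past j B -> past k B.
Proof. by move=> jk pB w w' h; apply: pB => i ij; apply: h; exact: leq_trans jk. Qed.

Lemma pastI k A B : past k A -> past k B -> past k (A `&` B).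
Proof. by move=> pA pB w w' h [Aw Bw]; split; [exact: pA Aw|exact: pB Bw]. Qed.

Lemma S_succ k w : S k.+1 w = S k w + xi k w.
Proof. by rewrite /increment addrC subrK. Qed.

Lemma S_agree k w w' : (forall i, (i < k)%N -> xi i w = xi i w') ->
  forall i, (i <= k)%N -> S i w = S i w'.
Proof.
move=> h; elim=> [|i IH] ik; first by case: S_walk => S0 _ _ _; rewrite !S0.
by rewrite !S_succ h // IH // ltnW.
Qed.

Lemma past_at k j (s : lattice 3) : (j <= k)%N -> past k [set w | S j w = s].
Proof. by move=> jk w w' h /= <-; rewrite (S_agree h). Qed.

Lemma hist_indep k h (y : 'rV[int]_3) :
  P (hist k @^-1` [set h] `&` xi k @^-1` [set y]) =
  (P (hist k @^-1` [set h]) * P (xi k @^-1` [set y]))%E.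
Proof.
case: S_walk => _ _ ind _.
have [hk|hk] := eqVneq (size h) k; last first.
  rewrite (_ : hist k @^-1` _ = set0) ?set0I ?measure0 ?mul0e //.
  apply/seteqP; split => // w /= e; move: hk.
  by rewrite -e size_map size_iota eqxx.
pose B (i : nat) : set (lattice 3) := if i == k then [set y] else [set nth 0 h i].
have mB i : measurable (B i) by [].
have := prefix_indep k ind mB.
have -> : \bigcap_(i in [set i | (i < k)%N]) (xi i @^-1` B i) = hist k @^-1` [set h].
  apply/seteqP; split => w /=.
    move=> hw; apply: (@eq_from_nth _ 0); first by rewrite size_map size_iota.
    rewrite size_map size_iota => i ik.
    rewrite (nth_map 0%N) ?size_iota // nth_iota // add0n.
    by have := hw i ik; rewrite /B ltn_eqF.
  move=> e i /= ik; rewrite /B (ltn_eqF ik) /= -e.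
  by rewrite (nth_map 0%N) ?size_iota // nth_iota // add0n.
by rewrite /B eqxx.
Qed.


Local Open Scope ereal_scope.

(** Given the history the next increment has its own law, so integrating over a
    past event averages over one step. *)
Lemma one_step k B (g : lattice 3 -> \bar R) : past k B -> (forall s, 0 <= g s) ->
  \int[P]_(w in B) g (S k.+1 w) =
  \int[P]_(w in B) \int[P]_w' g (S k w + xi k w')%R.
Proof.
move=> pB g0; have mB := past_measurable pB.
have mSk n d' (U : measurableType d') (f : lattice 3 -> U) :
    measurable_fun setT (fun w => f (S n w)).
  by apply: (@past_measurable_fun n) => w w' h; rewrite (S_agree h).
have mind : measurable_fun setT (fun w => (\1_B w)%:E : \bar R).
  by apply/measurable_EFinP; exact: measurable_indic.
pose A s := \int[P]_w' g (s + xi k w')%R.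
have A0 s : 0 <= A s by exact: integral_ge0.
rewrite !(integral_indicr P B).
rewrite !(integral_fibers P (hist_fibers k)); last 4 first.
- exact: emeasurable_funM (mSk k _ _ A) mind.
- by move=> w; rewrite mule_ge0 // ?A0 // lee_fin.
- exact: emeasurable_funM (mSk k.+1 _ _ g) mind.
- by move=> w; rewrite mule_ge0 // lee_fin.
apply: eq_eseriesr => n _.
case: (fib_cases (hist k) n) => [->|[h ->]]; first by rewrite !integral_set0.
have [[w0 hw0]|no] := pselect (exists w0, hist k w0 = h); last first.
  rewrite (_ : hist k @^-1` _ = set0) ?integral_set0 //.
  by apply/seteqP; split => // w hw; apply: no; exists w.
set H := hist k @^-1` [set h].
have mH : measurable H by exact: hist_fibers.
have cstB w : H w -> (\1_B w : R) = \1_B w0.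
  move=> Hw; rewrite !indicE; congr (nat_of_bool _)%:R.
  have e : hist k w = hist k w0 by rewrite hw0.
  apply/idP/idP; rewrite !inE => Bw; apply: pB Bw => i ik; first exact: hist_eq e _ ik.
  by apply/esym; exact: hist_eq e _ ik.
have cstS w : H w -> S k w = S k w0.
  by move=> Hw; apply: (@S_agree k) => // i ik; apply: hist_eq ik; rewrite hw0.
transitivity (\int[P]_(w in H) ((\1_B w0)%:E * g (S k w0 + xi k w)%R)).
  by apply: eq_integral => w; rewrite inE => Hw; rewrite S_succ (cstS _ Hw) (cstB _ Hw) muleC.
transitivity (\int[P]_(w in H) ((\1_B w0)%:E * A (S k w0))); last first.
  by apply: eq_integral => w; rewrite inE => Hw; rewrite -/(A _) (cstS _ Hw) (cstB _ Hw) muleC.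
have mg : measurable_fun setT (fun w => g (S k w0 + xi k w)%R).
  exact: (fibers_measurable_fun (xi_fibers k) (fun y : 'rV[int]_3 => g (S k w0 + y)%R)).
have mgH : measurable_fun H (fun w => g (S k w0 + xi k w)%R) by exact: measurable_funS mg.
transitivity ((\1_B w0)%:E * ((fine (P H))%:E * A (S k w0))); last first.
  rewrite fineK ?fin_num_measure // [P H * _]muleC muleA.
  by rewrite -(integral_cst P mH).
rewrite ge0_integralZl // ?lee_fin //; congr (_ * _).
rewrite integral_indicr /A.
rewrite -(integral_indep (xi_fibers k) (f := fun w => (\1_H w)%:E)
   (g := fun y : 'rV[int]_3 => g (S k w0 + y)%R)) //.
- by apply: eq_integral => w _; rewrite muleC.
- by apply/measurable_EFinP; exact: measurable_indic.
- exact: fine_ge0.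
- move=> y; have mx := xi_fibers k y.
  by rewrite integral_indic // fineK ?fin_num_measure //; exact: hist_indep.
Qed.

End Walk.

Section Markov.
Variables (R : realType) (F : probability (lattice 3) R) (a : nat -> nat).
Variables (disp : measure_display) (T : measurableType disp) (P : probability T R).
Variable S : nat -> T -> lattice 3.
Hypothesis F_mean : mean_zero F.
Hypothesis F_var : finite_variance F.
Hypothesis F_indep : mutually_independent F (@lattice_coord R 3).
Hypothesis S_walk : varying_dimension_walk 1 F a P S.

Local Notation xi := (increment S).

(** The step from time [k] to [k.+1] moves all three coordinates. *)
Definition full (k : nat) : bool := k.+1 \in a @` [set n | (1 <= n)%N].

Definition full_steps (k : nat) : nat := \sum_(i < k) full i.

Lemma full_stepsS k : full_steps k.+1 = (full_steps k + full k)%N.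
Proof. by rewrite /full_steps big_ord_recr. Qed.

Lemma full_steps_mono j k : (j <= k)%N -> (full_steps j <= full_steps k)%N.
Proof.
move=> /subnK <-; elim: (k - j)%N => // n IH.
by rewrite addSn full_stepsS (leq_trans IH) // leq_addr.
Qed.

Let W i : is_walk (second_moment F i) (step_op F i) := is_walk_step i F_mean F_var.

Lemma iter_step_bnd i n g : bnd g -> bnd (iter n (step_op F i) g).
Proof. exact: (walk_bnd (is_walk_iter n (W i))). Qed.

Lemma iter_step_ge0 i n g : bnd g -> (forall z, 0 <= g z) ->
  forall z, 0 <= iter n (step_op F i) g z.
Proof. exact: (walk_ge0 (is_walk_iter n (W i))). Qed.

Lemma zcoordD i (s t : lattice 3) : zcoord i (s + t) = zcoord i s + zcoord i t.
Proof. by rewrite /zcoord mxE. Qed.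

Lemma step_law k (g0 g1 g2 : int -> R) (s : lattice 3) : bnd g0 -> bnd g1 -> bnd g2 ->
  (forall z, 0 <= g0 z) -> (forall z, 0 <= g1 z) -> (forall z, 0 <= g2 z) ->
  (\int[P]_w (g0 (zcoord cX (s + xi k w)) * g1 (zcoord cY (s + xi k w)) *
              g2 (zcoord cZ (s + xi k w)))%:E =
   (step_op F cX g0 (zcoord cX s) * iter (full k) (step_op F cY) g1 (zcoord cY s) *
    iter (full k) (step_op F cZ) g2 (zcoord cZ s))%:E)%E.
Proof.
move=> b0 b1 b2 p0 p1 p2; have mxi := xi_fibers S_walk k.
have mF (eta : lattice 3 -> 'rV[int]_3) (y : 'rV[int]_3) : measurable (eta @^-1` [set y]).
  exact: lattice_measurable.
pose g (y : 'rV[int]_3) : \bar R := (g0 (zcoord cX (s + (y : lattice 3))) *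
  g1 (zcoord cY (s + (y : lattice 3))) * g2 (zcoord cZ (s + (y : lattice 3))))%:E.
have gp y : (0 <= g y)%E by rewrite lee_fin !mulr_ge0.
have law y := let: And4 _ _ _ h := S_walk in h k [set y].
rewrite -/(full k) in law.
transitivity (\int[P]_w g (xi k w))%E; first by [].
case: (full k) law => law /=.
  rewrite (@integral_same_law _ _ _ _ _ _ F _ (xi k) (fun y : lattice 3 => y) g mxi) //.
  under eq_integral do rewrite /g !zcoordD.
  exact: coord_product.
rewrite (@integral_same_law _ _ _ _ _ _ F _ (xi k) (@proj_first 1 3) g mxi) //.
have := coord_product F_indep (zcoord cX s) 0 0 b0
  (bnd_cst (g1 (zcoord cY s))) (bnd_cst (g2 (zcoord cZ s))) p0 (fun=> p1 _) (fun=> p2 _).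
rewrite !(walk_cst (W _)) => <-; apply: eq_integral => y _.
by rewrite /g !zcoordD /zcoord !mxE /= !addr0.
Qed.

(** The first coordinate moves at every step and the other two only at the full
    steps, each independently of the others and of the past. *)
Lemma markov_product j B s : past S j B -> (forall w, B w -> S j w = s) ->
  forall t (g0 g1 g2 : int -> R), bnd g0 -> bnd g1 -> bnd g2 ->
  (forall z, 0 <= g0 z) -> (forall z, 0 <= g1 z) -> (forall z, 0 <= g2 z) ->
  (\int[P]_(w in B) (g0 (zcoord cX (S (j + t) w)) * g1 (zcoord cY (S (j + t) w)) *
              g2 (zcoord cZ (S (j + t) w)))%:E =
   P B * (iter t (step_op F cX) g0 (zcoord cX s) *
    iter (full_steps (j + t) - full_steps j) (step_op F cY) g1 (zcoord cY s) *
    iter (full_steps (j + t) - full_steps j) (step_op F cZ) g2 (zcoord cZ s))%:E)%E.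
Proof.
move=> pB Bs; have mB := past_measurable S_walk pB.
elim=> [|t IH] g0 g1 g2 b0 b1 b2 p0 p1 p2.
  rewrite addn0 subnn /= muleC -integral_cst //; apply: eq_integral => w.
  by rewrite inE => /Bs ->.
have jt : (full_steps j <= full_steps (j + t))%N by apply: full_steps_mono; exact: leq_addr.
rewrite addnS.
rewrite (one_step S_walk (g := fun s => (g0 (zcoord cX s) * g1 (zcoord cY s) *
   g2 (zcoord cZ s))%:E)); last 2 first.
- exact: past_mono (leq_addr _ _) pB.
- by move=> z; rewrite lee_fin !mulr_ge0.
under eq_integral do rewrite step_law //.
rewrite IH; first last.
- by apply: iter_step_ge0.
- by apply: iter_step_ge0.
- exact: (@iter_step_ge0 cX 1).
- exact: iter_step_bnd.
- exact: iter_step_bnd.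
- exact: (@iter_step_bnd cX 1).
by rewrite full_stepsS -!iterD addnBAC // -iterSr.
Qed.

Lemma lattice3_eq0 (s : lattice 3) :
  (delta R 0 (zcoord cX s) * delta R 0 (zcoord cY s) * delta R 0 (zcoord cZ s)) =
  (s == 0)%:R.
Proof.
rewrite /delta -!natrM !mulnb; congr (nat_of_bool _)%:R.
apply/idP/eqP => [|->]; last by rewrite /zcoord !mxE eqxx.
move=> /andP[/andP[/eqP h0 /eqP h1] /eqP h2].
apply/rowP => -[[|[|[|//]]] hi]; rewrite mxE.
- by rewrite -[RHS]h0; congr (_ _ _); apply: val_inj.
- by rewrite -[RHS]h1; congr (_ _ _); apply: val_inj.
- by rewrite -[RHS]h2; congr (_ _ _); apply: val_inj.
Qed.

(** [hitp n m s] is the probability that a walk at [s] is at the origin after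
    [n] steps, [m] of which are full. *)
Definition hitp (n m : nat) (s : lattice 3) : R :=
  iter n (step_op F cX) (delta R 0) (zcoord cX s) *
  iter m (step_op F cY) (delta R 0) (zcoord cY s) *
  iter m (step_op F cZ) (delta R 0) (zcoord cZ s).

Lemma S_measurable k (A : set (lattice 3)) : measurable [set w | A (S k w)].
Proof.
apply: (@past_measurable _ _ _ _ _ _ _ S_walk k) => w w' h /=.
by rewrite (S_agree S_walk h (leqnn k)).
Qed.

Lemma markov_hit j k B s : past S j B -> (forall w, B w -> S j w = s) -> (j <= k)%N ->
  (P (B `&` [set w | S k w = 0%R]) =
   P B * (hitp (k - j) (full_steps k - full_steps j) s)%:E)%E.
Proof.
move=> pB Bs jk; have mB := past_measurable S_walk pB.
have d0 := bnd_delta R 0; have dp := @delta_ge0 R 0.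
have := markov_product pB Bs (k - j) d0 d0 d0 dp dp dp.
rewrite subnKC // => <-.
have mV : measurable [set w | S k w = 0] := S_measurable k [set 0].
rewrite setIC -(integral_indic P mB mV).
apply: eq_integral => w _; rewrite lattice3_eq0 indicE; congr ((nat_of_bool _)%:R%:E).
by apply/idP/eqP; rewrite inE.
Qed.

Lemma S_law k (s : lattice 3) :
  (P [set w | S k w = s] = (iter k (step_op F cX) (delta R (zcoord cX s)) 0 *
    iter (full_steps k) (step_op F cY) (delta R (zcoord cY s)) 0 *
    iter (full_steps k) (step_op F cZ) (delta R (zcoord cZ s)) 0)%:E)%E.
Proof.
have S0 w : S 0%N w = 0 by case: S_walk.
have := @markov_product 0 setT 0 _ _ k (delta R (zcoord cX s)) (delta R (zcoord cY s)) (delta R (zcoord cZ s)).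
rewrite add0n {2 4}/full_steps big_ord0 subn0 probability_setT mul1e.
have z i : zcoord i (0 : lattice 3) = 0 by rewrite /zcoord mxE.
rewrite !z => <- //; try exact: bnd_delta; try exact: delta_ge0.
transitivity (\int[P]_w (\1_[set w | S k w = s] w)%:E)%E.
  have mV : measurable [set w | S k w = s] := S_measurable k [set s].
  by rewrite (integral_indic P measurableT mV) setIT.
apply: eq_integral => w _; rewrite indicE.
have -> : (w \in [set w | S k w = s]) = (S k w - s == 0).
  by apply/idP/eqP; rewrite inE /=; [move=> ->; rewrite subrr|move/subr0_eq].
rewrite -lattice3_eq0 /delta !(zcoordD, subr_eq0).
by congr (_%:E); rewrite /zcoord !mxE !subr_eq0.
Qed.

End Markov.

(** * Visits in a window and transience *)

Section Clock.
Variable a : nat -> nat.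
Hypothesis a_gt0 : forall n : nat, (1 <= n)%N -> (0 < a n)%N.
Hypothesis a_incr : forall m n : nat, (1 <= m)%N -> (m < n)%N -> (a m < a n)%N.

(* index [0] stands for time [0], the beginning of the window without full steps *)
Let b (n : nat) : nat := if n is 0%N then 0%N else a n.

Let b_incr n : (b n < b n.+1)%N.
Proof. by case: n => [|n]; [exact: a_gt0|exact: a_incr]. Qed.

Let b_mono m n : (m <= n)%N -> (b m <= b n)%N.
Proof. by move=> /subnK <-; elim: (n - m)%N => // k IH; apply: leq_trans IH (ltnW (b_incr _)). Qed.

Lemma full_steps_window n k : (1 <= n)%N -> (a n <= k < a n.+1)%N -> full_steps a k = n.
Proof.
suff h n' : (b n' <= k < b n'.+1)%N -> full_steps a k = n' by case: n => // n _; exact: h.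
elim: k n' => [|k IH] n' {n}.
  case: n' => [|n']; first by rewrite /full_steps big_ord0.
  by have /= := a_gt0 (isT : (1 <= n'.+1)%N); lia.
move=> /andP[h1 h2]; rewrite full_stepsS.
move: h1; rewrite leq_eqVlt => /orP[/eqP e|h1].
  case: n' e h2 => [//|n'] e h2.
  have -> : full a k by rewrite /full -e inE; exists n'.+1.
  by rewrite (IH n') ?addn1 // -ltnS -e b_incr leqnn.
have -> : full a k = false.
  apply/negP; rewrite /full inE => -[m m1 mk].
  have bm : b m = k.+1 by case: m m1 mk.
  have [mn|nm] := leqP m n'.
    by have := b_mono mn; rewrite bm leqNgt h1.
  by have := b_mono nm; rewrite bm leqNgt h2.
by rewrite addn0; apply: IH; rewrite -ltnS h1 (ltn_trans _ h2).
Qed.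

Lemma window_exists N k : (1 <= N)%N -> (a N <= k)%N ->
  exists2 n, (N <= n)%N & (a n <= k < a n.+1)%N.
Proof.
move=> N1 Nk; have bk : exists n, (k < b n)%N.
  exists k.+1; elim: k {Nk} => [|k IH]; first exact: b_incr.
  by apply: leq_ltn_trans IH (b_incr _).
case: (ex_minnP bk) => -[|n] // kn hmin.
have nk : (b n <= k)%N by rewrite leqNgt; apply/negP => /hmin; rewrite ltnn.
have Nn : (N <= n)%N.
  rewrite leqNgt; apply/negP => nN; have := b_mono nN.
  case: N N1 Nk nN => // N _ Nk _; rewrite /= in Nk * => h.
  by have := leq_ltn_trans (leq_trans h Nk) kn; rewrite ltnn.
exists n => //; apply/andP; split => //.
by case: n nk Nn {kn hmin} N1 => //; rewrite leqn0 => _ /eqP ->.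
Qed.

End Clock.

Lemma sum_window (R : realType) (G : nat -> \bar R) b g :
  (\sum_(b <= k < b + g) G k = \sum_(m < g) G (b + m)%N)%E.
Proof.
have := big_addn 0 (b + g) b xpredT G; rewrite add0n addKn => ->.
by rewrite big_mkord; apply: eq_bigr => m _; rewrite addnC.
Qed.

Section Transience.
Variables (R : realType) (F : probability (lattice 3) R) (a : nat -> nat).
Variables (disp : measure_display) (T : measurableType disp) (P : probability T R).
Variable S : nat -> T -> lattice 3.
Hypothesis F_truly : truly_dimensional F.
Hypothesis F_mean : mean_zero F.
Hypothesis F_var : finite_variance F.
Hypothesis F_indep : mutually_independent F (@lattice_coord R 3).
Hypothesis a_gt0 : forall n : nat, (1 <= n)%N -> (0 < a n)%N.
Hypothesis a_incr : forall m n : nat, (1 <= m)%N -> (m < n)%N -> (a m < a n)%N.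
Hypothesis S_walk : varying_dimension_walk 1 F a P S.

Let W i : is_walk (second_moment F i) (step_op F i) := is_walk_step i F_mean F_var.

Local Notation uu i n := (iter n (step_op F i) (delta R 0)).

Lemma coord_return_le : exists2 C, 0 < C &
  forall i k x, uu i k x <= C / Num.sqrt (k%:R + 1).
Proof.
have h i : exists2 C, 0 < C & forall k x, uu i k x <= C / Num.sqrt (k%:R + 1).
  have [[u u0 mu] [v v0 mv]] := step_atoms i F_truly F_mean.
  exact: return_le (W i) u0 v0 mu mv.
have [[A A0 hA] [B B0 hB] [C C0 hC]] := And3 (h cX) (h cY) (h cZ).
exists (A + B + C) => [|i k x]; first by rewrite !addr_gt0.
have s0 : 0 <= (Num.sqrt (k%:R + 1))^-1 :> R by rewrite invr_ge0 sqrtr_ge0.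
have [->|[->|->]] := coord_cases i.
- by apply: (le_trans (hA k x)); rewrite ler_wpM2r //; lra.
- by apply: (le_trans (hB k x)); rewrite ler_wpM2r //; lra.
- by apply: (le_trans (hC k x)); rewrite ler_wpM2r //; lra.
Qed.

Definition first_visit (s j : nat) : set T :=
  [set w | S j w = 0 /\ forall i, (s <= i < j)%N -> S i w <> 0].

Lemma past_first_visit s j : past S j (first_visit s j).
Proof.
move=> w w' h [h1 h2]; have e := S_agree S_walk h.
split; first by rewrite -e.
by move=> i /andP[si ij]; rewrite -e 1?ltnW //; apply: h2; rewrite si.
Qed.

Lemma first_visit_measurable s j : measurable (first_visit s j).
Proof. by apply: (past_measurable S_walk (k := j)); exact: past_first_visit. Qed.

Lemma first_visit_triv s : trivIset setT (fun i => first_visit s (s + i)).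
Proof.
apply/trivIsetP => i j _ _; wlog ij : i j / (i < j)%N.
  move=> hw ne; case: (ltngtP i j) => ij; first exact: hw.
    by rewrite setIC; apply: hw => //; rewrite eq_sym.
  by rewrite ij eqxx in ne.
move=> _; apply/seteqP; split => // w [[Si hi] [Sj hj]].
by apply: (hj (s + i)%N) => //; rewrite leq_addr ltn_add2l.
Qed.

Definition visit_window (s g : nat) : set T :=
  [set w | exists2 i, (i < g)%N & S (s + i) w = 0].

Lemma visit_window_first s g :
  visit_window s g = \big[setU/set0]_(i < g) first_visit s (s + i).
Proof.
rewrite -(bigcup_mkord g (fun i => first_visit s (s + i))).
apply/seteqP; split => w.
  move=> [i ig Si]; have ex : exists i, (i < g)%N && (S (s + i) w == 0).
    by exists i; rewrite ig; apply/eqP.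
  case: (ex_minnP ex) => n /andP[ng /eqP Sn] hmin; exists n => //; split => // k /andP[sk kn] Sk.
  have : (n <= k - s)%N.
    apply: hmin; rewrite subnKC //; apply/andP; split; last by apply/eqP.
    by apply: ltn_trans ng; rewrite ltn_subLR.
  by rewrite leqNgt ltn_subLR // kn.
by move=> [i ig [Si _]]; exists i.
Qed.

Lemma visit_window_measurable s g : measurable (visit_window s g).
Proof.
rewrite visit_window_first; apply: bigsetU_measurable => i _.
exact: first_visit_measurable.
Qed.

Local Open Scope ereal_scope.

(** After a first visit at time [j] in the window of index [n], the expected
    number of zeros of the first coordinate during the next [gap a n] steps is a
    full Green function.  The other two coordinates are frozen until the window
    ends, so they are read off at time [minn k (a n.+1).-1]; dropping the first
    visit then only increases the count. *)
Lemma visit_window_le n : (1 <= n)%N ->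
  P (visit_window (a n) (gap a n)) * (\sum_(i < gap a n) uu cX i 0)%:E <=
  (uu cY n 0 * uu cZ n 0 * \sum_(a n <= k < a n + 2 * gap a n) uu cX k 0)%:E.
Proof.
move=> n1; set s := a n; set g := gap a n.
have st : (s + g = a n.+1)%N by rewrite /s /g /gap subnKC // ltnW // a_incr.
have g0 : (0 < g)%N by exact: gap_gt0.
pose k' k := minn k (s + g).-1.
pose f k w : \bar R := (uu cX (k - k' k) (zcoord cX (S (k' k) w)) *
   delta R 0 (zcoord cY (S (k' k) w)) * delta R 0 (zcoord cZ (S (k' k) w)))%:E.
have ub m : bnd (uu cX m) by exact: (iter_step_bnd F_mean F_var cX m (bnd_delta R 0)).
have up m z : (0 <= uu cX m z)%R.
  exact: (iter_step_ge0 F_mean F_var cX m (bnd_delta R 0) (@delta_ge0 R 0)).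
have db := bnd_delta R 0; have dp := @delta_ge0 R 0.
have f0 k w : 0 <= f k w by rewrite lee_fin !mulr_ge0.
have mf k : measurable_fun setT (f k).
  by apply: (past_measurable_fun S_walk (k := k' k)) => w w' h; rewrite /f (S_agree S_walk h).
have win k : (s <= k < s + g)%N -> full_steps a k = n.
  by move=> hk; apply: full_steps_window => //; rewrite -st.
have d1 (s0 : lattice 3) i : s0 = 0%R -> zcoord i s0 = 0%R by move=> ->; rewrite /zcoord mxE.
have first j k : (s <= j < s + g)%N -> (j <= k)%N ->
    P (first_visit s j) * (uu cX (k - j) 0)%:E = \int[P]_(w in first_visit s j) f k w.
  move=> hj jk; have jk' : (j <= k' k)%N.
    by rewrite leq_min jk; case/andP: hj => _; case: (s + g)%N.
  have sk' : (s <= k' k < s + g)%N.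
    case/andP: hj => sj jt; rewrite (leq_trans sj jk') /=.
    by rewrite /k' gtn_min; apply/orP; right; rewrite prednK // (leq_ltn_trans _ jt).
  have Bs w : first_visit s j w -> S j w = 0%R by case.
  have pB : past S j (first_visit s j) by exact: past_first_visit.
  have k'k : (k' k <= k)%N by rewrite geq_minl.
  have kk : (k - j = (k' k - j) + (k - k' k))%N by rewrite addnC addnBA // subnK.
  have := markov_product F_mean F_var F_indep S_walk pB Bs (k' k - j)
    (ub (k - k' k)%N) db db (up _) dp dp.
  rewrite subnKC // (win _ sk') (win _ hj) subnn !(d1 _ _ erefl).
  have z0 i : (iter 0 (step_op F i) (delta R 0) 0)%R = 1%R by rewrite /= /delta eqxx.
  rewrite !z0 !mulr1.
  by move=> e; rewrite kk iterD; apply: esym; exact: e.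
have total k : (s <= k)%N -> \int[P]_w f k w = (uu cY n 0 * uu cZ n 0 * uu cX k 0)%:E.
  move=> sk; have sk' : (s <= k' k < s + g)%N.
    by move: sk g0; rewrite /k'; clear; lia.
  have S0 w : setT w -> S 0%N w = 0%R by case: S_walk.
  have pT : past S 0 setT by [].
  have := markov_product F_mean F_var F_indep S_walk pT S0 (k' k)
    (ub (k - k' k)%N) db db (up _) dp dp.
  rewrite add0n win // {1 2}/full_steps big_ord0 subn0 probability_setT mul1e.
  rewrite !(d1 _ _ erefl) -iterD => ->; congr (_%:E).
  rewrite subnKC ?geq_minl //; ring.
have mB j : measurable (first_visit s j) by exact: first_visit_measurable.
apply: (@le_trans _ _ (\sum_(i < g) P (first_visit s (s + i)) * (\sum_(i < g) uu cX i 0)%:E)).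
  rewrite -ge0_sume_distrl; last by move=> i _; exact: measure_ge0.
  apply: lee_wpmul2r; first by rewrite lee_fin; apply: sumr_ge0 => i _; exact: up.
  rewrite visit_window_first.
  exact: (Boole_inequality P (A := fun i => first_visit s (s + i))).
apply: (@le_trans _ _ (\sum_(i < g) \sum_(s <= k < s + 2 * g)
    \int[P]_(w in first_visit s (s + i)) f k w)).
  apply: lee_sum => i _; have ig := ltn_ord i.
  rewrite -sumEFin ge0_sume_distrr; last by move=> m _; rewrite lee_fin up.
  have b1 : (s <= s + i)%N by rewrite leq_addr.
  have b2 : (s + i <= s + i + g)%N by rewrite leq_addr.
  have b3 : (s + i + g <= s + 2 * g)%N by rewrite -addnA leq_add2l mul2n -addnn leq_add2r ltnW.
  rewrite (@big_cat_nat _ _ _ (s + i)) ?(leq_trans b2 b3) //=.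
  rewrite (@big_cat_nat _ _ _ (s + i + g) (s + i)) //=.
  apply: (@le_trans _ _ (\sum_(s + i <= k < s + i + g)
      \int[P]_(w in first_visit s (s + i)) f k w)).
    rewrite sum_window; apply: lee_sum => m _.
    by rewrite -first ?leq_addr ?ltn_add2l // addKn.
  apply: (@le_trans _ _ (\sum_(s + i <= k < s + i + g)
      \int[P]_(w in first_visit s (s + i)) f k w + \sum_(s + i + g <= k < s + 2 * g)
      \int[P]_(w in first_visit s (s + i)) f k w)).
    by rewrite leeDl //; apply: sume_ge0 => k _; exact: integral_ge0.
  by rewrite leeDr //; apply: sume_ge0 => k _; exact: integral_ge0.
rewrite exchange_big /=.
apply: (@le_trans _ _ (\sum_(s <= k < s + 2 * g) \int[P]_w f k w)).
  apply: lee_sum => k _.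
  have := ge0_integral_bigsetU P (F := fun i : 'I_g => first_visit s (s + i))
    (f := f k) (s := index_enum 'I_g).
  move=> <- //; last 3 first.
  - exact: index_enum_uniq.
  - by apply/trivIsetP => i j _ _ ij; have /trivIsetP h := @first_visit_triv s; exact: h.
  - exact: measurable_funS (mf k).
  apply: ge0_subset_integral => //.
  by apply: bigsetU_measurable.
rewrite mulr_sumr -sumEFin big_nat_cond [leRHS]big_nat_cond.
by apply: lee_sum => k /andP[/andP[sk _] _]; rewrite total.
Qed.


(** In [visit_window_le] the Green function is at least of order
    [sqrt (gap a n)], the frozen coordinates vanish with probability of order
    [n^-1], and the sum over [k] is of order [gap a n / sqrt (a n.+1)]. *)
Lemma visit_prob_le : exists2 C : R, (0 < C)%R & forall n, (1 <= n)%N ->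
  P (visit_window (a n) (gap a n)) <= (C * (n%:R^-1 * phi1 R a n))%:E.
Proof.
have [C C0 hC] := coord_return_le; have [c c0 hc] := green_ge (W cX).
exists (4 * C ^+ 3 / c)%R => [|n n1]; first by rewrite divr_gt0 // mulr_gt0 // exprn_gt0.
have := visit_window_le n1; set g := gap a n; set s := a n.
have g0 : (0 < g)%N by exact: gap_gt0.
have st : (s + g = a n.+1)%N by rewrite /s /g /gap subnKC // ltnW // a_incr.
have gR : (0 < g%:R :> R)%R by rewrite ltr0n.
have sg0 : (0 < Num.sqrt g%:R :> R)%R by rewrite sqrtr_gt0.
have tR : (0 < (a n.+1)%:R :> R)%R by rewrite ltr0n (aS_gt0 a_incr n1).
have st0 : (0 < Num.sqrt (a n.+1)%:R :> R)%R by rewrite sqrtr_gt0.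
have nR : (0 < n%:R :> R)%R by rewrite ltr0n.
have u0 i k : (0 <= uu i k 0)%R.
  exact: (iter_step_ge0 F_mean F_var i k (bnd_delta R 0) (@delta_ge0 R 0)).
have fP : P (visit_window s g) \is a fin_num.
  by apply: fin_num_measure; exact: visit_window_measurable.
rewrite -(fineK fP); set p := fine _.
have p0 : (0 <= p)%R by exact: fine_ge0.
rewrite -EFinM !lee_fin => h.
have hG := hc g.
have yz : (uu cY n 0 * uu cZ n 0 <= C ^+ 2 / n%:R)%R.
  have e : (C ^+ 2 / (n%:R + 1) = (C / Num.sqrt (n%:R + 1)) * (C / Num.sqrt (n%:R + 1)))%R.
    have n1p : (0 < n%:R + 1 :> R)%R by rewrite addr_gt0.
    rewrite -{1}(sqr_sqrtr (ltW n1p)); field.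
    by rewrite gt_eqF // sqrtr_gt0.
  apply: (@le_trans _ _ (C ^+ 2 / (n%:R + 1)))%R.
    by rewrite e; apply: ler_pM => //; exact: hC.
  rewrite ler_wpM2l ?sqr_ge0 // lef_pV2 ?posrE ?addr_gt0 // lerDl //.
have hx : (\sum_(s <= k < s + 2 * g) uu cX k 0 <= 4 * C * g%:R / Num.sqrt (a n.+1)%:R)%R.
  have sg2 : (s < s + 2 * g)%N by rewrite -[ltnLHS]addn0 ltn_add2l muln_gt0.
  apply: (@le_trans _ _ (C * \sum_(s <= k < s + 2 * g) (Num.sqrt ((k - 0)%:R + 1))^-1))%R.
    by rewrite mulr_sumr; apply: ler_sum => k _; rewrite subn0; exact: hC.
  apply: le_trans (ler_wpM2l (ltW C0) (sum_inv_sqrt_shift R (leq0n s) sg2)) _.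
  rewrite subn0 addKn natrM.
  have -> : (C * (2 * (2 * g%:R) / Num.sqrt (s + 2 * g)%:R) =
     4 * C * g%:R / Num.sqrt (s + 2 * g)%:R)%R by ring.
  rewrite ler_wpM2l ?mulr_ge0 ?(ltW C0) ?(ltW gR) //.
  have sp : (0 < (s + 2 * g)%:R :> R)%R by rewrite ltr0n addn_gt0 muln_gt0 g0 orbT.
  rewrite lef_pV2 ?posrE ?sqrtr_gt0 //.
  by rewrite ler_sqrt // ler_nat -st leq_add2l leq_pmull.
have h1 := le_trans (ler_wpM2l p0 hG) h.
have S0 : (0 <= \sum_(s <= k < s + 2 * g) uu cX k 0)%R by apply: sumr_ge0 => k _; exact: u0.
have h2 := le_trans h1 (ler_pM (mulr_ge0 (u0 _ _) (u0 _ _)) S0 yz hx).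
rewrite (phi_sqrt R a_incr n1) -/g.
have cs : (0 < c * Num.sqrt g%:R)%R by exact: mulr_gt0.
rewrite -(ler_pM2r cs); apply: (le_trans h2).
rewrite le_eqVlt; apply/orP; left; apply/eqP.
rewrite -{1}(sqr_sqrtr (ltW gR)); field.
by rewrite !gt_eqF.
Qed.

Lemma walk_transient : \sum_(1 <= n <oo) (n%:R^-1 * phi1 R a n)%:E < +oo -> transient P S.
Proof.
have [C C0 hC] := visit_prob_le => hsum.
pose V n := visit_window (a n.+1) (gap a n.+1).
have mV n : measurable (V n) by exact: visit_window_measurable.
have x0 n : 0 <= (n%:R^-1 * phi1 R a n)%:E.
  by rewrite lee_fin mulr_ge0 ?invr_ge0 // phi_ge0.
have sumV : \sum_(0 <= n <oo) P (V n) < +oo.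
  apply: (@le_lt_trans _ _ (\sum_(0 <= n <oo) (C%:E * ((n + 1)%:R^-1 * phi1 R a (n + 1))%:E))).
    apply: lee_nneseries => [n _ _|n _]; first exact: measure_ge0.
    by rewrite -EFinM addn1; exact: hC.
  rewrite nneseriesZl; last by move=> n _; exact: x0.
  rewrite (nneseries_addn (f := fun n => (n%:R^-1 * phi1 R a n)%:E)) //.
  by rewrite lte_mul_pinfty // lee_fin ltW.
have nul := lim_sup_set_cvg0 mV sumV.
exists (lim_sup_set V); split => //.
  apply: bigcap_measurable => [|n _]; first by exists 0%N.
  by apply: bigcup_measurable.
move=> w /= hw N _.
have [k hk Sk] : exists2 k, (a N.+1 <= k)%N & S k w = 0%R.
  apply: contrapT => no; apply: hw; apply: (@sub_finite_set _ _ `I_(a N.+1)); last exact: finite_II.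
  move=> k /= Sk; rewrite ltnNge; apply/negP => hk; apply: no; by exists k.
have [n Nn /andP[h1 h2]] := window_exists a_gt0 a_incr (isT : (1 <= N.+1)%N) hk.
case: n Nn h1 h2 => // n Nn h1 h2; exists n => //.
exists (k - a n.+1)%N; last by rewrite subnKC.
by rewrite /gap ltn_sub2r // (leq_ltn_trans h1 h2).
Qed.

End Transience.

(** * Recurrence *)

Lemma sum_symmetric_le (R : realType) (A N : nat) (x : nat -> nat -> R) :
  (forall j k, 0 <= x j k) -> (forall j k, x j k = x k j) ->
  \sum_(A <= j < N) \sum_(A <= k < N) x j k <=
  2 * \sum_(A <= j < N) \sum_(j <= k < N) x j k.
Proof.
move=> x0 xs.
have half : \sum_(A <= j < N) \sum_(A <= k < N) (j <= k)%N%:R * x j k =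
    \sum_(A <= j < N) \sum_(j <= k < N) x j k.
  apply: eq_big_nat => j /andP[Aj jN].
  rewrite (@big_cat_nat _ _ _ j A N) ?(ltnW jN) //= big_nat_cond big1 => [|k]; last first.
    by move=> /andP[/andP[_ kj] _]; rewrite leqNgt kj mul0r.
  by rewrite add0r; apply: eq_big_nat => k /andP[jk _]; rewrite jk mul1r.
have half' : \sum_(A <= j < N) \sum_(A <= k < N) (k <= j)%N%:R * x j k =
    \sum_(A <= j < N) \sum_(j <= k < N) x j k.
  rewrite exchange_big -half /=; apply: eq_bigr => j _; apply: eq_bigr => k _.
  by rewrite xs.
rewrite mulr2n mulrDl !mul1r -{1}half -half' -big_split /=.
apply: ler_sum => j _; rewrite -big_split /=; apply: ler_sum => k _.
rewrite -mulrDl ler_peMl // -natrD ler1n.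
by case: (leqP j k) => // kj; rewrite (ltnW kj).
Qed.

(** The pointwise inequality is [(1 - l * V) ^+ 2 >= 0] when some event
    occurs, where [V] is the weighted number of those that do; otherwise [V = 0]. *)
Lemma union_ge_second_moment (R : realType) d (T : measurableType d) (P : probability T R)
    (B : set T) (E : nat -> set T) (h : nat -> R) (l : R) (A N : nat) :
  measurable B -> (forall k, measurable (E k)) -> (forall k, 0 <= h k) -> 0 <= l ->
  2 * l * (\sum_(A <= k < N) h k * fine (P (B `&` E k))) <=
  fine (P (B `&` [set w | exists2 k, (A <= k < N)%N & E k w])) +
  l ^+ 2 * (\sum_(A <= j < N) \sum_(A <= k < N) h j * h k * fine (P (B `&` E j `&` E k))).
Proof.
move=> mB mE h0 l0.
set U := [set w | exists2 k, _ & _].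
have mU : measurable U.
  rewrite (_ : U = \bigcup_(k in [set k | (A <= k < N)%N]) E k); first exact: bigcup_measurable.
  by apply/seteqP; split => w [k hk Ek]; exists k.
have mBE k : measurable (B `&` E k) by exact: measurableI.
have mBEE j k : measurable (B `&` E j `&` E k) by exact: measurableI.
have mBU : measurable (B `&` U) by exact: measurableI.
have ind (X : set T) c : measurable X -> 0 <= c ->
    (\int[P]_w (c * \1_X w)%:E = (c * fine (P X))%:E)%E.
  move=> mX c0; under eq_integral do rewrite EFinM.
  rewrite ge0_integralZl //.
  - by rewrite (integral_indic P measurableT mX) setIT EFinM fineK ?fin_num_measure.
  - by apply/measurable_EFinP; exact: measurable_indic.
have mind (X : set T) c : measurable X -> measurable_fun setT (fun w => (c * \1_X w)%:E : \bar R).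
  by move=> mX; apply/measurable_EFinP; apply: measurable_funM.
have ge (X : set T) c w : 0 <= c -> (0%:E <= (c * \1_X w)%:E :> \bar R)%E.
  by move=> c0; rewrite lee_fin mulr_ge0.
rewrite -lee_fin EFinD !mulr_sumr -!sumEFin.
have -> : (\sum_(A <= k < N) (2 * l * (h k * fine (P (B `&` E k))))%:E =
    \int[P]_w \sum_(A <= k < N) (2 * l * h k * \1_(B `&` E k) w)%:E)%E.
  rewrite ge0_integral_sum //.
  - by apply: eq_bigr => k _; rewrite ind ?mulr_ge0 // mulrA.
  - by move=> k; exact: mind.
  - by move=> k w _; apply: ge; rewrite !mulr_ge0.
have -> : (\sum_(A <= j < N) (l ^+ 2 * \sum_(A <= k < N) h j * h k *
      fine (P (B `&` E j `&` E k)))%:E =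
    \int[P]_w \sum_(A <= j < N) \sum_(A <= k < N)
      (l ^+ 2 * (h j * h k) * \1_(B `&` E j `&` E k) w)%:E)%E.
  rewrite ge0_integral_sum //.
  - apply: eq_bigr => j _; rewrite ge0_integral_sum //.
    + rewrite mulr_sumr -sumEFin; apply: eq_bigr => k _.
      by rewrite ind ?mulr_ge0 ?sqr_ge0 // mulrA.
    + by move=> k; exact: mind.
    + by move=> k w _; apply: ge; rewrite !mulr_ge0.
  - by move=> j; apply: emeasurable_sum => k; exact: mind.
  - by move=> j w _; apply: sume_ge0 => k _; apply: ge; rewrite !mulr_ge0.
have -> : ((fine (P (B `&` U)))%:E = \int[P]_w (1 * \1_(B `&` U) w)%:E)%E.
  by rewrite ind // mul1r.
rewrite -ge0_integralD //; first last.
- by apply: emeasurable_sum => j; apply: emeasurable_sum => k; exact: mind.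
- by move=> w _; apply: sume_ge0 => j _; apply: sume_ge0 => k _; apply: ge; rewrite !mulr_ge0.
- exact: mind.
apply: ge0_le_integral => //.
- by move=> w _; apply: sume_ge0 => k _; apply: ge; rewrite !mulr_ge0.
- by apply: emeasurable_sum => k; exact: mind.
- apply: emeasurable_funD; first exact: mind.
  by apply: emeasurable_sum => j; apply: emeasurable_sum => k; exact: mind.
move=> w _; under [X in (_ + X)%E]eq_bigr do rewrite sumEFin.
rewrite !sumEFin -EFinD lee_fin.
pose V := \sum_(A <= k < N) h k * \1_(E k) w : R.
have e1 : \sum_(A <= k < N) 2 * l * h k * \1_(B `&` E k) w = \1_B w * (2 * l * V) :> R.
  rewrite /V !mulr_sumr; apply: eq_bigr => k _.
  by rewrite indicI /=; ring.
have e2 : \sum_(A <= j < N) \sum_(A <= k < N) l ^+ 2 * (h j * h k) *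
    \1_(B `&` E j `&` E k) w = \1_B w * (l ^+ 2 * V ^+ 2) :> R.
  have -> : V ^+ 2 = \sum_(A <= j < N) \sum_(A <= k < N)
      h j * \1_(E j) w * (h k * \1_(E k) w).
    rewrite [V ^+ 2]expr2 {1}/V mulr_suml; apply: eq_bigr => j _.
    by rewrite mulr_sumr.
  rewrite !mulr_sumr; apply: eq_bigr => j _.
  rewrite !mulr_sumr; apply: eq_bigr => k _.
  by rewrite !indicI /=; ring.
rewrite e1 e2 mul1r (indicI _ B U) /= -exprMn.
have [Bw|nBw] := pselect (B w); last first.
  by rewrite [\1_B w]indicE memNset //= !mul0r addr0.
rewrite [\1_B w]indicE mem_set //= !mul1r.
have [Uw|nUw] := pselect (U w).
  rewrite indicE mem_set //=; have := sqr_ge0 (1 - l * V) => sq.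
  have : (1 - l * V) ^+ 2 = 1 - 2 * l * V + (l * V) ^+ 2 by ring.
  by move=> e; rewrite e in sq; lra.
have -> : V = 0.
  rewrite /V big_nat_cond big1 // => k /andP[hk _].
  rewrite indicE memNset ?mulr0 // => Ek; apply: nUw; by exists k.
by rewrite !mulr0 addr_ge0 ?sqr_ge0.
Qed.

Section Recurrence.
Variables (R : realType) (F : probability (lattice 3) R) (a : nat -> nat).
Variables (disp : measure_display) (T : measurableType disp) (P : probability T R).
Variable S : nat -> T -> lattice 3.
Hypothesis F_truly : truly_dimensional F.
Hypothesis F_mean : mean_zero F.
Hypothesis F_var : finite_variance F.
Hypothesis F_indep : mutually_independent F (@lattice_coord R 3).
Hypothesis a_gt0 : forall n : nat, (1 <= n)%N -> (0 < a n)%N.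
Hypothesis a_incr : forall m n : nat, (1 <= m)%N -> (m < n)%N -> (a m < a n)%N.
Hypothesis S_walk : varying_dimension_walk 1 F a P S.

Let W i : is_walk (second_moment F i) (step_op F i) := is_walk_step i F_mean F_var.

Local Notation uu i n := (iter n (step_op F i) (delta R 0)).
Local Notation fs := (full_steps a).

Lemma coord_return_ge : exists2 c, 0 < c & exists2 L : nat, (0 < L)%N &
  forall i k0 x0, reach (step_op F i) k0 x0 ->
  exists K : nat, forall k, (K <= k)%N -> (L %| k)%N ->
    (k0 <= k)%N /\ c / Num.sqrt (k%:R + 1) <= uu i (k - k0) x0.
Proof.
have h i : exists2 c, 0 < c & exists2 L : nat, (0 < L)%N &
    forall k0 x0, reach (step_op F i) k0 x0 ->
    exists K : nat, forall k, (K <= k)%N -> (L %| k)%N ->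
      (k0 <= k)%N /\ c / Num.sqrt (k%:R + 1) <= uu i (k - k0) x0.
  have [[u u0 mu] [v v0 mv]] := step_atoms i F_truly F_mean.
  exact: return_ge (W i) u0 v0 mu mv.
have [A A0 [L LA hA]] := h cX; have [B B0 [M MB hB]] := h cY; have [C C0 [N NC hC]] := h cZ.
exists (Num.min A (Num.min B C)); first by rewrite !lt_min A0 B0.
exists (L * M * N)%N => [|i k0 x0 hx]; first by rewrite !muln_gt0 LA MB.
have s0 k : 0 <= (Num.sqrt (k%:R + 1))^-1 :> R by rewrite invr_ge0 sqrtr_ge0.
have [e|[e|e]] := coord_cases i.
- subst i; have [K hK] := hA _ _ hx; exists K => k Kk Lk.
  have [|k0k hk] := hK k Kk; first by apply: dvdn_trans Lk; rewrite -mulnA dvdn_mulr.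
  by split => //; apply: le_trans hk; rewrite ler_wpM2r // !ge_min lexx.
- subst i; have [K hK] := hB _ _ hx; exists K => k Kk Lk.
  have [|k0k hk] := hK k Kk; first by apply: dvdn_trans Lk; rewrite mulnAC dvdn_mull.
  by split => //; apply: le_trans hk; rewrite ler_wpM2r // !ge_min lexx orbT.
- subst i; have [K hK] := hC _ _ hx; exists K => k Kk Lk.
  have [|k0k hk] := hK k Kk; first by apply: dvdn_trans Lk; rewrite dvdn_mull.
  by split => //; apply: le_trans hk; rewrite ler_wpM2r // !ge_min lexx !orbT.
Qed.

Hypothesis phi_mono : forall m n : nat,
  (1 <= m)%N -> (m <= n)%N -> phi1 R a n <= phi1 R a m.
Hypothesis Phi_unbounded : forall A, exists N, A <= Phi R a N.

Lemma hitp_le : exists2 C : R, 0 < C & forall n m s,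
  hitp F n m s <= C * ((Num.sqrt (n%:R + 1))^-1 / (m%:R + 1)).
Proof.
have [C C0 hC] := coord_return_le F_truly F_mean F_var.
exists (C ^+ 3) => [|n m s]; first exact: exprn_gt0.
have mp : (0 : R) < m%:R + 1 by rewrite ltr_wpDl.
have -> : C ^+ 3 * ((Num.sqrt (n%:R + 1))^-1 / (m%:R + 1)) =
    (C / Num.sqrt (n%:R + 1)) * (C / Num.sqrt (m%:R + 1)) * (C / Num.sqrt (m%:R + 1)).
  rewrite -{1}(sqr_sqrtr (ltW mp)); field.
  by rewrite !gt_eqF // sqrtr_gt0 // ltr_wpDl.
have u0 i k z : 0 <= uu i k z.
  exact: (iter_step_ge0 F_mean F_var i k (bnd_delta R 0) (@delta_ge0 R 0)).
by rewrite /hitp; apply: ler_pM; rewrite ?mulr_ge0 //; apply: ler_pM.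
Qed.

Definition return_after (K : nat) : set T := [set w | exists2 k, (K <= k)%N & S k w = 0].

Lemma return_after_measurable K : measurable (return_after K).
Proof.
rewrite (_ : return_after K = \bigcup_(k in [set k | (K <= k)%N]) [set w | S k w = 0]).
  by apply: bigcup_measurable => k _; exact: (S_measurable S_walk k [set 0]).
by apply/seteqP; split => w [k hk Ek]; exists k.
Qed.

(** Second moment method for the visits in the windows [M] to [N], those in a
    window of length [g] having weight [g ^-1/2].  The first moment is at least
    of order [1 + Phi N] by [windows_ge], and by [kernel_sum] the second is at
    most the first times a quantity of that order.  The constant depends neither
    on the time [K] nor on the position [s]: these only affect [M]. *)
Lemma return_from : exists2 c : R, 0 < c <= 1 & forall K s B,
  (0 < P [set w | S K w = s])%E -> past S K B -> (forall w, B w -> S K w = s) ->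
  (c%:E * P B <= P (B `&` return_after K))%E.
Proof.
have [C C0 hC] := hitp_le.
have [cl cl0 [L L0 hL]] := coord_return_ge.
have nkE : forall n k, (1 <= n)%N -> (a n <= k < a n.+1)%N -> fs k = n.
  exact: full_steps_window a_gt0 a_incr.
have [cw cw0 hw] := windows_ge a_incr phi_mono nkE Phi_unbounded L0.
pose c := cl ^+ 3 * cw / (16 * C).
have c0 : 0 < c by rewrite divr_gt0 ?mulr_gt0 ?exprn_gt0.
exists (Num.min c 1) => [|K s B hs pB Bs]; first by rewrite lt_min c0 ltr01 ge_min lexx orbT.
have mB := past_measurable S_walk pB.
have fP X : measurable X -> P X \is a fin_num by move=> mX; exact: fin_num_measure.
have mS k : measurable [set w | S k w = 0] := S_measurable S_walk k [set 0].
pose p X := fine (P X).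
suff : c * p B <= p (B `&` return_after K).
  move=> h; rewrite -(fineK (fP _ mB)) -(fineK (fP (B `&` return_after K) _)); last first.
    by apply: measurableI => //; exact: return_after_measurable.
  rewrite -EFinM lee_fin; apply: le_trans h.
  by rewrite ler_wpM2r ?fine_ge0 // ge_min lexx.
have [rX rY rZ] : [/\ reach (step_op F cX) K (zcoord cX s),
    reach (step_op F cY) (fs K) (zcoord cY s) & reach (step_op F cZ) (fs K) (zcoord cZ s)].
  move: hs; rewrite (S_law F_mean F_var F_indep S_walk) lte_fin.
  have g0 i k : 0 <= iter k (step_op F i) (delta R (zcoord i s)) 0.
    exact: (iter_step_ge0 F_mean F_var i k (bnd_delta R _) (@delta_ge0 R _)).
  rewrite /reach !lt0r !g0 !andbT => /andP[+ _].
  by rewrite !mulf_eq0 !negb_or => /andP[/andP[-> ->] ->].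
have [KX hKX] := hL _ _ _ rX; have [KY hKY] := hL _ _ _ rY; have [KZ hKZ] := hL _ _ _ rZ.
pose M := (K + KX + KY + KZ + 2)%N.
have M1 : (0 < M)%N by rewrite /M addn2.
have [N MN hN] := hw M M1.
have aM : (K + KX + KY + KZ < a M)%N.
  by have := a_ge a_incr M1; rewrite /M addn2; move=> ?; lia.
pose h k := (Num.sqrt (gap a (fs k))%:R)^-1 : R.
have h0 k : 0 <= h k by rewrite invr_ge0 sqrtr_ge0.
pose E k := [set w | S k w = 0].
pose q j k := p (B `&` E j `&` E k).
have q0 j k : 0 <= q j k by exact: fine_ge0.
have in_window k : (a M <= k < a N)%N ->
    exists m, [/\ (M <= m)%N, (m < N)%N & (a m <= k < a m.+1)%N].
  move=> /andP[k1 k2]; have [m Mm hm] := window_exists a_gt0 a_incr M1 k1.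
  exists m; split => //; rewrite ltnNge; apply/negP => Nm.
  have := a_mono a_incr (leq_ltn_trans (leq0n _) MN) Nm.
  by case/andP: hm => m1 _; rewrite leqNgt (leq_ltn_trans m1).
pose D := C * (8 + 2 * Phi R a N).
have P0 := Phi_ge0 R a N.
have D0 : 0 < D by rewrite mulr_gt0 //; lra.
have pE j : 0 <= p (B `&` E j) by exact: fine_ge0.
(* [D] bounds the weighted number of later visits expected given a visit at [j] *)
have later j : (a M <= j < a N)%N ->
    \sum_(j <= k < a N) h k * q j k <= p (B `&` E j) * D.
  move=> hj; have [m [Mm mN hm]] := in_window j hj.
  have m1 : (1 <= m)%N by exact: leq_trans Mm.
  have Kj : (K <= j)%N by case/andP: hj => hj _; move: aM hj; clear; lia.
  have mBE : measurable (B `&` E j) by apply: measurableI => //; exact: mS.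
  have pBE : past S j (B `&` E j).
    apply: pastI; first exact: past_mono Kj pB.
    exact: (past_at S_walk (leqnn j)).
  have BE0 w : (B `&` E j) w -> S j w = 0 by case.
  have qE k : (j <= k)%N -> q j k = p (B `&` E j) * hitp F (k - j) (fs k - fs j) 0.
    move=> jk; rewrite /q /p (markov_hit F_mean F_var F_indep S_walk pBE BE0 jk).
    by rewrite fineM // fP.
  apply: (@le_trans _ _ (\sum_(j <= k < a N) p (B `&` E j) * C * (h k *
      ((Num.sqrt ((k - j)%:R + 1))^-1 / ((fs k - fs j)%:R + 1))))).
    rewrite big_nat_cond [leRHS]big_nat_cond; apply: ler_sum => k /andP[/andP[jk _] _].
    rewrite (qE k jk) mulrCA -!mulrA ler_wpM2l // [leRHS]mulrCA ler_wpM2l //.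
  rewrite -mulr_sumr -mulrA ler_wpM2l // /D ler_wpM2l ?(ltW C0) //.
  exact: (kernel_sum a_incr phi_mono nkE m1 mN hm).
pose e := \sum_(a M <= k < a N) h k * p (B `&` E k).
have e_ge : cl ^+ 3 * cw * (1 + Phi R a N) * p B <= e.
  apply: (@le_trans _ _ (cl ^+ 3 * p B * \sum_(a M <= k < a N)
     ((L %| k)%N && (L %| fs k)%N)%:R * (h k *
      ((Num.sqrt (k%:R + 1))^-1 / ((fs k)%:R + 1))))).
    have -> : cl ^+ 3 * cw * (1 + Phi R a N) * p B =
      cl ^+ 3 * p B * (cw * (1 + Phi R a N)) by ring.
    by rewrite ler_wpM2l // mulr_ge0 ?fine_ge0 // exprn_ge0 // ltW.
  rewrite mulr_sumr /e big_nat_cond [leRHS]big_nat_cond.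
  apply: ler_sum => k /andP[hk _].
  case: (boolP (L %| k)%N) => Lk; last by rewrite mul0r mulr0 mulr_ge0.
  case: (boolP (L %| fs k)%N) => Lf; last by rewrite mul0r mulr0 mulr_ge0.
  rewrite mul1r mulrCA ler_wpM2l //.
  have [m [Mm mN hm]] := in_window k hk.
  have fm : fs k = m by apply: nkE => //; exact: leq_trans Mm.
  have kM : (a M <= k)%N by case/andP: hk.
  have kX : (KX <= k)%N by move: aM kM; clear; lia.
  have kY : (KY <= fs k)%N by move: Mm; rewrite fm /M; clear; lia.
  have kZ : (KZ <= fs k)%N by move: Mm; rewrite fm /M; clear; lia.
  have [Kk uX] := hKX k kX Lk; have [_ uY] := hKY (fs k) kY Lf.
  have [_ uZ] := hKZ (fs k) kZ Lf.
  rewrite /p (markov_hit F_mean F_var F_indep S_walk pB Bs Kk) fineM ?fP //.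
  rewrite [leLHS](_ : _ = p B * ((cl / Num.sqrt (k%:R + 1)) *
     (cl / Num.sqrt ((fs k)%:R + 1)) * (cl / Num.sqrt ((fs k)%:R + 1)))); last first.
    have fp : (0 : R) < (fs k)%:R + 1 by rewrite ltr_wpDl.
    rewrite -{1}(sqr_sqrtr (ltW fp)) -/(p B); field.
    by rewrite !gt_eqF // sqrtr_gt0 // ltr_wpDl.
  rewrite ler_wpM2l ?fine_ge0 // /hitp /=.
  have cp x : 0 <= cl / Num.sqrt x by rewrite divr_ge0 ?sqrtr_ge0 // ltW.
  apply: (ler_pM _ (cp _) _ uZ); first exact: mulr_ge0.
  exact: (ler_pM (cp _) (cp _) uX uY).
have e0 : 0 <= e by apply: sumr_ge0 => k _; exact: mulr_ge0.
have double : \sum_(a M <= j < a N) \sum_(a M <= k < a N) h j * h k * q j k <= 2 * (D * e).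
  apply: le_trans (sum_symmetric_le _ _ _ _) _.
  - by move=> j k; rewrite !mulr_ge0.
  - by move=> j k; rewrite [h j * _]mulrC /q setIAC.
  rewrite ler_wpM2l // /e mulr_sumr big_nat_cond [leRHS]big_nat_cond.
  apply: ler_sum => j /andP[hj _].
  under eq_bigr do rewrite -mulrA.
  rewrite -mulr_sumr mulrCA ler_wpM2l // mulrC; exact: later.
have l0 : 0 <= (2 * D)^-1 by rewrite invr_ge0; lra.
have := @union_ge_second_moment R _ T P B E h (2 * D)^-1 (a M) (a N) mB mS h0 l0.
rewrite -/e -/(p _).
set U := B `&` _ => sm.
have UB : p U <= p (B `&` return_after K).
  have mU : measurable U.
    apply: measurableI => //.
    rewrite (_ : [set w | _] = \bigcup_(k in [set k | (a M <= k < a N)%N]) E k).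
      by apply: bigcup_measurable => k _; exact: mS.
    by apply/seteqP; split => w [k hk Ek]; exists k.
  have mR : measurable (B `&` return_after K).
    by apply: measurableI => //; exact: return_after_measurable.
  apply: fine_le; rewrite ?fP //; apply: le_measure; rewrite ?inE //.
  move=> w [Bw [k /andP[hk _] Ek]]; split => //; exists k => //.
  by apply: leq_trans hk; move: aM; clear; lia.
apply: le_trans UB.
have sq : (2 * D)^-1 ^+ 2 * (2 * (D * e)) = (2 * D)^-1 * e.
  by field; rewrite gt_eqF.
have := ler_wpM2l (sqr_ge0 (2 * D)^-1) double; rewrite sq => sm2.
have sm3 : (2 * D)^-1 * e <= p U by move: sm sm2; rewrite /q; lra.
apply: le_trans sm3.
rewrite [leRHS]mulrC ler_pdivlMr; last by lra.
apply: le_trans e_ge.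
have -> : c * p B * (2 * D) = cl ^+ 3 * cw * p B * ((8 + 2 * Phi R a N) / 8).
  by rewrite /c /D; field; rewrite gt_eqF.
rewrite [leRHS]mulrAC ler_wpM2l //.
  by rewrite !mulr_ge0 ?fine_ge0 ?exprn_ge0 // ltW.
lra.
Qed.


Definition avoid (k : nat) : set T := [set w | forall j, (k <= j)%N -> S j w <> 0].
Definition avoid_upto (k K : nat) : set T :=
  [set w | forall j, (k <= j <= K)%N -> S j w <> 0].

Lemma past_avoid_upto k K : past S K (avoid_upto k K).
Proof.
move=> w w' h hw j /andP[kj jK]; rewrite -(S_agree S_walk h jK).
by apply: hw; rewrite kj.
Qed.

Lemma avoid_measurable k : measurable (avoid k).
Proof.
rewrite (_ : avoid k = ~` return_after k).
  by apply: measurableC; exact: return_after_measurable.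
by apply/seteqP; split => w /= h; [move=> [j kj]; exact: h|move=> j kj Sj; apply: h; exists j].
Qed.

Local Open Scope ereal_scope.

(** Avoiding the origin for ever after time [k] means avoiding it up to [K] and
    then also after [K], which [return_from] makes less likely by a fixed
    factor, whatever the position at time [K]. *)
Lemma avoid_contract : exists2 c : R, (0 < c <= 1)%R & forall k K, (k <= K)%N ->
  P (avoid k) <= (1 - c)%:E * P (avoid_upto k K).
Proof.
have [c /andP[c0 c1] hc] := return_from; exists c => [|k K kK]; first by rewrite c0.
have c1' : (0 <= 1 - c)%R by rewrite subr_ge0.
have mA := avoid_measurable k.
have mU : measurable (avoid_upto k K).
  by apply: (past_measurable S_walk (k := K)); exact: past_avoid_upto.
have mE (X : set T) : measurable X -> measurable_fun setT (fun w => (\1_X w)%:E : \bar R).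
  by move=> mX; apply/measurable_EFinP; exact: measurable_indic.
have tot (X : set T) : measurable X -> P X = \int[P]_w (\1_X w)%:E.
  by move=> mX; rewrite (integral_indic P measurableT mX) setIT.
pose xi : T -> 'rV[int]_3 := S K.
have mxi (y : 'rV[int]_3) : measurable (xi @^-1` [set y]) := S_measurable S_walk K [set y].
rewrite (tot _ mA) (tot _ mU).
have ge (X : set T) w : 0 <= (\1_X w)%:E :> \bar R by rewrite lee_fin.
rewrite (integral_fibers P mxi (mE _ mA) (ge _)) (integral_fibers P mxi (mE _ mU) (ge _)).
rewrite -nneseriesZl; last by move=> n _; apply: integral_ge0 => w _; rewrite lee_fin.
apply: lee_nneseries => [n _ _|n _]; first by apply: integral_ge0 => w _; rewrite lee_fin.
case: (fib_cases xi n) => [->|[s ->]]; first by rewrite !integral_set0 mule0.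
have mH := mxi s.
rewrite (integral_indic P mH mA) (integral_indic P mH mU).
set H := xi @^-1` [set s].
pose B := avoid_upto k K `&` H.
have pB : past S K B.
  apply: pastI; first exact: past_avoid_upto.
  exact: (past_at S_walk (leqnn K)).
have mB : measurable B by exact: measurableI.
have Bs w : B w -> S K w = s by case.
have mR := return_after_measurable K.
have sub : avoid k `&` H `<=` B `\` (B `&` return_after K).
  move=> w [hw Hw]; split; first by split => // j /andP[kj _]; exact: hw.
  by move=> [_ [j Kj Sj]]; apply: (hw j) => //; exact: leq_trans Kj.
have mAH : measurable (avoid k `&` H) by exact: measurableI.
have mBR : measurable (B `&` return_after K) by exact: measurableI.
have fP X : measurable X -> P X \is a fin_num by move=> mX; exact: fin_num_measure.
have [Hs|Hs] := eqVneq (P H) 0.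
  apply: (@le_trans _ _ (P H)); first by apply: le_measure; rewrite ?inE // => w [].
  by rewrite Hs mule_ge0 // lee_fin.
have Hs0 : 0 < P [set w | S K w = s] by rewrite lt0e Hs measure_ge0.
have hR := hc K s B Hs0 pB Bs.
apply: (@le_trans _ _ (P (B `\` (B `&` return_after K)))).
  by apply: le_measure; rewrite ?inE //; exact: measurableD.
rewrite measureD //; last by rewrite ltey_eq fP.
rewrite setIA setIid EFinB muleBl ?fP // mul1e.
by apply: leeB.
Qed.

Lemma avoid_null k : P (avoid k) = 0.
Proof.
have [c /andP[c0 c1] hc] := avoid_contract.
have fP X : measurable X -> P X \is a fin_num by move=> mX; exact: fin_num_measure.
have mA := avoid_measurable k.
have mU K : measurable (avoid_upto k K).
  by apply: (past_measurable S_walk (k := K)); exact: past_avoid_upto.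
have capE : \bigcap_K avoid_upto k (k + K) = avoid k.
  apply/seteqP; split => w hw.
    move=> j kj; apply: (hw (j - k)%N Logic.I).
    by rewrite kj subnKC //=.
  by move=> K _ j /andP[kj _]; exact: hw.
have mono : {homo (fun K => avoid_upto k (k + K)) : n m / (n <= m)%N >-> (m <= n)%O}.
  move=> m n mn; apply/subsetPset => w hw j /andP[kj jm]; apply: hw.
  by rewrite kj (leq_trans jm) // leq_add2l.
have cv : P (avoid_upto k (k + K)) @[K --> \oo] --> P (avoid k).
  rewrite -capE; apply: nonincreasing_cvg_mu => //.
  - by rewrite ltey_eq fP.
  - by rewrite capE.
have cv2 : (1 - c)%:E * P (avoid_upto k (k + K)) @[K --> \oo] --> (1 - c)%:E * P (avoid k).
  exact: cvgeZl.
have : P (avoid k) <= (1 - c)%:E * P (avoid k).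
  rewrite -(cvg_lim _ cv2) //; apply: lime_ge; first by apply/cvg_ex; eexists; exact: cv2.
  by apply: nearW => K; apply: hc; exact: leq_addr.
rewrite -(fineK (fP _ mA)) -EFinM lee_fin => h; congr (_%:E).
have p0 : (0 <= fine (P (avoid k)))%R by exact: fine_ge0.
apply/eqP; rewrite eq_le p0 andbT -(ler_pM2l c0) mulr0; lra.
Qed.

Lemma walk_recurrent : recurrent P S.
Proof.
exists (\bigcup_k avoid k); split.
- by apply: bigcup_measurable => k _; exact: avoid_measurable.
- apply/negligibleP; first by apply: bigcup_measurable => k _; exact: avoid_measurable.
  apply: negligible_bigcup => k; apply/negligibleP; first exact: avoid_measurable.
  exact: avoid_null.
move=> w /= hw; apply: contrapT => no; apply: hw => fin; apply: no.
have /finite_seqP[l lE] := fin.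
exists (\max_(j <- l) j).+1 => // j lj Sj.
have : j \in l by have : [set` l] j by [rewrite -lE].
by move=> jl; move: lj; rewrite ltnNge => /negP; apply; exact: leq_bigmax_seq.
Qed.

End Recurrence.

Lemma Phi_diverges (R : realType) (a : nat -> nat) :
  (\sum_(1 <= n <oo) (n%:R^-1 * phi1 R a n)%:E = +oo)%E ->
  forall A, exists N, A <= Phi R a N.
Proof.
move=> div A; apply: contrapT => no.
have bound N : Phi R a N <= A.
  by rewrite leNgt; apply/negP => /ltW h; apply: no; exists N.
suff : (+oo <= A%:E)%E by rewrite leye_eq.
rewrite -div; apply: lime_le.
  apply: is_cvg_nneseries => n _ _.
  by rewrite lee_fin mulr_ge0 ?invr_ge0 // phi_ge0.
by apply: nearW => N; rewrite sumEFin lee_fin; exact: bound.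
Qed.

Unset Implicit Arguments.

Theorem theorem2p6 (R : realType) (F : probability (lattice 3) R)
    (a : nat -> nat) (disp : measure_display) (T : measurableType disp)
    (P : probability T R) (S : nat -> T -> lattice 3)
    (F_truly : truly_dimensional F)
    (F_mean : mean_zero F)
    (F_var : finite_variance F)
    (F_indep : mutually_independent F (@lattice_coord R 3))
    (a_gt0 : forall n : nat, (1 <= n)%N -> (0 < a n)%N)
    (a_incr : forall m n : nat, (1 <= m)%N -> (m < n)%N -> (a m < a n)%N)
    (S_walk : varying_dimension_walk 1 F a P S) :
  ((\sum_(1 <= n <oo) (n%:R^-1 * phi1 R a n)%:E < +oo)%E -> transient P S) /\
  ((\sum_(1 <= n <oo) (n%:R^-1 * phi1 R a n)%:E = +oo)%E ->
   (forall m n : nat, (1 <= m)%N -> (m <= n)%N -> phi1 R a n <= phi1 R a m) ->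
   recurrent P S).
Proof.
split; first exact: walk_transient F_truly F_mean F_var F_indep a_gt0 a_incr S_walk.
move=> div mono.
exact: walk_recurrent F_truly F_mean F_var F_indep a_gt0 a_incr S_walk mono (Phi_diverges div).
Qed.
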